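(* There is a polynomial-time (many-one) reduction from the max-plus-average constraint satisfaction problem to the feasibility problem for semidefinite programs.
   Context: Max-plus-average constraint satisfaction problem (max-plus-average CSP). An instance is a finite conjunction of constraints on finitely many variables, each constraint having one of the following forms: (1) $x_0 \leq \max(x_1,\dots,x_k)$ where $k \in \mathbb{N}$; (2) $x_0 \leq c + x_1$ where $c$ is a rational constant; (3) $x_0 \leq \frac{x_1+x_2}{2}$; (4) $x_0 = c$ where $c$ is a rational constant. (Here $x_0,x_1,\dots$ stand for arbitrary variables of the instance.) The computational task is to decide whether the conjunction has a solution over $\mathbb{Q} \cup \{-\infty\}$ (with the usual conventions for order and addition with $-\infty$). Rational constants in the input are given by numerator and denominator in binary. Feasibility problem for semidefinite programs. Given symmetric matrices $A_1,\dots,A_n,B \in \mathbb{Q}^{m\times m}$, decide whether there is $x \in \mathbb{R}^n$ such that $x_1A_1+\dots+x_nA_n-B \succeq 0$, where $S \succeq 0$ means that $S$ is symmetric positive semidefinite. The representation size of the input is the sum of the bit lengths of all rational numbers in the input. *)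

(* Defs.v *)
From HB Require Import structures.
From Corelib Require Import PosDef.
From mathcomp Require Import all_boot all_order all_algebra.
From mathcomp Require Import zify.
From mathcomp Require Import boolp constructive_ereal reals.

Set Implicit Arguments.
Unset Strict Implicit.
Unset Printing Implicit Defensive.

Import Order.TTheory GRing.Theory Num.Theory.
Local Open Scope ring_scope.

(** * Deterministic multi-tape Turing machines *)

Inductive move := GoLeft | Stay | GoRight.

(* A two-way infinite tape: [left_of t] lists the cells to the left of the head,
   nearest first, [right_of t] those to its right; all other cells are blank. *)
Record tape (C : Type) := Tape { left_of : seq C; under : C; right_of : seq C }.

Definition write_move (C : Type) (blank : C) (t : tape C) (am : C * move) :
    tape C :=
  let: (a, m) := am in
  match m with
  | GoLeft => Tape (behead (left_of t)) (head blank (left_of t))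
                   (a :: right_of t)
  | Stay => Tape (left_of t) a (right_of t)
  | GoRight => Tape (a :: left_of t) (head blank (right_of t))
                    (behead (right_of t))
  end.

(* [None] is the blank; [inl] are input/output symbols, [inr] auxiliary ones. *)
Definition cell (S W : Type) := option (S + W).

(* The machine has [extra_tapes.+1] tapes; tape [ord0] holds both the input and
   the output. *)
Record machine (S : finType) := Machine {
  extra_tapes : nat;
  work_symbol : finType;
  state : finType;
  start : state;
  halting : pred state;
  trans : state -> {ffun 'I_extra_tapes.+1 -> cell S work_symbol} ->
          state * {ffun 'I_extra_tapes.+1 -> cell S work_symbol * move}
}.

Section Semantics.
Variables (S : finType) (M : machine S).

Let tape := tape (cell S (work_symbol M)).

Record config := Config {
  conf_state : state M;
  conf_tapes : 'I_(extra_tapes M).+1 -> tape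
}.

Definition word_tape (w : seq S) : tape :=
  let cells : seq (cell S (work_symbol M)) := [seq Some (inl a) | a <- w] in
  Tape [::] (head None cells) (behead cells).

Definition init_config (w : seq S) : config :=
  Config (start M) (fun i => word_tape (if i == ord0 then w else [::])).

(* Halting configurations are fixed points. *)
Definition step (c : config) : config :=
  if halting (conf_state c) then c else
  let: (q, act) :=
    trans (conf_state c) [ffun i => under (conf_tapes c i)] in
  Config q (fun i => write_move None (conf_tapes c i) (act i)).

(* The longest word over [S] that starts at the head. *)
Fixpoint read_cells (s : seq (cell S (work_symbol M))) : seq S :=
  if s is Some (inl a) :: s' then a :: read_cells s' else [::].

Definition read_tape (t : tape) : seq S := read_cells (under t :: right_of t).

Definition computes_within (w : seq S) (time : nat) (w' : seq S) : Prop :=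
  let c := iter time step (init_config w) in
  halting (conf_state c) /\ read_tape (conf_tapes c ord0) = w'.

End Semantics.

(** * Polynomial-time many-one reductions *)

Record encoding (S : finType) (X : Type) := Encoding {
  encode :> X -> seq S;
  encode_inj : injective encode
}.

Definition poly_time_computable (S : finType) (X Y : Type)
    (eX : encoding S X) (eY : encoding S Y) (f : X -> Y) : Prop :=
  exists (M : machine S) (p : {poly nat}), forall x : X,
    computes_within M (eX x) p.[size (eX x)] (eY (f x)).

Definition poly_time_reducible (S : finType) (X Y : Type)
    (eX : encoding S X) (eY : encoding S Y)
    (P : X -> Prop) (Q : Y -> Prop) : Prop :=
  exists f : X -> Y, poly_time_computable eX eY f /\ forall x, P x <-> Q (f x).

(** * Max-plus-average constraint satisfaction *)

Inductive mpa_constraint :=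
  | LeMax of nat & seq nat      (* x_0 <= max(x_1, ..., x_k) *)
  | LeShift of nat & rat & nat  (* x_0 <= c + x_1 *)
  | LeAvg of nat & nat & nat    (* x_0 <= (x_1 + x_2) / 2 *)
  | EqConst of nat & rat.       (* x_0 = c *)

Definition mpa_instance := seq mpa_constraint.

(* The maximum of the empty family is -oo. *)
Definition mpa_holds (x : nat -> \bar rat) (C : mpa_constraint) : Prop :=
  match C with
  | LeMax v vs => (x v <= \big[maxe/-oo]_(u <- vs) x u)%E
  | LeShift v c u => (x v <= c%:E + x u)%E
  | LeAvg v u w => (x v <= (x u + x w) * (2^-1)%:E)%E
  | EqConst v c => x v = c%:E
  end.

Definition mpa_solvable (I : mpa_instance) : Prop :=
  exists x : nat -> \bar rat,
    (forall v, x v <> +oo%E) /\ (forall C, List.In C I -> mpa_holds x C).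

(** * Feasibility of semidefinite programs *)

Record sdp_instance := SDP {
  sdp_dim : nat;
  sdp_nvars : nat;
  sdp_A : 'I_sdp_nvars -> 'M[rat]_sdp_dim;
  sdp_B : 'M[rat]_sdp_dim;
  sdp_A_sym : forall k, (sdp_A k)^T = sdp_A k;
  sdp_B_sym : sdp_B^T = sdp_B
}.

Definition psd (R : realType) (m : nat) (S : 'M[R]_m) : Prop :=
  S^T = S /\ forall v : 'cV[R]_m, 0 <= (v^T *m S *m v) 0 0.

Definition sdp_feasible (R : realType) (P : sdp_instance) : Prop :=
  exists x : 'I_(sdp_nvars P) -> R,
    psd (\sum_k x k *: map_mx ratr (sdp_A k) - map_mx ratr (sdp_B P)).

(** * Encodings of instances as words *)

Inductive symbol :=
  | Digit of bool | Minus | Slash | Comma | Semicolon | Bar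
  | TagMax | TagShift | TagAvg | TagConst.

Definition symbols : seq symbol :=
  [:: Digit false; Digit true; Minus; Slash; Comma; Semicolon; Bar;
      TagMax; TagShift; TagAvg; TagConst].

Definition symbol_code (a : symbol) : nat :=
  match a with
  | Digit b => b | Minus => 2 | Slash => 3 | Comma => 4 | Semicolon => 5
  | Bar => 6 | TagMax => 7 | TagShift => 8 | TagAvg => 9 | TagConst => 10
  end.

Lemma symbol_codeK : pcancel symbol_code (onth symbols).
Proof. by do ?case. Qed.

HB.instance Definition _ := Countable.copy symbol (pcan_type symbol_codeK).

Lemma symbols_enumP : Finite.axiom symbols.
Proof. by do ?case. Qed.

HB.instance Definition _ := isFinite.Build symbol symbols_enumP.

(* Binary digits, least significant first. *)
Fixpoint pos_digits (p : positive) : seq symbol :=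
  match p with
  | xH => [:: Digit true]
  | xO p' => Digit false :: pos_digits p'
  | xI p' => Digit true :: pos_digits p'
  end.

Definition enc_nat (n : nat) : seq symbol :=
  if bin_of_nat n is Npos p then pos_digits p else [:: Digit false].

(* Numerator and denominator of the reduced fraction. *)
Definition enc_rat (q : rat) : seq symbol :=
  (if q < 0 then [:: Minus] else [::]) ++
  enc_nat `|numq q| ++ Slash :: enc_nat `|denq q|.

Definition terminate (t : symbol) (ws : seq (seq symbol)) : seq symbol :=
  flatten [seq rcons w t | w <- ws].

Definition enc_constraint (C : mpa_constraint) : seq symbol :=
  match C with
  | LeMax v vs => TagMax :: terminate Comma [seq enc_nat u | u <- v :: vs]
  | LeShift v c u =>
      TagShift :: terminate Comma [:: enc_nat v; enc_rat c; enc_nat u]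
  | LeAvg v u w =>
      TagAvg :: terminate Comma [:: enc_nat v; enc_nat u; enc_nat w]
  | EqConst v c => TagConst :: terminate Comma [:: enc_nat v; enc_rat c]
  end.

Definition enc_mpa (I : mpa_instance) : seq symbol :=
  terminate Semicolon [seq enc_constraint C | C <- I].

Definition enc_row (m : nat) (A : 'M[rat]_m) (i : 'I_m) : seq symbol :=
  terminate Comma [seq enc_rat (A i j) | j <- enum 'I_m].

Definition enc_matrix (m : nat) (A : 'M[rat]_m) : seq symbol :=
  terminate Semicolon [seq enc_row A i | i <- enum 'I_m].

(* The matrices A_1, ..., A_n, B, in this order. *)
Definition enc_sdp (P : sdp_instance) : seq symbol :=
  terminate Bar
    (rcons [seq enc_matrix (sdp_A k) | k <- enum 'I_(sdp_nvars P)]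
           (enc_matrix (sdp_B P))).

Lemma cat_sep_inj (t : symbol) (u v u' v' : seq symbol) :
  t \notin u -> t \notin v -> u ++ t :: u' = v ++ t :: v' -> u = v /\ u' = v'.
Proof.
elim: u v => [|a u IH] [|b v] //=.
- by move=> _ _ [].
- by move=> _; rewrite inE => /norP[/eqP + _] [].
- by rewrite inE => /norP[/eqP + _] _ [] => /[swap] ->.
- rewrite !inE => /norP[_ tu] /norP[_ tv] [-> /(IH _ tu tv) [-> ->]].
  by [].
Qed.

Lemma terminate_inj (t : symbol) (us vs : seq (seq symbol)) :
  all (fun w => t \notin w) us -> all (fun w => t \notin w) vs ->
  terminate t us = terminate t vs -> us = vs.
Proof.
elim: us vs => [|u us IH] [|v vs] //=.
- by rewrite /terminate /= => _ _; case: (v).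
- by rewrite /terminate /= => _ _; case: (u).
- move=> /andP[tu tus] /andP[tv tvs].
  rewrite /terminate /= !cat_rcons => /(cat_sep_inj tu tv) [->].
  by move=> /(IH _ tus tvs) ->.
Qed.

Lemma notin_terminate (s t : symbol) (ws : seq (seq symbol)) :
  s != t -> all (fun w => s \notin w) ws -> s \notin terminate t ws.
Proof.
move=> st /allP wsP; apply/flattenP => -[w /mapP[w' w'ws ->]].
by rewrite mem_rcons inE (negPf st) (negPf (wsP _ w'ws)).
Qed.

Lemma pos_digits_inj : injective pos_digits.
Proof.
have n0 p : pos_digits p <> [::] by case: p.
elim=> [p IH|p IH|] [q|q|] //=.
- by case=> /IH ->.
- by case=> /n0.
- by case=> /IH ->.
- by case=> /esym/n0.
Qed.

Lemma pos_digits_neq0 p : pos_digits p <> [:: Digit false].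
Proof. by case: p => [?|[?|?|]|]. Qed.

Lemma enc_nat_inj : injective enc_nat.
Proof.
move=> m n; rewrite /enc_nat => e; apply: (can_inj bin_of_natK); move: e.
case: bin_of_nat => [|p]; case: bin_of_nat => [|q] //.
- by move=> /esym/pos_digits_neq0.
- by move=> /pos_digits_neq0.
- by move=> /pos_digits_inj ->.
Qed.

Definition is_digit (a : symbol) : bool := if a is Digit _ then true else false.

Lemma enc_nat_digits n : all is_digit (enc_nat n).
Proof. by rewrite /enc_nat; case: bin_of_nat => //; elim. Qed.

Lemma notin_enc_nat (s : symbol) n : ~~ is_digit s -> s \notin enc_nat n.
Proof. by apply: contra => /(allP (enc_nat_digits n)). Qed.

Lemma notin_enc_rat (s : symbol) q :
  ~~ is_digit s -> s != Minus -> s != Slash -> s \notin enc_rat q.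
Proof.
move=> sd sm ss; rewrite /enc_rat !mem_cat inE (negPf ss).
rewrite !(negPf (notin_enc_nat _ sd)) !orbF.
by case: ifP => _; rewrite ?inE.
Qed.

Lemma enc_rat_inj : injective enc_rat.
Proof.
move=> q r; rewrite /enc_rat.
have mn n : Minus \in enc_nat n = false by apply/negP/negP/notin_enc_nat.
have sn n : Slash \notin enc_nat n by apply: notin_enc_nat.
move=> e.
have sgn : (q < 0) = (r < 0).
  move/(congr1 (fun w => Minus \in w)): (e).
  rewrite !mem_cat !inE !mn !orbF.
  by case: ifP; case: ifP.
move: e; rewrite sgn => /eqP; rewrite eqseq_cat // => /andP[_ /eqP].
move=> /(cat_sep_inj (sn _) (sn _)) [/enc_nat_inj en /enc_nat_inj ed].
rewrite -[q]divq_num_den -[r]divq_num_den; congr (_%:~R / _%:~R).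
- by move: en sgn; rewrite -!numq_lt0; lia.
- by move: ed (denq_gt0 q) (denq_gt0 r); lia.
Qed.

Lemma all_notin_map (X : Type) (f : X -> seq symbol) (s : symbol) (xs : seq X) :
  (forall x, s \notin f x) -> all (fun w => s \notin w) [seq f x | x <- xs].
Proof. by move=> fs; elim: xs => //= x xs ->; rewrite fs. Qed.

Lemma enc_constraint_inj : injective enc_constraint.
Proof.
have cn n : Comma \notin enc_nat n by apply: notin_enc_nat.
have cr q : Comma \notin enc_rat q by apply: notin_enc_rat.
have inj us vs : all (fun w => Comma \notin w) us ->
    all (fun w => Comma \notin w) vs ->
    terminate Comma us = terminate Comma vs -> us = vs.
  exact: terminate_inj.
case=> [v vs|v c u|v u w|v c] [v' vs'|v' c' u'|v' u' w'|v' c'] //= [] /inj.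
- rewrite -!map_cons !all_notin_map // => /(_ isT isT).
  by move=> /(inj_map enc_nat_inj) [-> ->].
- rewrite /= !cn !cr => /(_ isT isT) [].
  by move=> /enc_nat_inj -> /enc_rat_inj -> /enc_nat_inj ->.
- rewrite /= !cn => /(_ isT isT) [].
  by move=> /enc_nat_inj -> /enc_nat_inj -> /enc_nat_inj ->.
- rewrite /= !cn !cr => /(_ isT isT) [].
  by move=> /enc_nat_inj -> /enc_rat_inj ->.
Qed.

Lemma enc_mpa_inj : injective enc_mpa.
Proof.
have sC C : Semicolon \notin enc_constraint C.
  have sn n : Semicolon \notin enc_nat n by apply: notin_enc_nat.
  have sr q : Semicolon \notin enc_rat q by apply: notin_enc_rat.
  case: C => [v vs|v c u|v u w|v c] /=; rewrite inE /=;
    apply: notin_terminate => //=; rewrite ?sn ?sr //.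
  exact: all_notin_map.
move=> I J e; apply: (inj_map enc_constraint_inj).
by apply: terminate_inj e; apply: all_notin_map.
Qed.

Lemma notin_enc_row (s : symbol) m (A : 'M[rat]_m) i :
  ~~ is_digit s -> s != Minus -> s != Slash -> s != Comma ->
  s \notin enc_row A i.
Proof.
move=> *; apply: notin_terminate => //.
by apply: all_notin_map => j; apply: notin_enc_rat.
Qed.

Lemma enc_matrix_rows m n (A : 'M[rat]_m) (B : 'M[rat]_n) :
  enc_matrix A = enc_matrix B ->
  [seq enc_row A i | i <- enum 'I_m] = [seq enc_row B i | i <- enum 'I_n].
Proof.
by apply: terminate_inj; apply: all_notin_map => i; apply: notin_enc_row.
Qed.

Lemma enc_matrix_inj m : injective (@enc_matrix m).
Proof.
move=> A B /enc_matrix_rows/eq_in_map e; apply/matrixP => i j.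
have r C : all (fun w => Comma \notin w) [seq enc_rat (C i j) | j <- enum 'I_m].
  by apply: all_notin_map => k; apply: notin_enc_rat.
have /eq_in_map eij := terminate_inj (r A) (r B) (e i (mem_enum _ i)).
by apply/enc_rat_inj/eij; rewrite mem_enum.
Qed.

Lemma enc_sdp_inj : injective enc_sdp.
Proof.
have bM m (A : 'M[rat]_m) : Bar \notin enc_matrix A.
  apply: notin_terminate => //.
  by apply: all_notin_map => i; apply: notin_enc_row.
move=> [m n A B sA sB] [m' n' A' B' sA' sB']; rewrite /enc_sdp /=.
have bMs k p (C : 'I_k -> 'M[rat]_p) (D : 'M[rat]_p) :
    all (fun w => Bar \notin w)
      (rcons [seq enc_matrix (C i) | i <- enum 'I_k] (enc_matrix D)).
  by rewrite all_rcons bM; apply: all_notin_map.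
move=> /(terminate_inj (bMs _ _ _ _) (bMs _ _ _ _))/rcons_inj [eA eB].
have em : m = m'.
  by have /(congr1 size) := enc_matrix_rows eB; rewrite 2!size_map 2!size_enum_ord.
have en : n = n' by have /(congr1 size) := eA; rewrite 2!size_map 2!size_enum_ord.
subst m' n'; have eBB := enc_matrix_inj eB; subst B'.
have eAA : A = A'.
  apply/funext => k; apply: enc_matrix_inj.
  by move/eq_in_map: eA; apply; rewrite mem_enum.
by subst A'; congr SDP; apply: Prop_irrelevance.
Qed.

Definition mpa_encoding : encoding symbol mpa_instance := Encoding enc_mpa_inj.

Definition sdp_encoding : encoding symbol sdp_instance := Encoding enc_sdp_inj.

(* Main.v *)
Require Import Defs.
From HB Require Import structures.
From Corelib Require Import PosDef.
From mathcomp Require Import all_boot all_order all_algebra.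
From mathcomp Require Import zify ring lra.
From mathcomp Require Import boolp constructive_ereal reals sequences exp.

Set Implicit Arguments.
Unset Strict Implicit.
Unset Printing Implicit Defensive.

Import Order.TTheory GRing.Theory Num.Theory.
Local Open Scope ring_scope.

(** A solution x over the rationals and -oo of a max-plus-average instance is
turned into nonnegative reals X = 2 ^ (M x), with X = 0 for -oo. Averages become
X0 ^ 2 <= X1 X2, a semidefinite condition on a two by two matrix; shifts become
multiplications by constants; a maximum is replaced by a sum. For a huge integer
M the last replacement is harmless: it perturbs x0 <= max (x1, ..., xk) by
log2 k / M only, and a system of this kind that is solvable up to an error below
2 ^ (- O (n)) is solvable. The reason is a vertex argument
([small_slack_vanishes]): once a maximal argument is fixed in each maximum, the
error is a coordinate of a point of a polyhedron with small integral data, its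
least value is attained at a vertex, and Cramer's rule shows that this value is
0 or at least the inverse of a determinant ([solvable_of_soft]).

The number 2 ^ (M c), with c rational and M exponential in the length of the
input, has too many digits to be written down. A shift by M c is therefore itself
expressed by averages: if the text of c = p / q is read digit by digit, an unknown
that is averaged at each digit of q with one of the two sides, and multiplied by 2
or 1 / 2 before it is averaged at the digits equal to 1 of p, ends up carrying the
inequality q x0 <= p + q x1 in its exponent; further averages scale p by M
([ratio_rules], [ratio_field], [complete_ratio]). Up to sign, only the numbers
0, 1 and 2 occur in the matrices.

All unknowns are indexed by pairs of positions in the text of the instance, and
all conditions are local: what they say depends on the symbols at two positions,
on the states of a finite parser there, and on which positions coincide or follow
each other. Even the equality of variable names is enforced in this way, by an
unknown at (i, j) that is passed on to (i + 1, j + 1) as long as the digits agree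
([name_rules]). For this reason the matrices can be written by finitely many
nested loops over the positions of the input, with no arithmetic at all, and such
loop programs run in polynomial time on a Turing machine ([pprog_poly_time]). *)

(** * Structured programs for Turing machines *)

Section StructuredCode.
Variables (S W : finType) (K : nat).

Notation cells := {ffun 'I_K.+1 -> cell S W}.
Notation act := {ffun 'I_K.+1 -> cell S W * move}.

(** Actions and tests are arbitrary functions of the scanned cells, so that
conditionals need no construct of their own. *)
Inductive code :=
  | Act of (cells -> act)
  | Then of code & code
  | While of (cells -> bool) & code.

(** A tape seen from its head: cell [k] lies [k] places to the right. Lists that
differ by trailing blanks give the same function, which makes equality of tapes
extensional. *)
Definition itape := int -> cell S W.

Definition imove (t : itape) (am : cell S W * move) : itape :=
  let t' k := if k == 0 then am.1 else t k in
  match am.2 with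
  | GoLeft => fun k => t' (k - 1)
  | Stay => t'
  | GoRight => fun k => t' (k + 1)
  end.

Definition itapes := 'I_K.+1 -> itape.

Definition heads (s : itapes) : cells := [ffun i => s i 0].

Definition iact (s : itapes) (u : act) : itapes := fun i => imove (s i) (u i).

(** The number is the exact running time of the compiled machine: a loop spends one
step on each test and one on each jump back. *)
Inductive exec : code -> itapes -> nat -> itapes -> Prop :=
  | ExecAct f s : exec (Act f) s 1 (iact s (f (heads s)))
  | ExecThen c d s t s' t' s'' :
      exec c s t s' -> exec d s' t' s'' -> exec (Then c d) s (t + t') s''
  | ExecStop (b : cells -> bool) c s : ~~ b (heads s) -> exec (While b c) s 1 s
  | ExecLoop (b : cells -> bool) c s t s' t' s'' :
      b (heads s) -> exec c s t s' -> exec (While b c) s' t' s'' ->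
      exec (While b c) s (t.+2 + t') s''.

Definition idle (h : cells) : act := [ffun i => (h i, Stay)].

Definition instr := cells -> nat * act.

(** An instruction returns the address of the next one; addresses are absolute, and
[base] is the address of the first instruction. *)
Fixpoint compile (c : code) (base : nat) : seq instr :=
  match c with
  | Act f => [:: fun h => (base.+1, f h)]
  | Then c d =>
      let p := compile c base in p ++ compile d (base + size p)
  | While b c =>
      let p := compile c base.+1 in
      rcons ((fun h => (if b h then base.+1 else (base + (size p).+2)%N, idle h))
             :: p)
            (fun h => (base, idle h))
  end.

Definition code_machine (p : seq instr) : machine S :=
  @Machine S K W 'I_(size p).+1 ord0 (fun q => q == size p :> nat)
    (fun q h => let: (n, u) := nth (fun h => (0%N, idle h)) p q h in
                (inord n, u)).

Definition itape_of (t : tape (cell S W)) : itape :=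
  fun k => match k with
  | Posz 0 => under t
  | Posz n.+1 => nth None (right_of t) n
  | Negz n => nth None (left_of t) n
  end.

Lemma itape_of_write_move t am :
  itape_of (write_move None t am) = imove (itape_of t) am.
Proof.
case: am => a m; apply/funext => k; case: t => l c r; case: m; rewrite /imove /=.
- by case: k => [[|[|n]]|n] /=; rewrite ?addn0 ?nth0 ?nth_behead.
- by case: k => [[|n]|n].
- case: k => [[|n]|[|n]] /=; rewrite ?addn1 ?nth0 ?nth_behead //.
  by rewrite subn1.
Qed.

(** The address is a natural number here, because it ranges over the addresses of a
subprogram whose place in [p] varies. *)
Definition at_point (p : seq instr) (cf : config (code_machine p)) n s :=
  conf_state cf = n :> nat /\ forall i, itape_of (conf_tapes cf i) = s i.

Lemma step_at p (cf : config (code_machine p)) n s m u :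
  at_point cf n s -> (n < size p)%N ->
  nth (fun h => (0%N, idle h)) p n (heads s) = (m, u) -> (m <= size p)%N ->
  at_point (step cf) m (iact s u).
Proof.
case: cf => q tp [/= qn tps] np pn mp; rewrite /step /=.
rewrite qn ltn_eqF //.
have -> : [ffun i => under (tp i)] = heads s.
  by apply/ffunP => i; rewrite !ffunE -tps.
rewrite pn; split=> /=; first by rewrite inordK.
by move=> i; rewrite itape_of_write_move tps.
Qed.

Lemma iact_idle s : iact s (idle (heads s)) = s.
Proof.
apply/funext => i; apply/funext => k; rewrite /iact /idle !ffunE /imove /=.
by case: eqP => [->|].
Qed.

Lemma compile_correct c s t s' : exec c s t s' ->
  forall pre post p, p = pre ++ compile c (size pre) ++ post ->
  forall cf : config (code_machine p), at_point cf (size pre) s ->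
  at_point (iter t (@step _ _) cf) (size pre + size (compile c (size pre))) s'.
Proof.
elim=> {c s t s'}.
- move=> f s pre post p pE cf at_cf /=.
  rewrite addn1; apply: (step_at at_cf).
  + by rewrite pE !size_cat /=; lia.
  + by rewrite pE nth_cat ltnn subnn.
  + by rewrite pE !size_cat /=; lia.
- move=> c d s t s' t' s'' _ IHc _ IHd pre post p /= pE cf at_cf.
  rewrite addnC iterD size_cat addnA -size_cat.
  apply: (IHd (pre ++ compile c (size pre)) post).
    by rewrite pE size_cat !catA.
  rewrite size_cat.
  by apply: (IHc _ (compile d (size pre + size (compile c (size pre))) ++ post));
     rewrite // pE !catA.
- move=> b c s /negPf nb pre post p /= pE cf at_cf.
  have := @step_at p cf _ s (size pre + (size (compile c (size pre).+1)).+2)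
    (idle (heads s)) at_cf.
  rewrite iact_idle /= size_rcons; apply.
  + by rewrite pE !size_cat /= ?size_cat ?size_rcons; lia.
  + by rewrite pE nth_cat ltnn subnn /= nb.
  + by rewrite pE !size_cat /= ?size_cat ?size_rcons; lia.
- move=> b c s t s' t' s'' bs _ IHc _ IHw pre post p pE cf at_cf.
  rewrite addnC iterD; rewrite /= in pE.
  have at1 : at_point (step cf) (size pre).+1 s.
    rewrite -[s]iact_idle; apply: (step_at at_cf).
    + by rewrite pE !size_cat /= ?size_cat ?size_rcons; lia.
    + by rewrite pE nth_cat ltnn subnn /= bs.
    + by rewrite pE !size_cat /= ?size_cat ?size_rcons; lia.
  pose i0 : instr := fun h => (if b h then (size pre).+1
    else (size pre + (size (compile c (size pre).+1)).+2)%N, idle h).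
  pose i1 : instr := fun h => (size pre, idle h).
  have pE' : p = (rcons pre i0) ++
      compile c (size (rcons pre i0)) ++ (i1 :: post).
    by rewrite pE size_rcons -cats1 -!catA /= -cats1 -!catA.
  have := IHc _ _ _ pE' (step cf); rewrite size_rcons => /(_ at1) at2.
  have at3 : at_point (iter t.+2 (@step _ _) cf) (size pre) s'.
    rewrite -addn1 addSn iterS iterD.
    rewrite -[s']iact_idle; apply: (step_at at2).
    + by rewrite pE' !size_cat size_rcons /=; lia.
    + by rewrite pE' nth_cat size_rcons ltnNge leq_addr /= addKn nth_cat ltnn subnn.
    + by rewrite pE' !size_cat size_rcons /=; lia.
  exact: (IHw pre post p pE _ at3).
Qed.

Lemma read_tape_itape p (t : tape (cell S W)) (out : seq S) :
  (forall n, itape_of t (Posz n) = nth None [seq Some (inl a) | a <- out] n) ->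
  @read_tape S (code_machine p) t = out.
Proof.
move=> tE; rewrite /read_tape.
have : forall n, nth None (under t :: right_of t) n =
    nth None [seq Some (inl a) : cell S W | a <- out] n.
  by move=> n; rewrite -tE; case: n.
elim: out {tE} (under t :: right_of t) => [|a out IH] [|c l] E //=.
- by have := E 0%N; rewrite /= => ->.
- by have := E 0%N.
- by have := E 0%N; rewrite /= => ->; rewrite (IH l) // => n; have := E n.+1.
Qed.

Definition word_itape (w : seq S) : itape :=
  fun k => if k is Posz n then nth None [seq Some (inl a) | a <- w] n else None.

Definition init_itapes (w : seq S) : itapes :=
  fun i => word_itape (if i == ord0 then w else [::]).

(** Halting configurations are fixed points, so an upper bound on the running time is
enough. *)
Theorem exec_computes c (w out : seq S) t s' N : (t <= N)%N ->
  exec c (init_itapes w) t s' ->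
  (forall n, s' ord0 (Posz n) = nth None [seq Some (inl a) | a <- out] n) ->
  computes_within (code_machine (compile c 0)) w N out.
Proof.
move=> tN ex sE.
have at0 : at_point (init_config (code_machine (compile c 0)) w) 0 (init_itapes w).
  split=> // i; apply/funext => k /=.
  rewrite /word_itape /init_itapes /word_tape /=.
  by case: ifP => _; case: k => [[|n]|n] //=; rewrite ?nth_nil ?nth_behead //; case: (w).
have := compile_correct ex (pre := [::]) (post := [::]).
rewrite cats0 => /(_ _ erefl _ at0); rewrite add0n => at1.
rewrite /computes_within.
have -> : iter N (@step _ _) (init_config (code_machine (compile c 0)) w) =
   iter t (@step _ _) (init_config (code_machine (compile c 0)) w).
  rewrite -(subnK tN) iterD; set cf := iter t _ _.
  have halt : halting (conf_state cf) by case: at1 => /= ->.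
  by elim: (N - t)%N => //= m ->; rewrite /step halt.
set cf := iter t _ _ in at1 *; case: at1 => /= st tp; split; first by rewrite st.
by apply: read_tape_itape => n; rewrite tp sE.
Qed.

End StructuredCode.

(** * Nested loops over pointers into the input *)

Section PointerPrograms.
Variables (S Q T : finType) (q0 : Q) (delta : Q -> S -> Q).

(** Each symbol is paired with the state reached before it. *)
Fixpoint annotate (q : Q) (w : seq S) : seq (Q * S) :=
  if w is a :: w' then (q, a) :: annotate (delta q a) w' else [::].

(** All that a program learns about the distance from one pointer to another. *)
Definition offset_mark (d : int) : option bool :=
  if d == 0 then Some true else if d == 1 then Some false else None.

Definition view : Type :=
  ({ffun T -> option (Q * S)} * {ffun T * T -> option bool})%type.

Definition view_at (l : seq (Q * S)) (pos : T -> int) : view :=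
  ([ffun p => if pos p is Posz n then onth l n else None],
   [ffun pq => offset_mark (pos pq.2 - pos pq.1)]).

(** What is written depends on finitely many data: the annotated symbols under the
pointers and the marks of their distances. Without any other control, d nested loops
take O (n ^ d) steps. *)
Inductive pprog :=
  | Emit of (view -> seq S)
  | PSeq of pprog & pprog
  | For of T & pprog.

Definition point (pos : T -> int) (p : T) (x : int) : T -> int :=
  fun q => if q == p then x else pos q.

(** A loop also visits the position [size l] just after the word, where no symbol is
seen; a program recognizes the end of the input by it. *)
Fixpoint peval (l : seq (Q * S)) (P : pprog) (pos : T -> int) : seq S :=
  match P with
  | Emit g => g (view_at l pos)
  | PSeq P1 P2 => peval l P1 pos ++ peval l P2 pos
  | For p P1 =>
      flatten [seq peval l P1 (point pos p (Posz n)) | n <- iota 0 (size l).+1]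
  end.

(** A loop leaves its pointer at rest, so it must not move one that an enclosing loop
is still using. *)
Fixpoint nests_fresh (busy : seq T) (P : pprog) : bool :=
  match P with
  | Emit _ => true
  | PSeq P1 P2 => nests_fresh busy P1 && nests_fresh busy P2
  | For p P1 => (p \notin busy) && nests_fresh (p :: busy) P1
  end.

Definition wsym : finType := (option (Q * S) + (bool + Q))%type.

(** Besides the input tape, the machine has a tape for each pointer, one for each pair
of pointers, and one that holds the state of the automaton while the input is
loaded. *)
Definition tid : finType := (T + (T * T + unit))%type.
Notation K := #|tid|.
Notation cel := (cell S wsym).
Notation itp := (itape S wsym).

Definition by_tid (X : Type) (x : X) (f : tid -> X) (j : 'I_K.+1) : X :=
  if unlift ord0 j is Some r then f (enum_val r) else x.

Definition at_tid (r : tid) : 'I_K.+1 := lift ord0 (enum_rank r).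

Lemma by_tid0 X (x : X) f : by_tid x f ord0 = x.
Proof. by rewrite /by_tid unlift_none. Qed.

Lemma by_tidE X (x : X) f r : by_tid x f (at_tid r) = f r.
Proof. by rewrite /by_tid /at_tid liftK enum_rankK. Qed.

Definition act_of (u : cel * move) (f : tid -> cel * move) :
  {ffun 'I_K.+1 -> cel * move} := [ffun j => by_tid u f j].

Lemma iact_by_tid (t : itp) (f : tid -> itp) u g :
  iact (by_tid t f) (act_of u g) =
  by_tid (imove t u) (fun r => imove (f r) (g r)).
Proof.
apply/funext => j; rewrite /iact /act_of ffunE /by_tid.
by case: (unlift ord0 j).
Qed.

Lemma heads0 (t : itp) f : heads (by_tid t f) ord0 = t 0.
Proof. by rewrite ffunE by_tid0. Qed.

Lemma headsE (t : itp) f r : heads (by_tid t f) (at_tid r) = f r 0.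
Proof. by rewrite ffunE by_tidE. Qed.

Definition pcells (l : seq (Q * S)) : seq cel :=
  [seq Some (inr (inl (Some x))) | x <- l].

Definition cells_from (s : seq cel) (x : int) : itp :=
  fun k => if x + k is Posz n then nth None s n else None.

(** The tape of a pair of pointers contains two marks only; its head is moved together
with the pointers, so that it stands at their distance. Comparing two pointers thus
amounts to reading one cell. *)
Definition offset_itape (d : int) : itp :=
  fun k => omap (fun b => inr (inr (inl b))) (offset_mark (d + k)).

Definition reg_itape (q : Q) : itp :=
  fun k => if k == 0 then Some (inr (inr (inr q))) else None.

(** The output grows to the left, and the head rests on the blank before it. *)
Definition out_itape (out : seq S) : itp :=
  fun k => if k is Posz n.+1 then nth None [seq Some (inl a) | a <- out] n
           else None.

Definition tapes_at (s : seq cel) (q : Q) (pos : T -> int) : tid -> itp :=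
  fun r => match r with
  | inl p => cells_from s (pos p)
  | inr (inl pq) => offset_itape (pos pq.2 - pos pq.1)
  | inr (inr _) => reg_itape q
  end.

(** The last cell is an end marker: a blank there would not be told apart from the
blanks that stop the loops. *)
Definition full_cells (l : seq (Q * S)) : seq cel :=
  rcons (pcells l) (Some (inr (inl None))).

Definition canon l q pos out :=
  by_tid (out_itape out) (tapes_at (full_cells l) q pos).

Definition seen (h : {ffun 'I_K.+1 -> cel}) : view :=
  ([ffun p => if h (at_tid (inl p)) is Some (inr (inl x)) then x else None],
   [ffun pq => if h (at_tid (inr (inl pq))) is Some (inr (inr (inl b)))
               then Some b else None]).

Lemma nth_full_cells l n :
  nth None (full_cells l) n =
  if (n <= size l)%N then Some (inr (inl (onth l n))) else None.
Proof.
rewrite nth_rcons size_map; case: ltngtP => // nl.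
  rewrite ?(ltnW nl) -[X in nth _ X]map_id /pcells.
  elim: l n nl => [|x l IH] [|n] //= nl; exact: IH.
by rewrite nl; elim: l {nl} => //= x l [->].
Qed.

Lemma seen_canon l q pos out : seen (heads (canon l q pos out)) = view_at l pos.
Proof.
congr pair; apply/ffunP => x; rewrite !ffunE /canon by_tidE /=.
  rewrite /cells_from addr0; case: (pos x) => // n.
  rewrite nth_full_cells; case: leqP => // nl.
  by rewrite onth_default // ltnW.
by rewrite /offset_itape addr0; case: offset_mark.
Qed.

Definition keep (h : {ffun 'I_K.+1 -> cel}) (f : tid -> move) :
  tid -> cel * move := fun r => (h (at_tid r), f r).

Definition shift_of (p : T) (right : bool) (r : tid) : move :=
  let dir b : move := if b then GoRight else GoLeft in
  match r with
  | inl q => if q == p then dir right else Stay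
  | inr (inl (a, b)) =>
      if a == b then Stay
      else if b == p then dir right
      else if a == p then dir (~~ right) else Stay
  | inr (inr _) => Stay
  end.

Definition shift (p : T) (right : bool) : code S wsym K :=
  Act (fun h => act_of (h ord0, Stay) (keep h (shift_of p right))).

Lemma imove_keep (t : itp) m :
  imove t (t 0, m) =
  match m with
  | GoLeft => fun k => t (k - 1) | Stay => t | GoRight => fun k => t (k + 1)
  end.
Proof.
by case: m; rewrite /imove /=; apply/funext => k; case: eqP => [->|].
Qed.

Lemma cells_from_shift s x y : (fun k => cells_from s x (k + y)) = cells_from s (x + y).
Proof. by apply/funext => k; rewrite /cells_from [k + y]addrC addrA. Qed.

Lemma offset_itape_shift x y :
  (fun k => offset_itape x (k + y)) = offset_itape (x + y).
Proof. by apply/funext => k; rewrite /offset_itape [k + y]addrC addrA. Qed.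

Lemma exec_shift p right l q pos out :
  exec (shift p right) (canon l q pos out) 1
    (canon l q (point pos p (pos p + (if right then 1 else -1))) out).
Proof.
have -> : canon l q (point pos p (pos p + (if right then 1 else -1))) out =
   iact (canon l q pos out) (act_of (heads (canon l q pos out) ord0, Stay)
     (keep (heads (canon l q pos out)) (shift_of p right))); last by constructor.
rewrite iact_by_tid /canon heads0 imove_keep; congr by_tid.
apply/funext => r; rewrite /keep headsE imove_keep.
case: r => [r|[[a b]|r]] //=; rewrite /point.
  case: eqP => [->|//]; case: right => /=.
    by rewrite cells_from_shift.
  by rewrite -(cells_from_shift _ (pos p) (-1)).
have [->|ab] := eqVneq a b; first by rewrite !subrr.
have [bp|bp] := eqVneq b p.
  rewrite (negPf (_ : a != p)) -?bp //.
  case: right => /=; rewrite ?(offset_itape_shift _ 1) ?(offset_itape_shift _ (-1));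
  congr offset_itape; ring.
have [ap|//] := eqVneq a p.
case: right => /=; rewrite ?(offset_itape_shift _ 1) ?(offset_itape_shift _ (-1));
 rewrite ap; congr offset_itape; ring.
Qed.

Definition exec_within (c : code S wsym K) s (B : nat) s' :=
  exists2 t, (t <= B)%N & exec c s t s'.

Lemma execW c s t s' : exec c s t s' -> exec_within c s t s'.
Proof. by exists t. Qed.

Lemma exec_within_then c d s s' s'' A B :
  exec_within c s A s' -> exec_within d s' B s'' ->
  exec_within (Then c d) s (A + B) s''.
Proof.
move=> [t tA c_t] [t' tB d_t]; exists (t + t')%N; first exact: leq_add.
exact: ExecThen d_t.
Qed.

Definition emit1 (g : view -> seq S) (n : nat) : code S wsym K :=
  Act (fun h =>
    act_of (if onth (g (seen h)) n is Some a then (Some (inl a), GoLeft)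
            else (h ord0, Stay))
           (keep h (fun=> Stay))).

(** One machine step writes one symbol. The length of the word depends on the view, so
[n] bounds it and the steps beyond the length have no effect. *)
Fixpoint emit (g : view -> seq S) (n : nat) : code S wsym K :=
  if n is n'.+1 then Then (emit1 g n') (emit g n')
  else Act (fun h => act_of (h ord0, Stay) (keep h (fun=> Stay))).

Lemma exec_emit1 g n l q pos out :
  exec (emit1 g n) (canon l q pos out) 1
    (canon l q pos (if onth (g (view_at l pos)) n is Some a then a :: out else out)).
Proof.
have -> : canon l q pos (if onth (g (view_at l pos)) n is Some a then a :: out else out) =
   iact (canon l q pos out) (act_of
      (if onth (g (seen (heads (canon l q pos out)))) n is Some a
       then (Some (inl a), GoLeft)
       else (heads (canon l q pos out) ord0, Stay))
     (keep (heads (canon l q pos out)) (fun=> Stay))); last by constructor.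
rewrite iact_by_tid seen_canon /canon heads0; congr by_tid; last first.
  by apply/funext => r; rewrite /keep headsE imove_keep.
case: onth => [a|]; last by rewrite imove_keep.
apply/funext => k; rewrite /imove /=.
case: k => [[|[|k]]|k] //=.
Qed.

Lemma exec_emit g n l q pos out :
  exec_within (emit g n) (canon l q pos out) n.+1
    (canon l q pos (take n (g (view_at l pos)) ++ out)).
Proof.
elim: n out => [|n IH] out.
  exists 1%N => //; rewrite take0 /=.
  rewrite -[X in exec _ _ _ X](_ : iact (canon l q pos out)
     (act_of (heads (canon l q pos out) ord0, Stay)
     (keep (heads (canon l q pos out)) (fun=> Stay))) = _); first by constructor.
  rewrite iact_by_tid /canon heads0 imove_keep; congr by_tid.
  by apply/funext => r; rewrite /keep headsE imove_keep.
have ex1 := execW (exec_emit1 g n l q pos out).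
have := exec_within_then ex1 (IH _); congr exec_within; congr canon.
set v := g _.
suff -> : take n.+1 v ++ out = take n v ++ (if onth v n is Some a then a :: out else out) by [].
elim: v n {IH ex1} => [|a v IHv] [|n] //=; first by rewrite take0.
by rewrite IHv.
Qed.

Definition loaded (p : T) (h : {ffun 'I_K.+1 -> cel}) : bool :=
  h (at_tid (inl p)) != None.

Lemma loaded_canon p l q pos out :
  loaded p (heads (canon l q pos out)) = (0 <= pos p <= (size l)%:Z).
Proof.
rewrite /loaded /canon headsE /= /cells_from addr0; case: (pos p) => // n.
by rewrite nth_full_cells lez_nat; case: leqP.
Qed.

Definition max_emit (g : view -> seq S) : nat := \max_(v : view) size (g v).

(** The output grows to the left, hence everything is executed backwards: the second
program of a sequence first, and loops from right to left. A pointer at rest stands on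
the blank after the end marker, and is rewound to it after the loop. *)
Fixpoint compile_pprog (P : pprog) : code S wsym K :=
  match P with
  | Emit g => emit g (max_emit g)
  | PSeq P1 P2 => Then (compile_pprog P2) (compile_pprog P1)
  | For p P1 =>
      Then (shift p false)
     (Then (While (loaded p) (Then (compile_pprog P1) (shift p false)))
     (Then (shift p true) (While (loaded p) (shift p true))))
  end.

Fixpoint cost (P : pprog) : {poly nat} :=
  match P with
  | Emit g => (max_emit g).+1%:P
  | PSeq P1 P2 => cost P2 + cost P1
  | For _ P1 => ('X + 1) * (cost P1 + 6%:P) + 4%:P
  end.

Lemma point_point pos p x y : point (point pos p x) p y = point pos p y.
Proof. by apply/funext => r; rewrite /point; case: eqP. Qed.

Lemma point_id pos p : point pos p (pos p) = pos.
Proof. by apply/funext => r; rewrite /point; case: eqP => [->|]. Qed.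

Lemma pointE pos p x : point pos p x p = x.
Proof. by rewrite /point eqxx. Qed.

(** [n] is the number of moves left before the pointer is at rest. *)
Lemma exec_rewind p l q pos out n : (n <= (size l).+1)%N ->
  exec_within (While (loaded p) (shift p true))
    (canon l q (point pos p ((size l).+1%:Z - n%:Z)) out) (n * 3 + 1)
    (canon l q (point pos p (size l).+1%:Z) out).
Proof.
elim: n => [|n IH] nl.
  exists 1%N => //; rewrite subr0; apply: ExecStop.
  by rewrite loaded_canon pointE; lia.
have [t tn ex] := IH (ltnW nl); exists (3 + t)%N; first by rewrite mulSn; lia.
apply: (ExecLoop (t := 1)) ex; first by rewrite loaded_canon pointE; lia.
have := exec_shift p true l q (point pos p ((size l).+1%:Z - n.+1%:Z)) out.
rewrite pointE point_point; congr exec.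
by congr (canon _ _ (point _ _ _) _); lia.
Qed.

(** [n] is the number of positions left to visit. *)
Lemma exec_walk p c l q pos (body : int -> seq S) B n out :
  (n <= (size l).+1)%N ->
  (forall x out', (x < n)%N -> exec_within c (canon l q (point pos p x%:Z) out') B
     (canon l q (point pos p x%:Z) (body x%:Z ++ out'))) ->
  exec_within (While (loaded p) (Then c (shift p false)))
    (canon l q (point pos p (n%:Z - 1)) out) (n * (B + 3) + 1)
    (canon l q (point pos p (-1)) (flatten [seq body x%:Z | x <- iota 0 n] ++ out)).
Proof.
elim: n out => [|n IH] out nl cP.
  exists 1%N => //; rewrite sub0r; apply: ExecStop.
  by rewrite loaded_canon pointE.
have [t1 t1B ex1] := cP n out (leqnn _).
have [|t2 t2B ex2] := IH (body n%:Z ++ out) (ltnW nl).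
  by move=> x out' xn; apply: cP; rewrite ltnS ltnW.
exists ((t1 + 1).+2 + t2)%N; first by rewrite mulSn; lia.
have -> : n.+1%:Z - 1 = n%:Z by lia.
apply: (ExecLoop (t := t1 + 1) (s' := canon l q (point pos p (n%:Z - 1)) (body n%:Z ++ out))).
- by rewrite loaded_canon pointE; lia.
- apply: ExecThen ex1 _.
  have := exec_shift p false l q (point pos p n%:Z) (body n%:Z ++ out).
  by rewrite pointE point_point.
- by move: ex2; rewrite -[n.+1]addn1 iotaD map_cat flatten_cat /= cats0 add0n -catA.
Qed.

Lemma exec_pprog P l q busy pos out :
  nests_fresh busy P -> (forall p, p \notin busy -> pos p = (size l).+1%:Z) ->
  exec_within (compile_pprog P) (canon l q pos out) (cost P).[size l]
    (canon l q pos (peval l P pos ++ out)).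
Proof.
elim: P busy pos out => [g|P1 IH1 P2 IH2|p P IH] busy pos out /=.
- move=> _ _; rewrite hornerC.
  have := exec_emit g (max_emit g) l q pos out.
  by rewrite take_oversize // /max_emit (bigD1 (view_at l pos)) //= leq_maxl.
- move=> /andP[f1 f2] idl; rewrite hornerD -catA.
  apply: exec_within_then (IH2 _ _ _ f2 idl) (IH1 _ _ _ f1 idl).
- move=> /andP[pb fr] idl; rewrite !(hornerD, hornerM, hornerX, hornerC).
  set B := (cost P).[size l]; set n := size l.
  have posp := idl _ pb.
  have ex1 := exec_shift p false l q pos out.
  have ex2 : exec_within (While (loaded p) (Then (compile_pprog P) (shift p false)))
    (canon l q (point pos p (n.+1%:Z - 1)) out) (n.+1 * (B + 3) + 1)
    (canon l q (point pos p (-1)) (peval l (For p P) pos ++ out)).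
    apply: (exec_walk (body := fun x => peval l P (point pos p x))) => //.
    move=> x out' xn; apply: IH fr _ => r; rewrite inE negb_or => /andP[rp rb].
    by rewrite /point (negPf rp) idl.
  have ex3 := exec_shift p true l q (point pos p (-1)) (peval l (For p P) pos ++ out).
  have ex4 := @exec_rewind p l q pos (peval l (For p P) pos ++ out) n.+1 (leqnn _).
  move: ex1 ex3 ex4; rewrite posp /= pointE point_point -/n => ex1 ex3 ex4.
  rewrite -posp point_id subrr in ex4.
  have := exec_within_then (execW ex1)
    (exec_within_then ex2 (exec_within_then (execW ex3) ex4)).
  case=> t tB ex; exists t => //; move: tB; rewrite -/n.
  by move: (B); clear; nia.
Qed.

Definition reg_of (h : {ffun 'I_K.+1 -> cel}) : Q :=
  if h (at_tid (inr (inr tt))) is Some (inr (inr (inr q))) then q else q0.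

(** [setup1] and [setup2] write the two adjacent marks on the tapes of pairs and come
back to the first one, since all distances are 0 at the start. *)
Definition setup1 : code S wsym K :=
  Act (fun h => act_of (h ord0, Stay) (fun r =>
    match r with
    | inl _ => (None, Stay)
    | inr (inl _) => (Some (inr (inr (inl true))), GoRight)
    | inr (inr _) => (Some (inr (inr (inr q0))), Stay)
    end)).

Definition setup2 : code S wsym K :=
  Act (fun h => act_of (h ord0, Stay) (fun r =>
    match r with
    | inr (inl _) => (Some (inr (inr (inl false))), GoLeft)
    | _ => (h (at_tid r), Stay)
    end)).

(** The input is erased as it is copied, which leaves the tape blank for the output. *)
Definition load1 : code S wsym K :=
  Act (fun h => if h ord0 is Some (inl a) then
    act_of (None, GoRight) (fun r =>
    match r with
    | inl _ => (Some (inr (inl (Some (reg_of h, a)))), GoRight)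
    | inr (inl _) => (h (at_tid r), Stay)
    | inr (inr _) => (Some (inr (inr (inr (delta (reg_of h) a)))), Stay)
    end) else act_of (None, Stay) (fun r => (None, Stay))).

Definition load_end : code S wsym K :=
  Act (fun h => act_of (None, Stay) (fun r =>
    match r with
    | inl _ => (Some (inr (inl None)), GoRight)
    | _ => (h (at_tid r), Stay)
    end)).

Definition unload : code S wsym K :=
  Act (fun h => act_of (None, GoRight) (keep h (fun=> Stay))).

Definition reading (h : {ffun 'I_K.+1 -> cel}) : bool := h ord0 != None.

Definition program (P : pprog) : code S wsym K :=
  Then (Then setup1 setup2)
  (Then (While reading load1) (Then load_end (Then (compile_pprog P) unload))).

Definition loading l q w : itapes S wsym K :=
  by_tid (word_itape wsym w) (tapes_at (pcells l) q (fun=> (size l)%:Z)).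

Lemma exec_setup w :
  exec (Then setup1 setup2) (@init_itapes S wsym K w) 2 (loading [::] q0 w).
Proof.
have -> : @init_itapes S wsym K w = by_tid (word_itape wsym w) (fun=> fun=> None).
  apply/funext => j; rewrite /init_itapes /by_tid.
  case: unliftP => [i|] ->; last by rewrite eqxx.
  apply/funext => -[k|k] //=; by rewrite nth_nil.
have -> : 2%N = (1 + 1)%N by [].
set s := by_tid _ _.
apply: (ExecThen (s' := iact s (act_of (heads s ord0, Stay) (fun r =>
    match r with
    | inl _ => (None, Stay)
    | inr (inl _) => (Some (inr (inr (inl true))), GoRight)
    | inr (inr _) => (Some (inr (inr (inr q0))), Stay)
    end)))); first exact: ExecAct.
rewrite {}/s iact_by_tid heads0 imove_keep; set s := by_tid _ _.
rewrite [X in exec _ _ _ X](_ : _ = iact s (act_of (heads s ord0, Stay) (fun r =>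
    match r with
    | inr (inl _) => (Some (inr (inr (inl false))), GoLeft)
    | _ => (heads s (at_tid r), Stay)
    end))); first exact: ExecAct.
rewrite {}/s iact_by_tid heads0 imove_keep; congr by_tid.
apply/funext => -[r|[[a b]|r]]; rewrite ?headsE /=; apply/funext => k.
- by rewrite /imove /= /cells_from /=; case: eqP => _; case: (_ + _) => // n; rewrite nth_nil.
- rewrite subrr /imove /offset_itape /offset_mark /= add0r.
  case: k => [[|[|k]]|k] //=.
- by rewrite /imove /reg_itape /=; case: eqP.
Qed.

Lemma exec_load l q w :
  exec_within (While reading load1) (loading l q w) (size w * 3 + 1)
    (loading (l ++ annotate q w) (foldl delta q w) [::]).
Proof.
elim: w l q => [|a w IH] l q.
  exists 1%N => //=; rewrite cats0; apply: ExecStop.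
  by rewrite /reading heads0.
have [t tB ex] := IH (rcons l (q, a)) (delta q a).
exists (3 + t)%N; first by rewrite /= mulSn; lia.
apply: (ExecLoop (t := 1) (s' := loading (rcons l (q, a)) (delta q a) w)).
- by rewrite /reading heads0.
- set s := loading _ _ (a :: w).
  have regE : reg_of (heads s) = q by rewrite /reg_of headsE.
  rewrite [X in exec _ _ _ X](_ : _ = iact s (
    if heads s ord0 is Some (inl a) then
    act_of (None, GoRight) (fun r =>
    match r with
    | inl _ => (Some (inr (inl (Some (reg_of (heads s), a)))), GoRight)
    | inr (inl _) => (heads s (at_tid r), Stay)
    | inr (inr _) => (Some (inr (inr (inr (delta (reg_of (heads s)) a)))), Stay)
    end) else act_of (None, Stay) (fun r => (None, Stay)))); first exact: ExecAct.
  rewrite regE heads0 /= iact_by_tid; congr by_tid.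
    by apply/funext => -[k|[|k]]; rewrite /imove //= addn1 //; case: eqP => //; lia.
  apply/funext => -[r|[[b c]|r]] /=.
  + apply/funext => k; rewrite /imove /= /cells_from size_rcons.
    have -> : (size l)%:Z + (k + 1) = (size l).+1%:Z + k by lia.
    rewrite /pcells map_rcons; case E : (_ + k) => [n|n]; last first.
      by rewrite ifF //; lia.
    rewrite nth_rcons size_map; case: ltngtP => nl.
    * by rewrite ifF //; lia.
    * by rewrite ifF ?nth_default // ?size_map; lia.
    * by rewrite ifT //; lia.
  + by rewrite /s /loading headsE imove_keep /= !subrr.
  + by apply/funext => k; rewrite /imove /reg_itape /=; case: eqP.
- by move: ex; rewrite cat_rcons.
Qed.

Lemma exec_load_end l q :
  exec load_end (loading l q [::]) 1
    (canon l q (fun=> (size l).+1%:Z) [::]).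
Proof.
set s := loading l q [::].
rewrite [X in exec _ _ _ X](_ : _ = iact s (act_of (None, Stay) (fun r =>
    match r with
    | inl _ => (Some (inr (inl None)), GoRight)
    | _ => (heads s (at_tid r), Stay)
    end))); first exact: ExecAct.
rewrite iact_by_tid; congr by_tid.
  by apply/funext => -[[|k]|k] //=; rewrite /imove /= nth_nil.
apply/funext => -[r|[[b c]|r]] /=.
- apply/funext => k; rewrite /imove /= /cells_from.
  have -> : (size l)%:Z + (k + 1) = (size l).+1%:Z + k by lia.
  rewrite /full_cells; case E : (_ + k) => [n|n]; last first.
    by rewrite ifF //; lia.
  rewrite nth_rcons size_map; case: ltngtP => nl.
  + by rewrite ifF //; lia.
  + by rewrite ifF ?nth_default // ?size_map; lia.
  + by rewrite ifT //; lia.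
- by rewrite /s /loading headsE imove_keep /= !subrr.
- by rewrite /s /loading headsE imove_keep.
Qed.

Lemma size_annotate q w : size (annotate q w) = size w.
Proof. by elim: w q => //= a w IH q; rewrite IH. Qed.

Lemma exec_program P w :
  nests_fresh [::] P ->
  let out := peval (annotate q0 w) P (fun=> (size w).+1%:Z) in
  exists2 s', exec_within (program P) (@init_itapes S wsym K w)
    (('X * 3%:P + 1 + cost P + 4%:P).[size w]) s' &
    forall n, s' ord0 (Posz n) = nth None [seq Some (inl a) | a <- out] n.
Proof.
move=> fr out; set l := annotate q0 w in out *.
have sl : size l = size w by rewrite size_annotate.
set q := foldl delta q0 w.
have ex1 := execW (exec_setup w).
have ex2 := exec_load [::] q0 w.
have ex3 := execW (exec_load_end l q).
have ex4 := @exec_pprog P l q [::] (fun=> (size l).+1%:Z) [::] fr (fun _ _ => erefl).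
rewrite cats0 [in peval _ _ _]sl -/out in ex4.
have ex5 := execW (ExecAct (fun h => act_of (None, GoRight) (keep h (fun=> Stay)))
   (canon l q (fun=> (size l).+1%:Z) out)).
have := exec_within_then ex1 (exec_within_then ex2
  (exec_within_then ex3 (exec_within_then ex4 ex5))).
set s' := iact _ _ => -[t tB ex]; exists s'.
  exists t => //; rewrite !(hornerD, hornerM, hornerX, hornerC) -sl.
  by move: tB; rewrite -sl; move: (cost P).[size l]; clear; lia.
move=> n; rewrite /s' iact_by_tid by_tid0 /imove /=.
by rewrite ifF ?addn1 //; lia.
Qed.

End PointerPrograms.

(** Loop programs are closed under all that the reduction needs, and their running time
is bounded by the polynomial [cost], computed from their syntax. *)
Theorem pprog_poly_time (S Q T : finType) (q0 : Q) (delta : Q -> S -> Q)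
    (X Y : Type) (eX : encoding S X) (eY : encoding S Y) (f : X -> Y)
    (P : pprog S Q T) :
  nests_fresh [::] P ->
  (forall x, eY (f x) =
     peval (annotate delta q0 (eX x)) P (fun=> (size (eX x)).+1%:Z)) ->
  poly_time_computable eX eY f.
Proof.
move=> fr fE; exists (code_machine (compile (program q0 delta P) 0)).
exists ('X * 3%:P + 1 + cost P + 4%:P) => x.
have [s' [t tB ex] sE] := exec_program q0 delta (eX x) fr.
by apply: exec_computes tB ex _ => n; rewrite sE fE.
Qed.

(** * Vertices of integral systems of inequalities *)

(** Laplace expansion: deleting a column does not increase the norm of a row. *)
Lemma det_norm_le n (M : 'M[int]_n) (c : int) :
  0 <= c -> (forall i, \sum_j `|M i j| <= c) -> `|\det M| <= c ^+ n.
Proof.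
move=> c0; elim: n M => [|n IH] M Mc; first by rewrite det_mx00 expr0.
rewrite (expand_det_row M ord0) exprS.
apply: (le_trans (ler_norm_sum _ _ _)).
apply: (le_trans (y := \sum_j `|M ord0 j| * c ^+ n)); last first.
  by rewrite -mulr_suml ler_wpM2r ?exprn_ge0.
apply: ler_sum => j _; rewrite normrM ler_wpM2l // /cofactor normrM normrX normrN1.
rewrite expr1n mul1r; apply: IH => i.
apply: le_trans (Mc (lift ord0 i)).
rewrite [leRHS](bigD1_ord j) //=.
rewrite -[leLHS]add0r lerD // le_eqVlt; apply/orP; left; apply/eqP.
by apply: eq_bigr => l _; rewrite !mxE.
Qed.

Section BasicPoints.
Variables (R : realFieldType) (m k : nat).

Definition satisfies (A : 'M[R]_(m, k)) (b : 'cV[R]_m) (z : 'cV[R]_k) :=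
  forall i, (A *m z) i 0 <= b i 0.

Definition tight_rows (A : 'M[R]_(m, k)) (b : 'cV[R]_m) (z : 'cV[R]_k) :=
  [set i | (A *m z) i 0 == b i 0].

Definition tight_mx (X : nmodType) (S : {set 'I_m}) (q : nat) (A : 'M[X]_(m, q)) :=
  \matrix_(i, j) if i \in S then A i j else 0.

(** A row outside the span of the tight rows does not vanish on some direction that is
orthogonal to all tight rows. Moving along it, in the sense in which coordinate [c0]
does not increase, a further row becomes tight: row [i0] at the latest if [c0]
decreases. *)
Lemma more_tight (A : 'M[R]_(m, k)) b z (c0 : 'I_k) i0 :
  (forall j, A i0 j = - (j == c0)%:R) ->
  satisfies A b z -> ~~ (A <= tight_mx (tight_rows A b z) A)%MS ->
  exists z', [/\ satisfies A b z', z' c0 0 <= z c0 0 &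
                 (#|tight_rows A b z| < #|tight_rows A b z'|)%N].
Proof.
move=> Ai0 sat; set T := tight_mx _ _; rewrite submxE => nz.
have /matrix0Pn[i [j Dij]] := nz.
pose d0 : 'cV[R]_k := cokermx T *m delta_mx j 0.
have Td0 : T *m d0 = 0 by rewrite mulmxA mulmx_coker mul0mx.
have Ad0 : (A *m d0) i 0 != 0 by rewrite mulmxA -colE mxE.
have Ai0E w : (A *m w) i0 0 = - (w c0 0).
  rewrite mxE (bigD1 c0) //= Ai0 eqxx mulN1r big1 ?addr0 // => l lc.
  by rewrite Ai0 (negPf lc) oppr0 mul0r.
have [d [Td dc [i1 i1d]]] : exists d : 'cV[R]_k, [/\ T *m d = 0, d c0 0 <= 0 &
    exists i, 0 < (A *m d) i 0].
  have [dn|dp|d0E] := ltgtP (d0 c0 0) 0.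
  - exists d0; split=> //; first exact: ltW.
    by exists i0; rewrite Ai0E oppr_gt0.
  - exists (- d0); rewrite !mulmxN Td0 oppr0; split=> //.
      by rewrite mxE oppr_le0 ltW.
    by exists i0; rewrite mxE Ai0E opprK.
  - move: Ad0; rewrite neq_lt => /orP[neg|pos].
      exists (- d0); rewrite !mulmxN Td0 oppr0; split=> //.
        by rewrite mxE d0E oppr0.
      by exists i; rewrite mxE oppr_gt0.
    by exists d0; split=> //; [rewrite d0E | exists i].
pose gapr l := (b l 0 - (A *m z) l 0) / (A *m d) l 0.
pose i2 := [arg min_(l < i1 | 0 < (A *m d) l 0) gapr l]%O.
have [i2d i2min] : 0 < (A *m d) i2 0 /\
    forall l, 0 < (A *m d) l 0 -> gapr i2 <= gapr l.
  by rewrite /i2; case: Order.TotalTheory.arg_minP => // l ld lmin; split.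
set t := gapr i2 in i2min.
have t0 : 0 <= t by rewrite divr_ge0 ?subr_ge0 // ltW.
have Az' l : (A *m (z + t *: d)) l 0 = (A *m z) l 0 + t * (A *m d) l 0.
  by rewrite mulmxDr -scalemxAr !mxE.
exists (z + t *: d); split.
- move=> l; rewrite Az'; have [ld|ld] := ltP 0 ((A *m d) l 0).
    by rewrite -lerBrDl -ler_pdivlMr // i2min.
  by apply: le_trans (sat l); rewrite gerDl mulr_ge0_le0.
- by rewrite !mxE gerDl mulr_ge0_le0.
- apply: proper_card; apply/properP; split.
    apply/subsetP => l; rewrite !inE Az' => lt.
    have -> : (A *m d) l 0 = 0; last by rewrite mulr0 addr0.
    move/matrixP/(_ l 0): Td; rewrite [RHS]mxE => <-; rewrite !mxE.
    by apply: eq_bigr => q _; rewrite mxE inE lt.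
  exists i2; first by rewrite inE Az' /t /gapr divfK ?(gt_eqF i2d) // addrC subrK.
  apply/negP; rewrite inE => lt; move: i2d.
  move/matrixP/(_ i2 0): Td; rewrite [RHS]mxE => E.
  rewrite (_ : (A *m d) i2 0 = 0) ?ltxx // -E !mxE.
  by apply: eq_bigr => q _; rewrite mxE inE lt.
Qed.

Lemma basic_point (A : 'M[R]_(m, k)) b z (c0 : 'I_k) i0 :
  (forall j, A i0 j = - (j == c0)%:R) -> satisfies A b z ->
  exists z', [/\ satisfies A b z', z' c0 0 <= z c0 0 &
                 (A <= tight_mx (tight_rows A b z') A)%MS].
Proof.
move=> Ai0 sat.
move: {2}(m - #|tight_rows A b z|)%N (leqnn (m - #|tight_rows A b z|)%N) => n.
elim: n z sat => [|n IH] z sat zn;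
  have [sub|nsub] := boolP (A <= tight_mx (tight_rows A b z) A)%MS;
  try by exists z.
all: have [z1 [sat1 c1 lt1]] := more_tight Ai0 sat nsub.
  have := subset_leq_card (subsetT (tight_rows A b z1)).
  by rewrite cardsT card_ord; move: zn lt1; lia.
have [|z' [sat' c' sub']] := IH z1 sat1; first by move: zn lt1; lia.
by exists z'; split=> //; apply: le_trans c1.
Qed.

(** The system is solved on a nonsingular submatrix of maximal rank, the other unknowns
being 0; Cramer's rule gives the common denominator [d]. The solution need not be [z],
but it agrees with [z] on the row space of [T]. *)
Lemma cramer_point (T : 'M[int]_(m, k)) (beta : 'cV[int]_m) (z : 'cV[R]_k) c :
  0 <= c -> (forall i, \sum_j `|T i j| <= c) ->
  map_mx intr T *m z = map_mx intr beta ->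
  exists r (d : int) (y : 'cV[int]_k), [/\ (r <= k)%N, d != 0, `|d| <= c ^+ r &
    map_mx intr T *m (d%:~R^-1 *: map_mx intr y) = map_mx intr T *m z].
Proof.
move=> c0 Tc Tz; pose TR : 'M[R]_(m, k) := map_mx intr T.
pose f := maxrankfun TR; set r := \rank TR in f.
have fr : row_free (rowsub f TR) by apply: maxrowsub_free.
have gfull : row_full (rowsub f TR)^T by rewrite /row_full mxrank_tr -/(row_free _).
pose g := fullrankfun gfull.
have Cu : rowsub g (rowsub f TR)^T \in unitmx by apply: fullrowsub_unit.
pose C := mxsub f g T.
have CE : map_mx intr C = (rowsub g (rowsub f TR)^T)^T.
  by apply/matrixP => i j; rewrite !mxE.
pose d := \det C.
have dE : d%:~R = \det (map_mx intr C : 'M[R]_r) by rewrite det_map_mx.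
have d0 : d != 0.
  rewrite -(intr_eq0 R) dE CE det_tr -unitfE -unitmxE //.
pose E : 'M[int]_(k, r) := \matrix_(i, j) (i == g j)%:R.
pose y := E *m (\adj C *m rowsub f beta).
have TE : rowsub f T *m E = C.
  apply/matrixP => i j; rewrite !mxE (bigD1 (g j)) //= !mxE eqxx mulr1 big1 ?addr0 //.
  by move=> l lg; rewrite !mxE (negPf lg) mulr0.
exists r, d, y; split=> //.
- exact: rank_leq_col.
- apply: det_norm_le => // i; apply: le_trans (Tc (f i)).
  rewrite (eq_bigr (fun j => `|T (f i) (g j)|)); last by move=> j _; rewrite mxE.
  rewrite -(big_imset (h := g) (A := predT) (fun l => `|T (f i) l|)) /=; last first.
    by move=> ? ? _ _; apply: fullrankfun_inj.
  rewrite [leRHS](bigID (mem [set g x | x in predT])) /=.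
  by rewrite lerDl sumr_ge0.
- have /submxP [X XE] : (TR <= rowsub f TR)%MS by rewrite eq_maxrowsub.
  rewrite -/TR XE -!mulmxA; congr (X *m _).
  have -> : rowsub f TR *m z = map_mx intr (rowsub f beta).
    rewrite mul_rowsub_mx /TR Tz; apply/matrixP => i j; by rewrite !mxE.
  have -> : rowsub f TR = map_mx intr (rowsub f T) by apply/matrixP => i j; rewrite !mxE.
  rewrite -scalemxAr -map_mxM /y mulmxA TE mulmxA mul_mx_adj mul_scalar_mx -/d.
  rewrite map_mxZ scalerA mulVf ?scale1r //.
  by rewrite intr_eq0.
Qed.

End BasicPoints.

(** Row [i0] says that coordinate [c0] is nonnegative. At a point where the tight rows
span all rows, this coordinate has a denominator of at most [c ^+ k], so it is 0 as
soon as it is smaller than the inverse; the same point then gives a rational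
solution. *)
Theorem small_slack_vanishes (R : archiRealFieldType) m k
    (A : 'M[int]_(m, k)) (b : 'cV[int]_m)
    (z : 'cV[R]_k) (c0 : 'I_k) (i0 : 'I_m) (c : int) :
  1 <= c -> (forall i, \sum_j `|A i j| <= c) ->
  (forall j, A i0 j = - (j == c0)%:R) -> b i0 0 = 0 ->
  (forall i, (map_mx intr A *m z) i 0 <= (b i 0)%:~R) ->
  z c0 0 < (c%:~R ^+ k)^-1 ->
  exists (d : int) (y : 'cV[int]_k), [/\ d != 0, y c0 0 = 0 &
    forall i, ((A *m y) i 0)%:~R / d%:~R <= (b i 0)%:~R :> rat].
Proof.
move=> c1 Ac Ai0 bi0 sat zc0.
pose AR : 'M[R]_(m, k) := map_mx intr A; pose bR : 'cV[R]_m := map_mx intr b.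
have satR : satisfies AR bR z by move=> i; rewrite [leRHS]mxE.
have ARi0 j : AR i0 j = - (j == c0)%:R by rewrite mxE Ai0 rmorphN rmorph_nat.
have [z1 [sat1 z1z sub]] := basic_point ARi0 satR.
set S := tight_rows AR bR z1 in sub.
pose T := tight_mx S A.
have TE : map_mx intr T = tight_mx S AR.
  by apply/matrixP => i j; rewrite !mxE; case: ifP; rewrite ?mxE.
have Tz : map_mx intr T *m z1 = map_mx intr (tight_mx S b).
  apply/matrixP => i j; rewrite ord1 TE !mxE; case: ifP => iS.
    move: (iS); rewrite inE => /eqP; rewrite [RHS]mxE => <-; rewrite mxE.
    by apply: eq_bigr => l _; rewrite mxE iS.
  by rewrite big1 // => l _; rewrite mxE iS mul0r.
have Tc i : \sum_j `|T i j| <= c.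
  apply: le_trans (Ac i); apply: ler_sum => j _; rewrite mxE.
  by case: ifP; rewrite ?normr0.
have c0' : 0 <= c by apply: le_trans c1.
have [r [d [y [rk dn0 dle E]]]] := cramer_point c0' Tc Tz.
have AE : AR *m (d%:~R^-1 *: map_mx intr y) = AR *m z1.
  have /submxP [X XE] := sub.
  by rewrite XE -!mulmxA -TE E.
have dR0 : d%:~R != 0 :> R by rewrite intr_eq0.
have AEi i : ((A *m y) i 0)%:~R / d%:~R = (AR *m z1) i 0.
  rewrite -AE -scalemxAr -map_mxM [RHS]mxE mulrC; congr (_ * _).
  by rewrite [RHS]mxE.
have Ai0E (F : nzRingType) (w : 'cV[F]_k) (B : 'M[F]_(m, k)) :
    (forall j, B i0 j = - (j == c0)%:R) -> (B *m w) i0 0 = - (w c0 0).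
  move=> Bi0; rewrite mxE (bigD1 c0) //= Bi0 eqxx mulN1r big1 ?addr0 // => l lc.
  by rewrite Bi0 (negPf lc) oppr0 mul0r.
have z1c0 : z1 c0 0 = (y c0 0)%:~R / d%:~R.
  have := AEi i0; rewrite !Ai0E // rmorphN mulNr => /oppr_inj <-.
  by [].
exists d, y; split=> //; last first.
  move=> i; rewrite -(ler_rat R) fmorph_div /= !ratr_int AEi.
  by have := sat1 i; rewrite [leRHS]mxE.
apply/eqP; rewrite -normr_le0 -ltz1D addr0.
rewrite -(ltr_int R) intr_norm.
have -> : (y c0 0)%:~R = z1 c0 0 * d%:~R by rewrite z1c0 divfK.
have z10 : 0 <= z1 c0 0.
  by have := sat1 i0; rewrite Ai0E // [leRHS]mxE bi0 oppr_le0.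
rewrite normrM ger0_norm // -intr_norm.
apply: (@le_lt_trans _ _ (z1 c0 0 * (c%:~R ^+ k))).
  rewrite ler_wpM2l // -rmorphXn ler_int; apply: le_trans dle _.
  exact: ler_weXn2l.
rewrite -ltr_pdivlMr ?exprn_gt0 ?ltr0z ?(lt_le_trans _ c1) // div1r.
exact: le_lt_trans zc0.
Qed.

(** * Binary logarithms *)

Section BinaryLogarithm.
Variable R : realType.
Implicit Types (x y : R) (n : nat).

Definition pow2 x : R := expR (x * ln 2).
Definition log2 x : R := ln x / ln 2.

Let ln2_gt0 : 0 < ln 2 :> R.
Proof. by rewrite ln_gt0 // ltr1n. Qed.

Lemma pow2K : cancel pow2 log2.
Proof. by move=> x; rewrite /log2 expRK mulfK ?gt_eqF. Qed.

Lemma log2K x : 0 < x -> pow2 (log2 x) = x.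
Proof. by move=> x0; rewrite /pow2 divfK ?gt_eqF // lnK. Qed.

Lemma pow2_gt0 x : 0 < pow2 x.
Proof. exact: expR_gt0. Qed.

Lemma pow2_ge0 x : 0 <= pow2 x.
Proof. exact: ltW (pow2_gt0 x). Qed.

Lemma pow2D x y : pow2 (x + y) = pow2 x * pow2 y.
Proof. by rewrite /pow2 mulrDl expRD. Qed.

Lemma pow2_1 : pow2 1 = 2.
Proof. by rewrite /pow2 mul1r lnK // posrE. Qed.

Lemma pow2Xn x n : pow2 x ^+ n = pow2 (n%:R * x).
Proof. by rewrite /pow2 -mulrA expRM_natl. Qed.

Lemma ler_pow2 x y : (pow2 x <= pow2 y) = (x <= y).
Proof. by rewrite ler_expR ler_pM2r. Qed.

Lemma log2_1 : log2 1 = 0.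
Proof. by rewrite /log2 ln1 mul0r. Qed.

Lemma log2M x y : 0 < x -> 0 < y -> log2 (x * y) = log2 x + log2 y.
Proof. by move=> x0 y0; rewrite /log2 lnM // mulrDl. Qed.

Lemma log2Xn x n : 0 < x -> log2 (x ^+ n) = n%:R * log2 x.
Proof. by move=> x0; rewrite /log2 lnXn // mulr_natl -mulrnAl. Qed.

Lemma ler_log2 x y : 0 < x -> 0 < y -> (log2 x <= log2 y) = (x <= y).
Proof. by move=> x0 y0; rewrite /log2 ler_pM2r ?invr_gt0 // ler_ln. Qed.

Lemma log2_double x : 0 < x -> log2 (x + x) = 1 + log2 x.
Proof.
by move=> x0; rewrite -mulr2n -mulr_natl -pow2_1 log2M ?pow2_gt0 // pow2K.
Qed.

End BinaryLogarithm.

(** * Local rules for the text of an instance *)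

(** [p_tag] is the form of the current constraint, [p_past1] and [p_past2] tell whether
one and whether two of its fields are complete, [p_neg] and [p_den] whether a minus sign
and a slash were read in the current field. [p_start] means that the previous symbol is
not a digit, and [p_first] that no symbol was read. *)
Record pstate := PState {
  p_first : bool; p_tag : symbol;
  p_past1 : bool; p_past2 : bool;
  p_start : bool; p_neg : bool; p_den : bool }.

Definition pstate_code (q : pstate) :=
  (p_first q, p_tag q, p_past1 q, p_past2 q, p_start q, p_neg q, p_den q).

Definition pstate_decode c : pstate :=
  let: (f, t, a, b, s, n, d) := c in PState f t a b s n d.

Lemma pstate_codeK : cancel pstate_code pstate_decode.
Proof. by case. Qed.

HB.instance Definition _ := Finite.copy pstate (can_type pstate_codeK).

Definition pstate0 := PState true Semicolon false false true false false.

Definition parse (q : pstate) (a : symbol) : pstate :=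
  let: PState _ t f1 f2 _ neg den := q in
  match a with
  | Digit _ => PState false t f1 f2 false neg den
  | Minus => PState false t f1 f2 true true den
  | Slash => PState false t f1 f2 true neg true
  | Comma => PState false t true f1 true false false
  | Bar => PState false t f1 f2 true neg den
  | Semicolon | TagMax | TagShift | TagAvg | TagConst =>
      PState false a false false true false false
  end.

(** The unknowns are indexed by a kind and two positions. Those of kinds [KG] and [KW]
are used on the whole grid, the others on the diagonal, hence at one position.
- [KX]: the value of the variable whose name is being read;
- [KS]: in a maximum, the sum of the values of the variables that are still to come;
- [KA false], [KA true]: the variable x_0 of the current constraint and its partner,
  copied along the whole text of the constraint;
- [KV], [KY], [KW]: the chain that compares them, once in each direction;
- [KG]: a value on its way from one occurrence of a name to another. *)
Inductive kind :=
  | KX | KS | KG | KA of bool | KV of bool | KY of bool | KW of bool & 'I_8.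

Definition kind_code (k : kind) :
    unit + unit + unit + bool + bool + bool + bool * 'I_8 :=
  match k with
  | KX => inl (inl (inl (inl (inl (inl tt)))))
  | KS => inl (inl (inl (inl (inl (inr tt)))))
  | KG => inl (inl (inl (inl (inr tt))))
  | KA e => inl (inl (inl (inr e)))
  | KV e => inl (inl (inr e))
  | KY e => inl (inr e)
  | KW e t => inr (e, t)
  end.

Definition kind_decode
    (c : unit + unit + unit + bool + bool + bool + bool * 'I_8) : kind :=
  match c with
  | inl (inl (inl (inl (inl (inl _))))) => KX
  | inl (inl (inl (inl (inl (inr _))))) => KS
  | inl (inl (inl (inl (inr _)))) => KG
  | inl (inl (inl (inr e))) => KA e
  | inl (inl (inr e)) => KV e
  | inl (inr e) => KY e
  | inr (e, t) => KW e t
  end.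

Lemma kind_codeK : cancel kind_code kind_decode.
Proof. by case. Qed.

HB.instance Definition _ := Finite.copy kind (can_type kind_codeK).

Section Blocks.
Variable T : Type.

(** A symmetric two by two matrix whose entries are sums of unknowns; [None] stands for
the constant 1. *)
Record block := Block {
  b_ul : seq (option T); b_off : seq (option T); b_lr : seq (option T) }.

Definition nonneg_rule x := Block [:: x] [::] [::].

(** Since [x ^+ 2 <= y * x] means [x <= y] for nonnegative numbers, linear inequalities
are of the same shape as [avg_rule]. *)
Definition le_rule x y := Block [:: y] [:: x] [:: x].
Definition le_sum_rule x y z := Block [:: y; z] [:: x] [:: x].
Definition eq_rules x y := [:: le_rule x y; le_rule y x].
Definition avg_rule x y z := Block [:: y] [:: x] [:: z].
Definition zero_rule x := Block [::] [:: x] [:: x].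

Variables (R : realType) (v : T -> R).

Definition lsum (s : seq (option T)) : R := \sum_(x <- s) oapp v 1 x.

Definition holds (b : block) : Prop :=
  [/\ 0 <= lsum (b_ul b), 0 <= lsum (b_lr b) &
      lsum (b_off b) ^+ 2 <= lsum (b_ul b) * lsum (b_lr b)].

Definition all_hold (bs : seq block) : Prop := foldr (fun b P => holds b /\ P) True bs.

Lemma all_hold_cat bs cs : all_hold (bs ++ cs) <-> all_hold bs /\ all_hold cs.
Proof. by elim: bs => /= [|b bs ->]; tauto. Qed.

Lemma all_hold_flatten (I : eqType) (s : seq I) (F : I -> seq block) :
  all_hold (flatten [seq F i | i <- s]) <-> forall i, i \in s -> all_hold (F i).
Proof.
elim: s => //= i s IH; rewrite all_hold_cat IH; split.
  by move=> [Fi Fs] j; rewrite inE => /orP[/eqP->|/Fs].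
by move=> h; split=> [|j js]; apply: h; rewrite inE ?eqxx ?js ?orbT.
Qed.

Lemma all_hold_map (I : eqType) (s : seq I) (F : I -> block) :
  all_hold [seq F i | i <- s] <-> forall i, i \in s -> holds (F i).
Proof.
elim: s => //= i s IH; rewrite IH; split.
  by move=> [Fi Fs] j; rewrite inE => /orP[/eqP->|/Fs].
by move=> h; split=> [|j js]; apply: h; rewrite inE ?eqxx ?js ?orbT.
Qed.

Notation val := (oapp v 1).

Lemma lsum0 : lsum [::] = 0. Proof. exact: big_nil. Qed.
Lemma lsum1 x : lsum [:: x] = val x. Proof. exact: big_seq1. Qed.
Lemma lsum2 x y : lsum [:: x; y] = val x + val y.
Proof. by rewrite /lsum big_cons big_seq1. Qed.

Lemma sqr_le_mulr (x y : R) : 0 <= x -> 0 <= y -> (x ^+ 2 <= y * x) = (x <= y).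
Proof.
rewrite le_eqVlt => /orP[/eqP <- ->|x0 _]; first by rewrite expr0n mulr0 lexx.
by rewrite expr2 ler_pM2r.
Qed.

Lemma holds_nonneg x : holds (nonneg_rule x) <-> 0 <= val x.
Proof.
by rewrite /holds /= !lsum0 lsum1 expr0n mulr0; split=> [[]|].
Qed.

Lemma holds_le x y : holds (le_rule x y) <-> 0 <= val x <= val y.
Proof.
rewrite /holds /= !lsum1; split=> [[y0 x0]|/andP[x0 xy]].
  by rewrite sqr_le_mulr // x0.
by have y0 := le_trans x0 xy; split=> //; rewrite sqr_le_mulr.
Qed.

Lemma holds_le2 x y z : holds (le_sum_rule x y z) <-> 0 <= val x <= val y + val z.
Proof.
rewrite /holds /= !lsum1 lsum2; split=> [[y0 x0]|/andP[x0 xy]].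
  by rewrite sqr_le_mulr // x0.
by have y0 := le_trans x0 xy; split=> //; rewrite sqr_le_mulr.
Qed.

Lemma holds_null x : holds (zero_rule x) <-> val x = 0.
Proof.
rewrite /holds /= !lsum1 lsum0 mul0r; split=> [[_ x0]|->].
  by rewrite real_exprn_even_le0 ?num_real //= => /eqP.
by rewrite expr0n.
Qed.

Lemma all_hold_eqs x y : all_hold (eq_rules x y) <-> 0 <= val x /\ val y = val x.
Proof.
rewrite /= !holds_le; split=> [[/andP[x0 xy] [/andP[_ yx] _]]|[x0 ->]].
  by split=> //; apply/eqP; rewrite eq_le xy yx.
by rewrite x0 lexx.
Qed.

Lemma holds_avg x y z : holds (avg_rule x y z) <->
  [/\ 0 <= val y, 0 <= val z & val x ^+ 2 <= val y * val z].
Proof. by rewrite /holds /= !lsum1. Qed.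

End Blocks.

Definition map_block T U (f : T -> U) (b : block T) : block U :=
  Block (map (omap f) (b_ul b)) (map (omap f) (b_off b)) (map (omap f) (b_lr b)).

Lemma lsum_map (R : realType) T U (f : T -> U) (v : U -> R) s :
  lsum v (map (omap f) s) = lsum (v \o f) s.
Proof. by rewrite /lsum big_map; apply: eq_bigr => -[]. Qed.

Lemma holds_map_block (R : realType) T U (f : T -> U) (v : U -> R) b :
  holds v (map_block f b) <-> holds (v \o f) b.
Proof. by rewrite /holds /= !lsum_map. Qed.

Lemma all_hold_map_block (R : realType) T U (f : T -> U) (v : U -> R) bs :
  all_hold v (map (map_block f) bs) <-> all_hold (v \o f) bs.
Proof. by elim: bs => //= b bs ->; rewrite holds_map_block. Qed.

(** An equation [x = c] is read as the two inequalities [x <= c + 0] and [0 <= - c + x],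
of which [e] selects one. *)
Definition active (q : pstate) (e : bool) : bool :=
  ((p_tag q == TagShift) || (p_tag q == TagConst)) && (e ==> (p_tag q == TagConst)).

Definition here (k : kind) : option (kind * bool) := Some (k, false).
Definition next (k : kind) : option (kind * bool) := Some (k, true).

(** Let a, b, v, y be the logarithms of [KA e], [KA (~~ e)], [KV e], [KY e], let the digits
of p / q be read, with sign s, least significant first, and let y' belong to the next
position. At a digit of q, 2 y' <= y + a or 2 y' <= y + b according to the digit; over
n digits this gives 2 ^ n y' <= y + q b + (2 ^ n - 1 - q) a. As y <= v at the first of
them and a <= y' after the last one, (q + 1) a <= v + q b. At a digit d of p,
2 y' <= y + v + s d, so that v <= y + s p for y at the first digit, because v <= y'
after the last one. If moreover M (y - v) <= a - v there, as imposed by [scale_rules],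
then v <= a + s M p, and altogether q a <= s M p + q b. *)
Definition ratio_rules (q : pstate) (a : symbol) (e : bool) :
    seq (block (kind * bool)) :=
  match a with
  | Comma => [:: le_rule (here (KA e)) (here (KY e))]
  | Slash => [:: le_rule (next (KY e)) (here (KV e)); le_rule (here (KV e)) (here (KY e))]
  | Minus => [:: le_rule (next (KY e)) (here (KY e))]
  | Digit b =>
      if p_den q then [:: avg_rule (next (KY e)) (here (KY e)) (here (KA (b (+) e)))]
      else if ~~ b then [:: avg_rule (next (KY e)) (here (KY e)) (here (KV e))]
      else [:: Block [:: here (KY e); here (KY e)]
                 (if p_neg q (+) e then [:: next (KY e); next (KY e)]
                  else [:: next (KY e)])
                 [:: here (KV e)]]
  | _ => [::]
  end.

(** These have the same values along the whole text of a constraint. *)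
Definition carried : seq kind := [:: KA false; KA true; KV false; KV true].

Definition tag_rules (q : pstate) (a : symbol) : seq (block (kind * bool)) :=
  match p_tag q, a with
  | TagMax, Comma => if p_past1 q then [:: le_sum_rule (here KS) (here KX) (next KS)]
                     else [:: le_rule (here KX) (next KS)]
  | TagMax, Digit _ => if p_past1 q then [:: le_rule (here KS) (next KS)] else [::]
  | TagMax, Semicolon => [:: zero_rule (here KS)]
  | TagAvg, Comma =>
      if p_past2 q then [:: avg_rule (here (KA false)) (here (KA true)) (here KX)]
      else if p_past1 q then eq_rules (here (KA true)) (here KX) else [::]
  | TagShift, Comma => if p_past2 q then eq_rules (here (KA true)) (here KX) else [::]
  | TagConst, Semicolon => eq_rules (here (KA true)) None
  | _, _ => [::]
  end.

Definition word_rules (q : pstate) (a : symbol) : seq (block (kind * bool)) :=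
  (if a == Semicolon then [::]
   else flatten [seq eq_rules (here c) (next c) | c <- carried]) ++
  (if is_digit a then eq_rules (here KX) (next KX) else [::]) ++
  (if (a == Comma) && ~~ p_past1 q then eq_rules (here (KA false)) (here KX)
   else [::]) ++
  (if p_past1 q && ~~ p_past2 q then
     flatten [seq (if active q e then ratio_rules q a e else [::])
             | e <- [:: false; true]]
   else [::]) ++
  tag_rules q a.

(** The comma after the first field: the grid row of this position holds the chain that
multiplies by the scale. *)
Definition scale_start (q : pstate) (a : symbol) : bool :=
  (a == Comma) && ~~ p_past1 q.

(** The positions, relative to (i, j), of the unknowns that a rule at (i, j) may
mention. *)
Inductive mode := Here | Next | Row | RowNext | Col | Right.

Definition target (m : mode) (i j : nat) : nat * nat :=
  match m with
  | Here => (i, j) | Next => (i.+1, j.+1) | Row => (i, i)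
  | RowNext => (i.+1, i.+1) | Col => (j, j) | Right => (i, j.+1)
  end%N.

Definition at_mode (k : kind) (m : mode) : option (kind * mode) := Some (k, m).

(** An unknown [KG] starts with the value at the occurrence of a name at i, moves
diagonally as long as the occurrences at i and j have the same digits, and is bounded by
the value at j if they end together. *)
Definition name_rules (q q' : pstate) (a a' : symbol) :
    seq (block (kind * mode)) :=
  (if [&& p_start q, p_start q', is_digit a & is_digit a']
   then [:: le_rule (at_mode KX Row) (at_mode KG Here)] else [::]) ++
  (if is_digit a && (a == a')
   then [:: le_rule (at_mode KG Here) (at_mode KG Next)] else [::]) ++
  (if ~~ is_digit a && ~~ is_digit a'
   then [:: le_rule (at_mode KG Here) (at_mode KX Col)] else [::]).

(** The successor in the chain that runs through the kinds [KW e t] of a pair and then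
moves on to the next column. *)
Definition halved (e : bool) (t : 'I_8) : option (kind * mode) :=
  if (t.+1 < 8)%N then at_mode (KW e (inord t.+1)) Here
  else at_mode (KW e ord0) Right.

(** From the first column to the last, the logarithmic distance to [KV e] is halved eight
times per column; [KY e] at the next position is compared with the result. *)
Definition scale_rules (e : bool) (y : option (pstate * symbol)) :
    seq (block (kind * mode)) :=
  if y is Some (q', _) then
    (if p_first q' then [:: le_rule (at_mode (KW e ord0) Here) (at_mode (KA e) Row)]
     else [::]) ++
    [seq avg_rule (halved e t) (at_mode (KW e t) Here) (at_mode (KV e) Row)
    | t <- enum 'I_8]
  else [:: le_rule (at_mode (KY e) RowNext) (at_mode (KW e ord0) Here)].

Definition grid_rules (x y : option (pstate * symbol)) (same : bool) :
    seq (block (kind * mode)) :=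
  [seq nonneg_rule (at_mode k Here) | k <- enum {: kind}] ++
  (if x is Some (q, a) then
     (if same then
        [seq map_block (fun kb => (kb.1, if kb.2 then Next else Here)) b
        | b <- word_rules q a]
      else [::]) ++
     (if y is Some (q', a') then name_rules q q' a a' else [::]) ++
     (if scale_start q a then
        flatten [seq (if active q e then scale_rules e y else [::])
                | e <- [:: false; true]]
      else [::])
   else [::]).

(** * What the rules along the word imply *)

Fixpoint run (w : seq symbol) : seq symbol :=
  if w is a :: w' then if is_digit a then a :: run w' else [::] else [::].

Lemma run_cat ds a w : all is_digit ds -> ~~ is_digit a -> run (ds ++ a :: w) = ds.
Proof. by move=> + /negPf a0; elim: ds => /= [|d ds IH]; rewrite ?a0 // => /andP[-> /IH ->]. Qed.

(** Least significant digit first. *)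
Fixpoint dval (ds : seq symbol) : nat :=
  if ds is d :: ds' then ((d == Digit true) + 2 * dval ds')%N else 0%N.

Lemma dval_enc_nat n : dval (enc_nat n) = n.
Proof.
rewrite /enc_nat -[RHS]bin_of_natK; case: bin_of_nat => //=.
elim=> [p /= ->|p /= ->|] //=; rewrite !natTrecE; lia.
Qed.

Lemma digit_neq a : is_digit a -> a != Semicolon.
Proof. by case: a => // -[]. Qed.

Lemma enc_nat_neq0 n : enc_nat n != [::].
Proof. by rewrite /enc_nat; case: bin_of_nat => // -[]. Qed.

Lemma parse_digits ds f t f1 f2 s n d : all is_digit ds -> ds != [::] ->
  foldl parse (PState f t f1 f2 s n d) ds = PState false t f1 f2 false n d.
Proof.
elim: ds f s => // -[] // b [|a ds] IH f s dd _ //.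
exact: (IH false false).
Qed.

Section WordRules.
Variables (R : realType) (M : nat) (xv : seq symbol -> R).
Hypothesis M_gt0 : (0 < M)%N.
Implicit Types (D : nat -> kind -> R) (u : kind -> R).

Definition adjacent (u u' : kind -> R) (kb : kind * bool) : R :=
  if kb.2 then u' kb.1 else u kb.1.

(** The second part is the effect of [scale_rules] on the diagonal. *)
Definition step_ok (q : pstate) (a : symbol) (u u' : kind -> R) : Prop :=
  all_hold (adjacent u u') (word_rules q a) /\
  (scale_start q a -> forall e, active q e ->
     u' (KY e) ^+ M <= u (KA e) * u (KV e) ^+ M.-1).

(** [D] gives the values at the positions of [w], and [xv] the value of the variable with
a given name. *)
Fixpoint sat (D : nat -> kind -> R) (q : pstate) (w : seq symbol) : Prop :=
  (forall k, 0 <= D 0%N k) /\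
  if w is a :: w' then
    [/\ step_ok q a (D 0%N) (D 1%N),
        p_start q -> is_digit a -> D 0%N KX = xv (run w) &
        sat (fun i => D i.+1) (parse q a) w']
  else True.

Lemma sat_ge0 D q w : sat D q w -> forall k, 0 <= D 0%N k.
Proof. by case: w => [|a w] []. Qed.

Lemma sat_cat D q w1 w2 : sat D q (w1 ++ w2) ->
  sat (fun i => D (size w1 + i)%N) (foldl parse q w1) w2.
Proof.
elim: w1 D q => //= a w1 IH D q [_ [_ _ /IH]].
by apply.
Qed.

Lemma rule_carried q a u u' c : step_ok q a u u' -> a != Semicolon ->
  c \in carried -> u' c = u c.
Proof.
rewrite /step_ok /word_rules => -[/all_hold_cat[+ _] _] /negPf aS cc; rewrite aS.
by move=> /all_hold_flatten/(_ c cc)/all_hold_eqs[].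
Qed.

Lemma rule_KX q a u u' : step_ok q a u u' -> is_digit a -> u' KX = u KX.
Proof.
rewrite /step_ok /word_rules => -[/all_hold_cat[_ /all_hold_cat[+ _]] _] ad; rewrite ad.
by move=> /all_hold_eqs[].
Qed.

Lemma rule_KS q a u u' : step_ok q a u u' -> is_digit a ->
  p_tag q = TagMax -> p_past1 q -> u KS <= u' KS.
Proof.
rewrite /step_ok /word_rules /tag_rules; do 4 rewrite all_hold_cat.
move=> [[_ [_ [_ [_ +]]]] _] + tq p1; rewrite tq.
case: a => // b; by rewrite p1 => -[/holds_le/andP[]].
Qed.

Lemma rule_ratio q a u u' e : step_ok q a u u' -> active q e ->
  p_past1 q -> ~~ p_past2 q -> all_hold (adjacent u u') (ratio_rules q a e).
Proof.
rewrite /step_ok /word_rules; do 4 rewrite all_hold_cat.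
move=> [[_ [_ [_ [+ _]]]] _] act p1 p2; rewrite p1 p2 all_hold_flatten.
by move=> /(_ e); rewrite act; apply; rewrite !inE; case: (e).
Qed.

Lemma rule_tag q a u u' : step_ok q a u u' ->
  all_hold (adjacent u u') (tag_rules q a).
Proof.
rewrite /step_ok /word_rules; do 4 rewrite all_hold_cat.
by move=> [[_ [_ [_ [_ +]]]] _].
Qed.

Lemma rule_comma q u u' : step_ok q Comma u u' -> ~~ p_past1 q ->
  u (KA false) = u KX.
Proof.
rewrite /step_ok /word_rules; do 4 rewrite all_hold_cat.
move=> [[_ [_ [+ _]]] _] p1; rewrite p1.
by move=> /all_hold_eqs[].
Qed.

Lemma digits_carried D q ds w c : all is_digit ds -> sat D q (ds ++ w) ->
  c \in carried -> D (size ds) c = D 0%N c.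
Proof.
move=> + + cc; elim: ds D q => //= a ds IH D q /andP[ad dsd] [_ [ok _ st]].
rewrite (IH _ _ dsd st); apply: rule_carried ok _ cc.
exact: digit_neq.
Qed.

Lemma digits_KX D q ds w : all is_digit ds -> sat D q (ds ++ w) ->
  D (size ds) KX = D 0%N KX.
Proof.
elim: ds D q => //= a ds IH D q /andP[ad dsd] [_ [ok _ st]].
by rewrite (IH _ _ dsd st); apply: rule_KX ok ad.
Qed.

Lemma digits_KS D q ds w : all is_digit ds -> sat D q (ds ++ w) ->
  p_tag q = TagMax -> p_past1 q -> D 0%N KS <= D (size ds) KS.
Proof.
elim: ds D q => //= a ds IH D q /andP[ad dsd] [_ [ok _ st]] tq p1.
apply: le_trans (rule_KS ok ad tq p1) (IH _ _ dsd st _ _).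
  by case: (q) tq; case: (a) ad.
by case: (q) p1; case: (a) ad.
Qed.

(** Reading a name brings its value to the position after it and changes nothing else. *)
Lemma name_field D t f1 f2 n d v a w : ~~ is_digit a ->
  sat D (PState false t f1 f2 true n d) (enc_nat v ++ a :: w) ->
  exists D', [/\ sat D' (PState false t f1 f2 false n d) (a :: w),
    forall c, c \in carried -> D' 0%N c = D 0%N c,
    D' 0%N KX = xv (enc_nat v) &
    t = TagMax -> f1 -> D 0%N KS <= D' 0%N KS].
Proof.
move=> ad st; have dd := enc_nat_digits v.
have st' := sat_cat st; rewrite parse_digits ?enc_nat_neq0 // in st'.
exists (fun i => D (size (enc_nat v) + i)%N); rewrite addn0; split=> //.
- by move=> c cc; rewrite (digits_carried dd st cc).
- rewrite (digits_KX dd st) -[in RHS](run_cat w dd ad).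
  move: st dd (enc_nat_neq0 v); case: (enc_nat v) => //= b ds [_ [_ h _]] /andP[bd _] _; exact: h.
- by move=> tm p1; apply: digits_KS dd st _ _.
Qed.

Lemma pos_of_mul (x y : R) : 0 <= y -> 0 < x * y -> 0 < x.
Proof.
move=> y0; have [x0|//] := leP x 0.
by rewrite ltNge mulr_le0_ge0.
Qed.

(** A positive mean forces both terms to be positive, so that positivity spreads along the
chains and the logarithms are meaningful. *)
Lemma avg_log2 (x y z : R) : 0 < x -> 0 <= y -> 0 <= z -> x ^+ 2 <= y * z ->
  [/\ 0 < y, 0 < z & 2 * log2 x <= log2 y + log2 z].
Proof.
move=> x0 y0 z0 le_xyz.
have yz : 0 < y * z by apply: lt_le_trans le_xyz; rewrite exprn_gt0.
have y1 : 0 < y := pos_of_mul z0 yz.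
have z1 : 0 < z by apply: (@pos_of_mul z y) => //; rewrite mulrC.
split=> //; rewrite -log2M // -log2Xn // ler_log2 // exprn_gt0 //.
Qed.

Definition ratio_sign (neg e : bool) : R := if neg (+) e then -1 else 1.

(** Induction from the last digit: [2 * (y' - v) <= y - v + s * d], and [v <= y'] at the
end. *)
Lemma digits_num D t s neg ds f w e : all is_digit ds ->
  sat D (PState f t true false s neg false) (ds ++ w) ->
  active (PState f t true false s neg false) e ->
  let V := D 0%N (KV e) in let Y := D 0%N (KY e) in
  let Y' := D (size ds) (KY e) in
  0 < V -> 0 < Y' -> log2 V <= log2 Y' ->
  0 < Y /\ log2 V <= log2 Y + ratio_sign neg e * (dval ds)%:R.
Proof.
elim: ds D f s => [|a ds IH] D f s; first by move=> /= _ _ _ V0 Y0; rewrite mulr0 addr0.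
move=> /= /andP[ad dsd] [D0 [ok _ st]] act V0 Y0 VY.
have {}st : sat (fun i => D i.+1) (PState false t true false false neg false) (ds ++ w).
  by case: (a) ad st.
have VE : D 1%N (KV e) = D 0%N (KV e).
  by apply: rule_carried ok _ _; [exact: digit_neq | case: (e)].
have D1 := sat_ge0 st.
have := IH _ _ _ dsd st act; rewrite /= VE => /(_ V0 Y0 VY) [Y1 le1].
have := rule_ratio ok act isT isT.
have yb0 := D0 (KY e); have y1 := D1 (KY e); rewrite /= in y1.
case: (a) ad => // b _; case: b.
- rewrite /= /ratio_sign; case: ifP => sg; rewrite /holds /= !(lsum1, lsum2) /adjacent /= => -[[h1 h2 h3] _].
  + have YY : 0 < D 1%N (KY e) + D 1%N (KY e) by rewrite addr_gt0.
    have [P0 _] := avg_log2 YY h1 h2 h3.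
    have y0 : 0 < D 0%N (KY e) by move: P0; rewrite -mulr2n pmulrn_lgt0.
    rewrite !log2_double // => h; split=> //.
    move: le1; rewrite /ratio_sign sg natrD natrM /=.
    by move: h VY; lra.
  + have [P0 _] := avg_log2 Y1 h1 h2 h3.
    have y0 : 0 < D 0%N (KY e) by move: P0; rewrite -mulr2n pmulrn_lgt0.
    rewrite log2_double // => h; split=> //.
    move: le1; rewrite /ratio_sign sg natrD natrM /=.
    by move: h VY; lra.
- rewrite /= => -[/holds_avg[h1 h2 h3] _].
  have [y0 _ h] := avg_log2 Y1 h1 h2 h3; split=> //.
  move: le1; rewrite natrD natrM /=.
  by move: h VY; rewrite /adjacent /=; lra.
Qed.

(** Each digit doubles the weight of what follows; the sides are chosen by the digits, so
that the weight of [B] is the number they denote. *)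
Lemma digits_den D t s neg ds f w e : all is_digit ds ->
  sat D (PState f t true false s neg true) (ds ++ w) ->
  active (PState f t true false s neg true) e ->
  let A := D 0%N (KA e) in let B := D 0%N (KA (~~ e)) in
  let Y := D 0%N (KY e) in let Y' := D (size ds) (KY e) in
  0 < A -> 0 < Y' ->
  [/\ 0 < Y, (0 < dval ds)%N -> 0 < B &
     2 ^+ size ds * log2 Y' <= log2 Y + (dval ds)%:R * log2 B +
        (2 ^+ size ds - 1 - (dval ds)%:R) * log2 A].
Proof.
elim: ds D f s => [|a ds IH] D f s.
  by move=> /= _ _ _ A0 Y0; split; rewrite // expr0; lra.
move=> /= /andP[ad dsd] [D0 [ok _ st]] act A0 Y0.
have {}st : sat (fun i => D i.+1) (PState false t true false false neg true) (ds ++ w).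
  by case: (a) ad st.
have AE b : D 1%N (KA b) = D 0%N (KA b).
  by apply: rule_carried ok _ _; [exact: digit_neq | case: (b)].
have := IH _ _ _ dsd st act; rewrite /= !AE => /(_ A0 Y0) [Y1 B1 le1].
have := rule_ratio ok act isT isT.
case: (a) ad => // b _ /=; rewrite /ratio_rules /= => -[/holds_avg[h1 h2 h3] _].
have [y0 leaf0] := avg_log2 Y1 h1 h2 h3; rewrite /adjacent /= => h.
split=> //.
  by case: (b) leaf0 => //= _; rewrite add0n muln_gt0 /=.
move: le1 h; rewrite exprS natrD natrM; case: (b) => /=; rewrite ?addTb ?addFb; nra.
Qed.

End WordRules.

(** * Soundness for one constraint *)

Section Soundness.
Variables (R : realType) (M : nat) (xv : seq symbol -> R).
Hypothesis M_gt0 : (0 < M)%N.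

Notation sat := (sat M xv).
Notation step_ok := (@step_ok R M).

(** The constraint [C] for the numbers [x v = 2 ^ (M * _)], exact except that a maximum is
replaced by a sum; [x v = 0] stands for -oo. *)
Definition soft (x : nat -> R) (C : mpa_constraint) : Prop :=
  match C with
  | LeMax v vs => x v <= \sum_(u <- vs) x u
  | LeShift v c u =>
      0 < x v -> 0 < x u /\ log2 (x v) <= M%:R * ratr c + log2 (x u)
  | LeAvg v u w => x v ^+ 2 <= x u * x w
  | EqConst v c => 0 < x v /\ log2 (x v) = M%:R * ratr c
  end.

Lemma ratr_num_den c : ratr c = ratio_sign R (c < 0) false * `|numq c|%:R / `|denq c|%:R :> R.
Proof.
rewrite -[c in LHS]divq_num_den fmorph_div /= !ratr_int.
rewrite -[`|denq c|%:R]/(`|denq c|%:Z%:~R) -[`|numq c|%:R]/(`|numq c|%:Z%:~R).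
rewrite absz_denq abszE /ratio_sign addbF -numq_lt0; case: ltP => h.
  by rewrite ltr0_norm // rmorphN mulN1r opprK.
by rewrite ger0_norm // mul1r.
Qed.

(** The two chains of digits are combined as explained at [ratio_rules]. *)
Lemma ratio_field D t c w :
  sat D (PState false t true false true false false) (enc_rat c ++ Comma :: w) ->
  exists D', [/\ sat D' (PState false t true true true false false) w,
    forall k, k \in carried -> D' 0%N k = D 0%N k &
    forall e, active (PState false t true false true false false) e ->
      0 < D 0%N (KA e) ->
      D 0%N (KY e) ^+ M <= D 0%N (KA e) * D 0%N (KV e) ^+ M.-1 ->
      0 < D 0%N (KA (~~ e)) /\
      log2 (D 0%N (KA e)) <=
        ratio_sign R false e * (M%:R * ratr c) + log2 (D 0%N (KA (~~ e)))].
Proof.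
rewrite /enc_rat -catA; set neg := c < 0 => st0.
set p := `|numq c|%N in st0; set q := `|denq c|%N in st0.
have [D1 [st1 car1 Y1]] : exists D1,
  [/\ sat D1 (PState false t true false true neg false)
        ((enc_nat p ++ Slash :: enc_nat q) ++ Comma :: w),
      forall k, k \in carried -> D1 0%N k = D 0%N k &
      forall e, active (PState false t true false true false false) e ->
        D1 0%N (KY e) <= D 0%N (KY e)].
  move: st0; case: (neg) => st0; last by exists D; split.
  move: st0 => /= [D0 [ok _ st]]; exists (fun i => D i.+1); split=> //.
    by move=> k; apply: rule_carried ok _.
  by move=> e act; have [/holds_le/andP[]] := rule_ratio ok act isT isT.
rewrite -catA /= in st1.
have pd := enc_nat_digits p; have qd := enc_nat_digits q.
have := sat_cat st1; rewrite parse_digits ?enc_nat_neq0 // => -[/=].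
rewrite addn0 => D2_0 [ok2 _ st3].
have car2 k : k \in carried -> D1 (size (enc_nat p)) k = D1 0%N k.
  exact: digits_carried pd st1.
have car3 k : k \in carried -> D1 (size (enc_nat p) + 1)%N k = D1 0%N k.
  by move=> kc; rewrite -car2 //; apply: rule_carried ok2 _ kc.
pose D3 i := D1 (size (enc_nat p) + i.+1)%N; rewrite -/D3 in st3.
have := sat_cat st3; rewrite parse_digits ?enc_nat_neq0 // => -[/=].
rewrite addn0; set n3 := size (enc_nat q); move=> D4_0 [ok4 _ st5].
have carD3 k : k \in carried -> D3 0%N k = D 0%N k.
  by move=> kc; rewrite /D3 car3 // car1.
have car4 k : k \in carried -> D3 n3 k = D 0%N k.
  by move=> kc; rewrite -carD3 //; apply: digits_carried qd st3 kc.
have car5 k : k \in carried -> D3 (n3 + 1)%N k = D 0%N k.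
  by move=> kc; rewrite -car4 //; apply: rule_carried ok4 _ kc.
exists (fun i => D3 (n3 + i.+1)%N); split=> //.
move=> e act A0 W0.
have cA b : KA b \in carried by case: b.
have cV b : KV b \in carried by case: b.
have [/holds_le/andP[_]] := rule_ratio ok4 act isT isT.
rewrite /adjacent /= -/n3 car4 // => AY4 _.
have Y4 : 0 < D3 n3 (KY e) by apply: lt_le_trans AY4.
have := digits_den qd st3 act.
rewrite /= !(carD3 (KA _) (cA _)) => /(_ A0 Y4) [Y3 B0 den_le].
rewrite dval_enc_nat in B0 den_le.
have q0 : (0 < q)%N by rewrite absz_gt0 denq_neq0.
have {}B0 := B0 q0; split=> //.
have [/holds_le/andP[_ YV] [/holds_le/andP[_ VY] _]] := rule_ratio ok2 act isT isT.
rewrite /adjacent /= car2 // car1 // in VY; rewrite /adjacent /= car2 // car1 // in YV.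
have V0 : 0 < D 0%N (KV e) by apply: lt_le_trans YV.
have Y2 : 0 < D1 (size (enc_nat p)) (KY e) by apply: lt_le_trans VY.
have := digits_num (e := e) pd st1 act.
rewrite /= car1 // ler_log2 // => /(_ V0 Y2 VY) [Y1_0 num_le].
rewrite dval_enc_nat in num_le.
have Y0 : 0 < D 0%N (KY e) by apply: lt_le_trans (Y1 e act).
have Y10 : log2 (D1 0%N (KY e)) <= log2 (D 0%N (KY e)) by rewrite ler_log2 // Y1.
have YV' : log2 (D3 0%N (KY e)) <= log2 (D 0%N (KV e)) by rewrite ler_log2.
have AY : log2 (D 0%N (KA e)) <= log2 (D3 n3 (KY e)) by rewrite ler_log2.
have MW : M%:R * log2 (D 0%N (KY e)) <=
    log2 (D 0%N (KA e)) + (M%:R - 1) * log2 (D 0%N (KV e)).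
  have -> : M%:R - 1 = M.-1%:R :> R by rewrite -subn1 natrB.
  rewrite -log2Xn // -log2Xn // -log2M ?exprn_gt0 //.
  by rewrite ler_log2 // ?mulr_gt0 ?exprn_gt0.
have M1 : 1 <= M%:R :> R by rewrite ler1n.
have q1 : 0 < q%:R :> R by rewrite ltr0n.
have pow1 : 0 < 2 ^+ n3 :> R by rewrite exprn_gt0.
have -> : ratio_sign R false e * (M%:R * ratr c) =
  M%:R * (ratio_sign R neg e * p%:R) / q%:R.
  rewrite ratr_num_den -/p -/q -/neg /ratio_sign addbF addFb.
  by case: (neg); case: (e) => /=; rewrite ?(mulN1r, mul1r, mulrN, mulNr, opprK) ?mulrA.
rewrite -lerBlDr ler_pdivlMr //.
set a := log2 (D 0%N (KA e)) in MW AY den_le *.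
set v := log2 (D 0%N (KV e)) in MW YV' num_le *.
set b := log2 (D 0%N (KA (~~ e))) in den_le *.
set y0 := log2 (D 0%N (KY e)) in MW Y10.
have h1 : (1 + q%:R) * a <= v + q%:R * b.
  have := ler_wpM2l (ltW pow1) AY; move: den_le YV'; lra.
have h2 : v <= y0 + ratio_sign R neg e * p%:R by move: num_le Y10; lra.
have h3 : M%:R * v <= M%:R * y0 + M%:R * (ratio_sign R neg e * p%:R).
  by rewrite -mulrDr ler_wpM2l // ler0n.
move: h1 h3 MW; lra.
Qed.

Lemma terminate_cons (t : symbol) (x : seq symbol) xs w :
  terminate t (x :: xs) ++ w = x ++ t :: (terminate t xs ++ w).
Proof. by rewrite /terminate /= cat_rcons -catA. Qed.

Lemma sat_tag D q t w : t \in [:: TagMax; TagShift; TagAvg; TagConst] ->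
  sat D q (t :: w) ->
  sat (fun i => D i.+1) (PState false t false false true false false) w.
Proof.
by case: t => [[]|||||||||] // _ [_ [_ _]]; case: q.
Qed.

(** At each name the sum loses one term, and it is 0 at the end of the constraint. *)
Lemma max_tail D f2 vs w :
  sat D (PState false TagMax true f2 true false false)
    (terminate Comma [seq enc_nat u | u <- vs] ++ Semicolon :: w) ->
  D 0%N KS <= \sum_(u <- vs) xv (enc_nat u) /\
  exists D' q', sat D' q' w.
Proof.
elim: vs D f2 => [|u vs IH] D f2.
  move=> [_ [ok _ st]]; split; last by exists (fun i => D i.+1), (parse (PState false TagMax true f2 true false false) Semicolon).
  by have [/holds_null /= + _] := rule_tag ok; rewrite big_nil /adjacent /= => ->.
rewrite map_cons terminate_cons => st.
have [D1 [[_ [ok _ st1]] _ X1 /(_ erefl isT) S1]] := name_field (a := Comma) isT st.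
have [S2 tl] := IH _ _ st1; split=> //.
apply: le_trans S1 _; have [/holds_le2/andP[_ +] _] := rule_tag ok.
rewrite /adjacent /= => /le_trans; apply.
by rewrite big_cons X1 lerD2l.
Qed.

Lemma sound_constraint D q C w :
  sat D q (enc_constraint C ++ Semicolon :: w) ->
  soft (fun v => xv (enc_nat v)) C /\ exists D' q', sat D' q' w.
Proof.
case: C => [v vs|v c u|v u u'|v c]; rewrite [enc_constraint _]/= cat_cons => /sat_tag;
  move=> /(_ isT); rewrite ?map_cons !terminate_cons => st.
- have [D1 [[_ [ok _ st1]] _ X1 _]] := name_field (a := Comma) isT st.
  have [S1 tl] := max_tail st1; split=> //=.
  have [/holds_le/andP[_ +] _] := rule_tag ok.
  by rewrite /adjacent /= X1 => /le_trans; apply.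
- have [D1 [[_ [ok1 _ st1]] _ X1 _]] := name_field (a := Comma) isT st.
  have A1 := rule_comma ok1 isT.
  have car1 k : k \in carried -> D1 1%N k = D1 0%N k by apply: rule_carried ok1 _.
  have [D2 [st2 car2 chain]] := ratio_field st1.
  have [D3 [[_ [ok3 _ st3]] car3 X3 _]] := name_field (a := Comma) isT st2.
  have /all_hold_eqs[_ B3] := rule_tag ok3.
  rewrite /adjacent /= X3 in B3.
  split; last by case: st3 => _ [_ _ tl]; eexists; eexists; exact: tl.
  have vA : D1 1%N (KA false) = xv (enc_nat v) by rewrite car1 // A1 X1.
  have uB : D1 1%N (KA true) = xv (enc_nat u) by rewrite -car2 // -car3.
  have W : D1 1%N (KY false) ^+ M <= D1 1%N (KA false) * D1 1%N (KV false) ^+ M.-1.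
    by rewrite (car1 (KA _)) // (car1 (KV _)) //; have [_ /(_ isT false isT)] := ok1.
  move=> v0; have := chain false isT; rewrite vA in W; rewrite /= vA uB /ratio_sign mul1r.
  by move=> /(_ v0 W).
- have [D1 [[_ [ok1 _ st1]] _ X1 _]] := name_field (a := Comma) isT st.
  have A1 := rule_comma ok1 isT.
  have car1 k : k \in carried -> D1 1%N k = D1 0%N k by apply: rule_carried ok1 _.
  have [D2 [[_ [ok2 _ st2]] car2 X2 _]] := name_field (a := Comma) isT st1.
  have car3 k : k \in carried -> D2 1%N k = D2 0%N k by apply: rule_carried ok2 _.
  have [D3 [[_ [ok3 _ st3]] car4 X3 _]] := name_field (a := Comma) isT st2.
  have /all_hold_eqs[_ B3] := rule_tag ok2.
  rewrite /adjacent /= in B3.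
  have [/holds_avg[_ _ +] _] := rule_tag ok3.
  rewrite /adjacent /= X3 !(car4 (KA _)) // !(car3 (KA _)) // -B3 car2 // car1 // A1 X1 X2.
  by split=> //; case: st3 => _ [_ _ tl]; eexists; eexists; exact: tl.
- have [D1 [[_ [ok1 _ st1]] _ X1 _]] := name_field (a := Comma) isT st.
  have A1 := rule_comma ok1 isT.
  have car1 k : k \in carried -> D1 1%N k = D1 0%N k by apply: rule_carried ok1 _.
  have [D2 [st2 car2 chain]] := ratio_field st1.
  case: st2 => _ [ok2 _ st2].
  have /all_hold_eqs[_ B2] := rule_tag ok2; rewrite /adjacent /= in B2.
  split; last by eexists; eexists; exact: st2.
  have vA : D1 1%N (KA false) = xv (enc_nat v) by rewrite car1 // A1 X1.
  have uB : D1 1%N (KA true) = 1 by rewrite -car2.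
  have W e : D1 1%N (KY e) ^+ M <= D1 1%N (KA e) * D1 1%N (KV e) ^+ M.-1.
    by rewrite (car1 (KA _)) ?(car1 (KV _)); [have [_ /(_ isT e)] := ok1; apply; case: (e) | case: e | case: e].
  have := chain true isT; rewrite /= vA uB ltr01 log2_1 => /(_ isT).
  have := W true; rewrite uB => -> /(_ isT) [v0 le1].
  have := chain false isT; rewrite /= vA uB => /(_ v0).
  have := W false; rewrite vA => -> /(_ isT) [_ le_sum_rule].
  move: le1 le_sum_rule; rewrite /ratio_sign /= log2_1; split=> //; lra.
Qed.

End Soundness.

(** * Completeness for one constraint *)

Section Completeness.
Variables (R : realType) (M : nat) (xv : seq symbol -> R).
Hypothesis M_gt0 : (0 < M)%N.
Hypothesis xv_ge0 : forall ds, 0 <= xv ds.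

Notation sat := (sat M xv).
Notation step_ok := (@step_ok R M).

(** Kinds [KG] and [KW] do not occur along the word. *)
Definition vals (x s : R) (A V Y : bool -> R) (k : kind) : R :=
  match k with
  | KX => x | KS => s | KA e => A e | KV e => V e | KY e => Y e | _ => 0
  end.

(** Assignments are built from right to left, like the words they belong to. *)
Definition scons (u : kind -> R) (D : nat -> kind -> R) (i : nat) : kind -> R :=
  if i is j.+1 then D j else u.

Lemma vals_ge0 x s A V Y : 0 <= x -> 0 <= s -> (forall e, 0 <= A e) ->
  (forall e, 0 <= V e) -> (forall e, 0 <= Y e) ->
  forall k, 0 <= vals x s A V Y k.
Proof. by move=> x0 s0 A0 V0 Y0 [||| e|e|e|e t] /=. Qed.

Lemma step_okI q a x x' s s' A V Y Y' :
  0 <= x -> (forall e, 0 <= A e) -> (forall e, 0 <= V e) ->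
  (is_digit a -> x' = x) ->
  (a == Comma -> ~~ p_past1 q -> x = A false) ->
  (p_past1 q -> ~~ p_past2 q -> forall e, active q e ->
    all_hold (adjacent (vals x s A V Y) (vals x' s' A V Y')) (ratio_rules q a e)) ->
  all_hold (adjacent (vals x s A V Y) (vals x' s' A V Y')) (tag_rules q a) ->
  (scale_start q a -> forall e, active q e -> Y' e ^+ M <= A e * V e ^+ M.-1) ->
  step_ok q a (vals x s A V Y) (vals x' s' A V Y').
Proof.
move=> x0 A0 V0 xx xA rr tr sr; split=> //.
rewrite /word_rules !all_hold_cat; split; [|split; [|split; [|split]]] => //.
- case: ifP => // _; apply/all_hold_flatten => c cc; apply/all_hold_eqs.
  move: cc; rewrite !inE => /or4P[] /eqP->; split=> //=; rewrite /adjacent /=; auto.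
- by case: ifP => // ad; apply/all_hold_eqs; rewrite /adjacent /= xx.
- by case: ifP => // /andP[ac p1]; apply/all_hold_eqs; rewrite /adjacent /= xA.
- case: ifP => // /andP[p1 p2]; apply/all_hold_flatten => e _.
  by case: ifP => // act; apply: rr.
Qed.

Lemma step_semicolon q x s A V Y u' :
  all_hold (adjacent (vals x s A V Y) u') (tag_rules q Semicolon) ->
  step_ok q Semicolon (vals x s A V Y) u'.
Proof.
move=> tr; split; last by move=> /andP[].
rewrite /word_rules !all_hold_cat; split; [|split; [|split; [|split]]] => //.
case: ifP => // _; apply/all_hold_flatten => e _.
by case: ifP.
Qed.

(** All positions of a name carry the same values. *)
Lemma complete_name D t f1 f2 st n d ds w x s A V Y :
  (f1 && ~~ f2 -> (t != TagShift) && (t != TagConst)) ->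
  0 <= x -> 0 <= s -> (forall e, 0 <= A e) ->
  (forall e, 0 <= V e) -> (forall e, 0 <= Y e) ->
  all is_digit ds ->
  D 0%N = vals x s A V Y ->
  sat D (foldl parse (PState false t f1 f2 st n d) ds) w ->
  (st -> ds != [::] -> x = xv (run (ds ++ w))) ->
  exists D', D' 0%N = vals x s A V Y /\
    sat D' (PState false t f1 f2 st n d) (ds ++ w).
Proof.
move=> tN x0 s0 A0 V0 Y0; elim: ds st => [|a ds IH] st; first by exists D.
move=> /andP[ad dsd] D0 stD xE.
have [D' [D'0 st']] : exists D', D' 0%N = vals x s A V Y /\
    sat D' (PState false t f1 f2 false n d) (ds ++ w).
  by apply: IH => //; case: (a) ad stD.
exists (scons (vals x s A V Y) D'); split=> //=.
split; first exact: vals_ge0; split; last by case: (a) ad.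
  rewrite D'0; apply: step_okI => //.
  - by case: (a) ad => // -[].
  - move=> /= p1 p2 e; rewrite /active /=; have := tN; rewrite p1 p2 => /(_ isT).
    by case/andP => /negPf-> /negPf->.
  - case: (a) ad => // b _; case: (t) => //=; case: (f1) => //=; split=> //.
    by apply/holds_le; rewrite /adjacent /= s0 lexx.
  - by case: (a) ad => // -[].
by move=> stt _; apply: xE.
Qed.

Section Ratio.
Variables (t : symbol) (s : R) (A : bool -> R) (z : bool -> bool) (a v : bool -> R).
Hypotheses (s_ge0 : 0 <= s) (A_ge0 : forall e, 0 <= A e).

(** The power of 2 with exponent [r], except that the whole chain for [e] vanishes if
[z e], which is the case when x_0 is -oo. *)
Definition pos_part (e : bool) (r : R) : R := if z e then 0 else pow2 r.

Let V e := pos_part e (v e).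

Lemma pos_part_ge0 e r : 0 <= pos_part e r.
Proof. by rewrite /pos_part; case: ifP => _; rewrite ?pow2_ge0. Qed.

Lemma pos_part_sqr e x y y' : 2 * x <= y + y' ->
  pos_part e x ^+ 2 <= pos_part e y * pos_part e y'.
Proof.
rewrite /pos_part; case: ifP => _ h; first by rewrite expr0n mulr0.
by rewrite pow2Xn -pow2D ler_pow2.
Qed.

Lemma pos_part_double e r : pos_part e r + pos_part e r = pos_part e (1 + r).
Proof.
rewrite /pos_part; case: ifP => _; first by rewrite addr0.
by rewrite pow2D pow2_1 mulr_natl.
Qed.

Hypothesis t_ratio : (t == TagShift) || (t == TagConst).

Lemma ratio_tag_rules q b u : p_tag q = t -> p_past1 q -> ~~ p_past2 q ->
  b != Semicolon -> all_hold u (tag_rules q b) (R := R).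
Proof.
move=> tE p1 /negPf p2 bS; rewrite /tag_rules tE p2.
by move: t_ratio => /orP[/eqP->|/eqP->]; case: (b) bS => //= -[].
Qed.

(** From right to left, each inequality of the chain is solved with equality, starting
from y = v; the sum of the digits read is then the exponent of [KY e]. *)
Lemma complete_num D neg st ds w x :
  0 <= x -> all is_digit ds ->
  D 0%N = vals x s A V V ->
  sat D (foldl parse (PState false t true false st neg false) ds) w ->
  (st -> ds != [::] -> x = xv (run (ds ++ w))) ->
  exists D', D' 0%N = vals x s A V
       (fun e => pos_part e (v e - ratio_sign R neg e * (dval ds)%:R)) /\
    sat D' (PState false t true false st neg false) (ds ++ w).
Proof.
move=> x0; elim: ds st => [|b ds IH] st.
  move=> _ D0 stD _; exists D; split=> //; rewrite D0; congr vals.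
  by apply/funext => e; rewrite mulr0 subr0.
move=> /andP[bd dsd] D0 stD xE.
have [D' [D'0 st']] : exists D', D' 0%N = vals x s A V
       (fun e => pos_part e (v e - ratio_sign R neg e * (dval ds)%:R)) /\
    sat D' (PState false t true false false neg false) (ds ++ w).
  by apply: IH => //; case: (b) bd stD.
exists (scons (vals x s A V
  (fun e => pos_part e (v e - ratio_sign R neg e * (dval (b :: ds))%:R))) D').
split=> //; split; first by apply: vals_ge0 => // e; apply: pos_part_ge0.
split; last by case: (b) bd.
  rewrite [scons _ _ 0%N]/= [scons _ _ 1%N]/= D'0; apply: step_okI => //.
  - by move=> e; apply: pos_part_ge0.
  - move=> _ _ e act; case: (b) bd => // -[] _ /=; (split; last by []).
    + rewrite /holds /ratio_sign natrD natrM; case: ifP => sg;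
      rewrite /= !(lsum1, lsum2) /adjacent /= !pos_part_double;
      split; rewrite ?pos_part_ge0 //; apply: pos_part_sqr; rewrite sg; lra.
    + apply/holds_avg; rewrite /adjacent /= !pos_part_ge0; split=> //.
      by apply: pos_part_sqr; rewrite natrD natrM /=; lra.
  - by apply: ratio_tag_rules => //; exact: digit_neq.
  - by rewrite /scale_start andbF.
by move=> stt _; apply: xE.
Qed.

(** Again all inequalities are equalities, starting from y = a at the end. *)
Lemma complete_den D neg st ds w x :
  (forall e, active (PState false t true false st neg true) e -> ~~ z e ->
     A e = pow2 (a e) /\ A (~~ e) = pow2 (a (~~ e))) ->
  0 <= x -> all is_digit ds ->
  D 0%N = vals x s A V (fun e => pos_part e (a e)) ->
  sat D (foldl parse (PState false t true false st neg true) ds) w ->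
  (st -> ds != [::] -> x = xv (run (ds ++ w))) ->
  exists D', D' 0%N = vals x s A V
       (fun e => pos_part e ((1 + (dval ds)%:R) * a e - (dval ds)%:R * a (~~ e))) /\
    sat D' (PState false t true false st neg true) (ds ++ w).
Proof.
move=> Aa x0; elim: ds st Aa => [|b ds IH] st Aa.
  move=> _ D0 stD _; exists D; split=> //; rewrite D0; congr vals.
  by apply/funext => e; rewrite mul0r subr0 addr0 mul1r.
move=> /andP[bd dsd] D0 stD xE.
pose Y ds e := pos_part e ((1 + (dval ds)%:R) * a e - (dval ds)%:R * a (~~ e)).
have [D' [D'0 st']] : exists D', D' 0%N = vals x s A V (Y ds) /\
    sat D' (PState false t true false false neg true) (ds ++ w).
  by apply: IH => //; case: (b) bd stD.
exists (scons (vals x s A V (Y (b :: ds))) D').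
split=> //; split; first by apply: vals_ge0 => // e; apply: pos_part_ge0.
split; last by case: (b) bd.
  rewrite [scons _ _ 0%N]/= [scons _ _ 1%N]/= D'0; apply: step_okI => //.
  - by move=> e; apply: pos_part_ge0.
  - move=> _ _ e act; case: (b) bd => // c _; split=> //.
    apply/holds_avg; rewrite /adjacent /=; split; rewrite ?pos_part_ge0 //.
    have [ze|ze] := boolP (z e); first by rewrite /Y /pos_part ze expr0n mul0r.
    have [Ae Ane] := Aa e act ze.
    have -> : A (c (+) e) = pos_part e (a (c (+) e)).
      by rewrite /pos_part (negPf ze); case: (c).
    by apply: pos_part_sqr; rewrite natrD natrM; case: (c) => /=; lra.
  - by apply: ratio_tag_rules => //; exact: digit_neq.
  - by rewrite /scale_start andbF.
by move=> stt _; apply: xE.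
Qed.

(** With v = a + s M p the inequalities that join the chains of p and of q hold as soon as
q a <= s M p + q b. *)
Lemma complete_ratio D c w x' s' Y' :
  let q := `|denq c|%N in let p := `|numq c|%N in
  let neg := c < 0 in
  (forall e, active (PState false t true false true false false) e ->
     if z e then A e = 0 else
     [/\ A e = pow2 (a e), A (~~ e) = pow2 (a (~~ e)),
         v e = a e + M%:R * (ratio_sign R neg e * p%:R) &
         q%:R * a e <= M%:R * (ratio_sign R neg e * p%:R) + q%:R * a (~~ e)]) ->
  D 0%N = vals x' s' A V Y' ->
  sat D (PState false t true true true false false) w ->
  exists D' x Y, [/\ D' 0%N = vals x s A V Y,
    sat D' (PState false t true false true false false) (enc_rat c ++ Comma :: w) &
    forall e, active (PState false t true false true false false) e ->
      Y e ^+ M <= A e * V e ^+ M.-1].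
Proof.
move=> q p neg H D0 stD.
have pd := enc_nat_digits p; have qd := enc_nat_digits q.
have V_ge0 e : 0 <= V e by apply: pos_part_ge0.
pose u1 := vals (xv (enc_nat q)) s A V (fun e => pos_part e (a e)).
have st1 : sat (scons u1 D) (PState false t true false false neg true) (Comma :: w).
  split; first by apply: vals_ge0 => // e; apply: pos_part_ge0.
  split=> //=; rewrite D0; apply: step_okI => //.
  - move=> _ _ e act; split=> //; apply/holds_le; rewrite /adjacent /= A_ge0.
    have := H e act; rewrite /pos_part; by case: ifP => [_ ->|_ [->]]; rewrite lexx.
  - by apply: ratio_tag_rules.
have [D2 [D20 st2]] : exists D', D' 0%N = vals (xv (enc_nat q)) s A V
    (fun e => pos_part e ((1 + q%:R) * a e - q%:R * a (~~ e))) /\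
    sat D' (PState false t true false true neg true) (enc_nat q ++ Comma :: w).
  rewrite -{2 3}(dval_enc_nat q); apply: (complete_den (D := scons u1 D)) => //.
  - by move=> e act ze; have := H e act; rewrite (negPf ze) => -[].
  - by rewrite parse_digits ?enc_nat_neq0.
  - by rewrite run_cat.
pose u3 := vals (xv (enc_nat p)) s A V V.
have st3 : sat (scons u3 D2) (PState false t true false false neg false)
    (Slash :: enc_nat q ++ Comma :: w).
  split; first exact: vals_ge0.
  split=> //=; rewrite D20; apply: step_okI => //.
  - move=> _ _ e act; split; last (split; last by []); apply/holds_le;
      rewrite /adjacent /= /V pos_part_ge0 ?lexx //=.
    rewrite /pos_part; have := H e act; case: ifP => // _ [_ _ -> h].
    by rewrite ler_pow2; lra.
  - by apply: ratio_tag_rules.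
have [D4 [D40 st4]] : exists D', D' 0%N = vals (xv (enc_nat p)) s A V
    (fun e => pos_part e (v e - ratio_sign R neg e * p%:R)) /\
    sat D' (PState false t true false true neg false)
      (enc_nat p ++ Slash :: enc_nat q ++ Comma :: w).
  rewrite -{2}(dval_enc_nat p); apply: (complete_num (D := scons u3 D2)) => //.
  - by rewrite parse_digits ?enc_nat_neq0.
  - by rewrite run_cat.
have WY e : active (PState false t true false true false false) e ->
   pos_part e (v e - ratio_sign R neg e * p%:R) ^+ M <= A e * V e ^+ M.-1.
  move=> act; have := H e act; rewrite /V /pos_part; case: ifP => _.
    by move=> ->; rewrite mul0r expr0n gtn_eqF.
  move=> [-> _ vE _]; rewrite !pow2Xn -pow2D ler_pow2.
  have -> : M.-1%:R = M%:R - 1 :> R by rewrite -subn1 natrB.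
  by rewrite vE; lra.
rewrite /enc_rat -catA -/neg -/p -/q.
case: (boolP neg) => negE; rewrite ?(negPf negE) ?negE in st4 WY D40 *; last first.
  by exists D4, (xv (enc_nat p)), (fun e => pos_part e (v e - ratio_sign R false e * p%:R)); rewrite -catA.
pose Y e := pos_part e (v e - ratio_sign R true e * p%:R).
exists (scons (vals 0 s A V Y) D4), 0, Y; split=> //.
split; first by apply: vals_ge0 => // e; apply: pos_part_ge0.
split=> //; last by rewrite -catA.
rewrite [scons _ _ 0%N]/= [scons _ _ 1%N]/= D40; apply: step_okI => //.
- move=> _ _ e act; split=> //; apply/holds_le; rewrite /adjacent /=.
  by rewrite pos_part_ge0 lexx.
- by apply: ratio_tag_rules.
Qed.

End Ratio.

Lemma complete_name_field D t f1 f2 v s A V Y x' s' Y' w :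
  (f1 && ~~ f2 -> (t != TagShift) && (t != TagConst)) ->
  0 <= s -> (forall e, 0 <= A e) ->
  (forall e, 0 <= V e) -> (forall e, 0 <= Y e) ->
  D 0%N = vals x' s' A V Y' ->
  sat D (PState false t true f1 true false false) w ->
  (~~ f1 -> xv (enc_nat v) = A false) ->
  all_hold (adjacent (vals (xv (enc_nat v)) s A V Y) (vals x' s' A V Y'))
    (tag_rules (PState false t f1 f2 false false false) Comma) ->
  (~~ f1 -> forall e, active (PState false t f1 f2 false false false) e ->
     Y' e ^+ M <= A e * V e ^+ M.-1) ->
  exists D', D' 0%N = vals (xv (enc_nat v)) s A V Y /\
    sat D' (PState false t f1 f2 true false false) (enc_nat v ++ Comma :: w).
Proof.
move=> tN s0 A0 V0 Y0 D0 stD xA tr sc.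
have st1 : sat (scons (vals (xv (enc_nat v)) s A V Y) D)
    (PState false t f1 f2 false false false) (Comma :: w).
  split; first exact: vals_ge0.
  split=> //=; rewrite D0; apply: step_okI => //.
  move=> /= p1 p2 e; rewrite /active /=; have := tN; rewrite p1 p2 => /(_ isT).
  by case/andP => /negPf-> /negPf->.
apply: (complete_name (D := scons (vals (xv (enc_nat v)) s A V Y) D)) => //.
- exact: enc_nat_digits.
- by rewrite parse_digits ?enc_nat_digits ?enc_nat_neq0.
- by rewrite run_cat // enc_nat_digits.
Qed.

Lemma complete_tag D q t x s A V Y w :
  t \in [:: TagMax; TagShift; TagAvg; TagConst] ->
  (forall e, 0 <= A e) -> (forall e, 0 <= V e) -> (forall e, 0 <= Y e) ->
  D 0%N = vals x s A V Y ->
  sat D (PState false t false false true false false) w ->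
  exists D', sat D' q (t :: w).
Proof.
move=> tT A0 V0 Y0 D0 stD; exists (scons (vals 0 0 A V Y) D).
split; first exact: vals_ge0.
have tag : tag_rules q t = [::] /\ forall e, ratio_rules q t e = [::].
  by move: tT; rewrite !inE => /or4P[] /eqP ->; rewrite /tag_rules; case: (p_tag q).
split; last 1 first.
- by move: tT stD; rewrite !inE => /or4P[] /eqP ->; case: (q).
- rewrite /= D0; apply: step_okI => //.
  + by move: tT; rewrite !inE => /or4P[] /eqP ->.
  + by move: tT; rewrite !inE => /or4P[] /eqP ->.
  + by move=> _ _ e _; have [_ ->] := tag.
  + by have [-> _] := tag.
  + by move: tT; rewrite !inE => /or4P[] /eqP ->.
- by move: tT; rewrite !inE => /or4P[] /eqP ->.
Qed.

Lemma complete_semicolon D q s A V Y w :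
  0 <= s -> (forall e, 0 <= A e) -> (forall e, 0 <= V e) -> (forall e, 0 <= Y e) ->
  all_hold (adjacent (vals 0 s A V Y) (D 0%N)) (tag_rules q Semicolon) ->
  sat D (parse q Semicolon) w ->
  sat (scons (vals 0 s A V Y) D) q (Semicolon :: w).
Proof.
move=> *; split; first exact: vals_ge0.
by split=> //; apply: step_semicolon.
Qed.

Lemma complete_max_tail D f2 vs w A V Y :
  (forall e, 0 <= A e) -> (forall e, 0 <= V e) -> (forall e, 0 <= Y e) ->
  sat D (PState false Semicolon false false true false false) w ->
  exists D' x, D' 0%N = vals x (\sum_(u <- vs) xv (enc_nat u)) A V Y /\
    sat D' (PState false TagMax true f2 true false false)
      (terminate Comma [seq enc_nat u | u <- vs] ++ Semicolon :: w).
Proof.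
move=> A0 V0 Y0 stD; elim: vs f2 => [|u vs IH] f2.
  exists (scons (vals 0 0 A V Y) D), 0; rewrite big_nil; split=> //.
  apply: complete_semicolon => //; split=> //.
  by apply/holds_null.
have [D1 [x [D10 st1]]] := IH true.
rewrite map_cons terminate_cons big_cons.
have [] := @complete_name_field D1 TagMax true f2 u
  (xv (enc_nat u) + \sum_(j <- vs) xv (enc_nat j)) A V Y _ _ _ _ _ _ A0 V0 Y0 D10 st1.
- by [].
- by rewrite addr_ge0 ?sumr_ge0.
- by [].
- split=> //; apply/holds_le2; rewrite /adjacent /= lexx andbT.
  by rewrite addr_ge0 ?sumr_ge0.
- by [].
by move=> D2 [D20 st2]; exists D2, (xv (enc_nat u)).
Qed.

Lemma ratio_sign_numq (c : rat) :
  ratio_sign R (c < 0) false * `|numq c|%:R = `|denq c|%:R * ratr c.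
Proof.
rewrite ratr_num_den [RHS]mulrC divfK // pnatr_eq0 -lt0n absz_gt0.
exact: denq_neq0.
Qed.

Lemma ratio_signT neg (r : R) : ratio_sign R neg true * r = - (ratio_sign R neg false * r).
Proof. by rewrite /ratio_sign; case: neg; rewrite /= ?mulN1r ?mul1r ?opprK. Qed.

Lemma complete_constraint D q C w :
  soft M (fun v => xv (enc_nat v)) C ->
  sat D (PState false Semicolon false false true false false) w ->
  exists D', sat D' q (enc_constraint C ++ Semicolon :: w).
Proof.
have n0 (e : bool) : 0 <= (0 : R) by [].
case: C => [v vs|v c u|v u u'|v c]; rewrite [enc_constraint _]/= cat_cons;
  rewrite ?map_cons !terminate_cons /= => sC stD.
- pose A (e : bool) := if e then 0 else xv (enc_nat v).
  have A0 e : 0 <= A e by case: e => /=.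
  have [D1 [x [D10 st1]]] := complete_max_tail false vs A0 n0 n0 stD.
  have [|//||//|D2 [D20 st2]] := @complete_name_field D1 TagMax false false v 0 A _ _
    _ _ _ _ _ (lexx 0) A0 n0 n0 D10 st1; first by [].
    split=> //; apply/holds_le; rewrite /adjacent /= xv_ge0 //.
  by apply: (complete_tag _ _ A0 n0 n0 D20 st2).
- pose A (e : bool) := if e then xv (enc_nat u) else xv (enc_nat v).
  have A0 e : 0 <= A e by case: e => /=.
  pose z e := e || (xv (enc_nat v) == 0).
  pose a e := log2 (A e).
  pose V e := pos_part z e (a e + M%:R *
    (ratio_sign R (c < 0) e * `|numq c|%:R)).
  have V0 e : 0 <= V e by apply: pos_part_ge0.
  have st1 : sat (scons (vals 0 0 A V (fun=> 0)) D)
      (PState false TagShift true true true false false) (Semicolon :: w).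
    exact: complete_semicolon.
  have [] := @complete_name_field _ TagShift true true u 0 A V (fun=> 0)
    _ _ _ _ _ (lexx 0) A0 V0 n0 erefl st1; try by [].
    by apply/all_hold_eqs; rewrite /adjacent /= xv_ge0.
  move=> D2 [D20 st2].
  have [|D3 [x [Y [D30 st3 WY]]]] := complete_ratio (v := fun e => a e + M%:R *
    (ratio_sign R (c < 0) e * `|numq c|%:R)) (z := z) (a := a)
    (t := TagShift) (lexx 0) A0 isT (c := c) _ D20 st2.
    case=> // _.
    rewrite /z /=; case: eqP => // /eqP vn0.
    have v0 : 0 < xv (enc_nat v) by rewrite lt_def vn0 xv_ge0.
    have [u0 h] := sC v0; rewrite /a /= !log2K //; split=> //.
    by rewrite ratio_sign_numq (mulrCA M%:R `|denq c|%:R) -mulrDr ler_wpM2l // ler0n.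
  have [] := @complete_name_field _ TagShift false false v 0 A V (fun=> 0)
    _ _ _ _ _ (lexx 0) A0 V0 n0 D30 st3; try by [].
  by move=> D4 [D40 st4]; apply: (complete_tag _ _ A0 V0 n0 D40 st4).
- pose A (e : bool) := if e then xv (enc_nat u) else xv (enc_nat v).
  have A0 e : 0 <= A e by case: e => /=.
  have st1 : sat (scons (vals 0 0 A (fun=> 0) (fun=> 0)) D)
      (PState false TagAvg true true true false false) (Semicolon :: w).
    exact: complete_semicolon.
  have [] := @complete_name_field _ TagAvg true true u' 0 A (fun=> 0) (fun=> 0)
    _ _ _ _ _ (lexx 0) A0 n0 n0 erefl st1; try by [].
    by split=> //; apply/holds_avg; rewrite /adjacent /= !xv_ge0.
  move=> D2 [D20 st2].
  have [] := @complete_name_field _ TagAvg true false u 0 A (fun=> 0) (fun=> 0)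
    _ _ _ _ _ (lexx 0) A0 n0 n0 D20 st2; try by [].
    by apply/all_hold_eqs; rewrite /adjacent /= xv_ge0.
  move=> D3 [D30 st3].
  have [] := @complete_name_field _ TagAvg false false v 0 A (fun=> 0) (fun=> 0)
    _ _ _ _ _ (lexx 0) A0 n0 n0 D30 st3; try by [].
  by move=> D4 [D40 st4]; apply: (complete_tag _ _ A0 n0 n0 D40 st4).
- case: sC => v0 vE.
  pose A (e : bool) := if e then 1 else xv (enc_nat v).
  have A0 e : 0 <= A e by case: e => /=.
  pose a e := log2 (A e).
  pose V e := pos_part (fun=> false) e (a e + M%:R *
    (ratio_sign R (c < 0) e * `|numq c|%:R)).
  have V0 e : 0 <= V e by apply: pos_part_ge0.
  have st1 : sat (scons (vals 0 0 A V (fun=> 0)) D)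
      (PState false TagConst true true true false false) (Semicolon :: w).
    by apply: complete_semicolon => //; apply/all_hold_eqs; rewrite /adjacent /= ler01.
  have [|D3 [x [Y [D30 st3 WY]]]] := complete_ratio (v := fun e => a e + M%:R *
    (ratio_sign R (c < 0) e * `|numq c|%:R)) (z := fun=> false) (a := a)
    (t := TagConst) (lexx 0) A0 isT (c := c) _ (erefl : scons _ D 0%N = _) st1.
    move=> e _; rewrite /a /A; case: e; rewrite /= !log2K //; split=> //.
      rewrite log2_1 mulr0 vE ratio_signT ratio_sign_numq.
      by rewrite mulrN (mulrCA M%:R `|denq c|%:R) addrC subrr.
    by rewrite log2_1 mulr0 addr0 vE ratio_sign_numq (mulrCA M%:R `|denq c|%:R) lexx.
  have [] := @complete_name_field _ TagConst false false v 0 A V (fun=> 0)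
    _ _ _ _ _ (lexx 0) A0 V0 n0 D30 st3; try by [].
  by move=> D4 [D40 st4]; apply: (complete_tag _ _ A0 V0 n0 D40 st4).
Qed.

End Completeness.

(** * From the word to the grid of pairs of positions *)

Section Words.
Variables (R : realType) (M : nat) (xv : seq symbol -> R).
Hypothesis M_gt0 : (0 < M)%N.

Lemma enc_mpa_cons C I : enc_mpa (C :: I) = enc_constraint C ++ Semicolon :: enc_mpa I.
Proof. by rewrite /enc_mpa /= -[LHS]cats0 terminate_cons cats0. Qed.

Lemma sound_word D q I : sat M xv D q (enc_mpa I) ->
  forall C, List.In C I -> soft M (fun v => xv (enc_nat v)) C.
Proof.
elim: I D q => [|C I IH] D q // st C'.
move: st; rewrite enc_mpa_cons => /(sound_constraint M_gt0)[sC [D' [q' st]]].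
by move=> /= -[<-|/(IH _ _ st)].
Qed.

Lemma complete_word q I : (forall ds, 0 <= xv ds) ->
  (forall C, List.In C I -> soft M (fun v => xv (enc_nat v)) C) ->
  exists D, sat M xv D q (enc_mpa I).
Proof.
move=> xv0; elim: I q => [|C I IH] q sI; first by exists (fun=> fun=> 0).
have [|D st] := IH (PState false Semicolon false false true false false).
  by move=> C' C'I; apply: sI; right.
rewrite enc_mpa_cons; apply: complete_constraint st => //.
by apply: sI; left.
Qed.

Lemma last_enc_mpa I : last Semicolon (enc_mpa I) = Semicolon.
Proof.
elim: I => [|C I IH] //; rewrite enc_mpa_cons last_cat /= IH.
by [].
Qed.

End Words.

Lemma onth_annotate q w i : (i < size w)%N ->
  exists q', onth (annotate parse q w) i = Some (q', nth Semicolon w i).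
Proof.
elim: w q i => [|a w IH] q [|i] //= iw; first by exists q.
exact: IH.
Qed.

Lemma onth_annotate_inv q w i q' a :
  onth (annotate parse q w) i = Some (q', a) ->
  (i < size w)%N /\ nth Semicolon w i = a.
Proof.
move=> E; have iw : (i < size w)%N.
  rewrite ltnNge; apply/negP => wi; move: E.
  by rewrite onth_default // size_annotate.
split=> //; have [q'' E'] := onth_annotate q iw.
by move: E; rewrite E' => -[].
Qed.

Lemma first_annotate q w i q' a :
  onth (annotate parse q w) i = Some (q', a) -> p_first q' -> i = 0%N.
Proof.
case: i w => // i [|b w] //=.
have pf p c : p_first (parse p c) = false by case: p; case: c.
move: (pf q b); elim: w (parse q b) i => [|c w IH] p [|i] //= pF.
  by move=> [<-]; rewrite pF.
by move=> E pq; have := IH _ _ (pf p c) E pq.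
Qed.

Lemma run_drop w i : (i < size w)%N -> run (drop i w) =
  if is_digit (nth Semicolon w i)
  then nth Semicolon w i :: run (drop i.+1 w) else [::].
Proof. by move=> iw; rewrite (drop_nth Semicolon iw). Qed.

(** The rules along the word, position by position. *)
Lemma satP (R : realType) M (xv : seq symbol -> R) D q w :
  sat M xv D q w <->
  (forall i k, (i <= size w)%N -> 0 <= D i k) /\
  (forall i q' a, onth (annotate parse q w) i = Some (q', a) ->
     step_ok M q' a (D i) (D i.+1) /\
     (p_start q' -> is_digit a -> D i KX = xv (run (drop i w)))).
Proof.
elim: w D q => [|a w IH] D q /=.
  split=> [[D0 _]|[D0 _]]; split=> //.
  - by case=> [|i] k //= _; apply: D0.
  - by case.
  by move=> k; apply: D0.
split.
- move=> [D0 [ok nm /IH[D1 st]]]; split.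
    by case=> [|i] k //= ik; apply: D1.
  case=> [|i] q' b /=; last by move=> /st.
  by move=> [<- <-].
- move=> [D0 st]; split; first by move=> k; apply: D0.
  have [ok nm] := st 0%N q a erefl; split=> //.
  apply/IH; split; first by move=> i k ik; apply: D0.
  by move=> i q' b E; apply: (st i.+1).
Qed.

(** The kinds that rules along the word may mention. *)
Definition word_kind (k : kind) : bool :=
  match k with KG | KW _ _ => false | _ => true end.

Lemma word_rules_ext (R : realType) (u v : kind * bool -> R) q a :
  (forall k b, word_kind k -> u (k, b) = v (k, b)) ->
  all_hold u (word_rules q a) -> all_hold v (word_rules q a).
Proof.
move=> uv; pose f (kb : kind * bool) := (if word_kind kb.1 then kb.1 else KX, kb.2).
have E : map (map_block f) (word_rules q a) = word_rules q a.
  rewrite /word_rules !map_cat; congr (_ ++ (_ ++ (_ ++ (_ ++ _)))).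
  - by case: ifP.
  - by case: ifP.
  - by case: ifP.
  - case: ifP => //= _; case: (active q false); case: (active q true) => //=;
    case: a => //= b; case: (p_den q) => //; case: b => //;
    by case: (p_neg q).
  - rewrite /tag_rules; case: (p_tag q); case: a => //=; intros;
    by case: (p_past1 q); case: (p_past2 q).
rewrite -E => /all_hold_map_block h; apply/all_hold_map_block.
suff <- : u \o f = v \o f by [].
by apply/funext => -[k b]; rewrite /f /=; case: ifP => kw; rewrite uv.
Qed.

Section Grid.
Variables (R : realType) (w : seq symbol).

(** Eight halvings for each symbol leave enough room for the error analysis of
[slack_small]. *)
Definition scale : nat := (2 ^ (8 * size w))%N.

Lemma scale_gt0 : (0 < scale)%N.
Proof. by rewrite expn_gt0. Qed.

Notation cell_at i := (onth (annotate parse pstate0 w) i).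

Definition grid_value (X : kind -> nat -> nat -> R) (i j : nat) (km : kind * mode) : R :=
  X km.1 (target km.2 i j).1 (target km.2 i j).2.

Definition grid_ok (X : kind -> nat -> nat -> R) : Prop :=
  forall i j, (i <= size w)%N -> (j <= size w)%N ->
  all_hold (grid_value X i j) (grid_rules (cell_at i) (cell_at j) (i == j)).

Section GridSound.
Variable X : kind -> nat -> nat -> R.
Hypotheses (okX : grid_ok X) (lastw : ~~ is_digit (last Semicolon w)).

Lemma grid_ge0 k i j : (i <= size w)%N -> (j <= size w)%N -> 0 <= X k i j.
Proof.
move=> iw jw; have := okX iw jw; rewrite /grid_rules all_hold_cat all_hold_map.
by move=> [/(_ k) + _]; rewrite mem_enum holds_nonneg /grid_value /= => /(_ isT).
Qed.

Lemma grid_word i q a : cell_at i = Some (q, a) ->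
  all_hold (adjacent (fun k => X k i i) (fun k => X k i.+1 i.+1)) (word_rules q a).
Proof.
move=> E; have [iw _] := onth_annotate_inv E.
have := okX (ltnW iw) (ltnW iw); rewrite /grid_rules eqxx E.
move=> /all_hold_cat[_ /all_hold_cat[/all_hold_map_block + _]].
set f := _ \o _; suff -> : f = adjacent (fun k => X k i i) (fun k => X k i.+1 i.+1) by [].
by apply/funext => -[k []].
Qed.

Lemma grid_names i j q q' a a' :
  cell_at i = Some (q, a) -> cell_at j = Some (q', a') ->
  all_hold (grid_value X i j) (name_rules q q' a a').
Proof.
move=> E E'; have [iw _] := onth_annotate_inv E; have [jw _] := onth_annotate_inv E'.
have := okX (ltnW iw) (ltnW jw); rewrite /grid_rules E E'.
by move=> /all_hold_cat[_ /all_hold_cat[_ /all_hold_cat[]]].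
Qed.

Lemma grid_scale i j q a e : cell_at i = Some (q, a) -> (j <= size w)%N ->
  scale_start q a -> active q e ->
  all_hold (grid_value X i j) (scale_rules e (cell_at j)).
Proof.
move=> E jw sq act; have [iw _] := onth_annotate_inv E.
have := okX (ltnW iw) jw; rewrite /grid_rules E sq.
move=> /all_hold_cat[_ /all_hold_cat[_ /all_hold_cat[_ /all_hold_flatten/(_ e)]]].
rewrite act; apply.
by rewrite !inE; case: (e).
Qed.

Lemma grid_KX i : (i < size w)%N -> is_digit (nth Semicolon w i) ->
  X KX i.+1 i.+1 = X KX i i.
Proof.
move=> iw id; have [q E] := onth_annotate pstate0 iw.
have := grid_word E; rewrite /word_rules !all_hold_cat id => -[_ [+ _]].
by move=> /all_hold_eqs[].
Qed.

(** The two names are followed to their common end. They do end inside the word, since its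
last symbol is not a digit. *)
Lemma name_chain i j : (i < size w)%N -> (j < size w)%N ->
  run (drop i w) = run (drop j w) -> X KG i j <= X KX j j.
Proof.
move E : (run (drop i w)) => ds; elim: ds i j E => [|d ds IH] i j.
  move=> + iw jw; rewrite (run_drop iw) (run_drop jw); case: ifP => // id _; case: ifP => // jd _.
  have [q Ei] := onth_annotate pstate0 iw; have [q' Ej] := onth_annotate pstate0 jw.
  have := grid_names Ei Ej; rewrite /name_rules !all_hold_cat id jd !andbF /=.
  by move=> [_ [_ [/holds_le/andP[_ +] _]]].
move=> + iw jw; rewrite (run_drop iw) (run_drop jw); case: ifP => // id; case: ifP => // jd.
move=> [di ri] [dj rj].
have nxt k : (k < size w)%N -> is_digit (nth Semicolon w k) -> (k.+1 < size w)%N.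
  move=> kw kd; rewrite ltn_neqAle; apply/andP; split=> //; apply/eqP => kE.
  by move: lastw; rewrite (last_nth Semicolon) -kE /= kd.
rewrite -(grid_KX jw jd).
apply: le_trans _ (IH i.+1 j.+1 ri (nxt _ iw id) (nxt _ jw jd) rj).
have [q Ei] := onth_annotate pstate0 iw; have [q' Ej] := onth_annotate pstate0 jw.
have := grid_names Ei Ej; rewrite /name_rules !all_hold_cat id di dj eqxx /=.
by move=> [_ [[/holds_le/andP[_ +] _] _]].
Qed.

(** The [s]-th term [W s] of the chain satisfies [W s ^+ (2 ^ s) <= A * V ^+ (2 ^ s - 1)];
each step squares this. *)
Lemma scale_chain i q a e : cell_at i = Some (q, a) -> scale_start q a ->
  active q e ->
  X (KY e) i.+1 i.+1 ^+ scale <= X (KA e) i i * X (KV e) i i ^+ scale.-1.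
Proof.
move=> E sq act; have [iw _] := onth_annotate_inv E.
pose W s := X (KW e (inord (s %% 8))) i (s %/ 8).
have n0 : (0 < size w)%N by apply: leq_ltn_trans iw.
have A0 : 0 <= X (KA e) i i by apply: grid_ge0; apply: ltnW.
have V0 : 0 <= X (KV e) i i by apply: grid_ge0; apply: ltnW.
have Wchain s : (s <= 8 * size w)%N ->
    W s ^+ (2 ^ s) <= X (KA e) i i * X (KV e) i i ^+ (2 ^ s).-1.
  elim: s => [_|s IH sw].
    have [q' E0] := onth_annotate pstate0 n0.
    have := grid_scale E (leq0n _) sq act; rewrite E0 /scale_rules all_hold_cat.
    have -> : p_first q' by case: (w) n0 E0 => //= ? ? _ [<-].
    move=> [[/holds_le/andP[_ +] _] _]; rewrite !expr1 expr0 mulr1 /W /grid_value /=.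
    by congr (X (KW e _) _ _ <= _); apply: val_inj; rewrite /= inordK.
  have jw : (s %/ 8 < size w)%N by lia.
  have [q' Ej] := onth_annotate pstate0 jw.
  have := grid_scale E (ltnW jw) sq act; rewrite Ej /scale_rules all_hold_cat all_hold_map.
  move=> [_ /(_ (inord (s %% 8)))]; rewrite mem_enum => /(_ isT)/holds_avg[W0 _].
  have -> : oapp (grid_value X i (s %/ 8)) 1 (halved e (inord (s %% 8))) = W s.+1.
    rewrite /halved inordK ?ltn_mod // /W /grid_value; case: ifP => h /=.
      have -> : (s.+1 %% 8 = (s %% 8).+1)%N by lia.
      by have -> : (s.+1 %/ 8 = s %/ 8)%N by lia.
    have -> : (s.+1 %% 8 = 0)%N by lia.
    have -> : (s.+1 %/ 8 = (s %/ 8).+1)%N by lia.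
    by congr X; congr KW; apply: val_inj; rewrite /= inordK.
  rewrite /grid_value /= in W0 *; rewrite -/(W s) in W0 * => le1.
  rewrite expnS mulnC exprM -exprM mulnC exprM.
  apply: (@le_trans _ _ ((W s * X (KV e) i i) ^+ (2 ^ s))).
    by rewrite lerXn2r // nnegrE ?exprn_even_ge0 ?mulr_ge0.
  rewrite exprMn; apply: le_trans (ler_wpM2r (exprn_ge0 _ V0) (IH (ltnW sw))) _.
  rewrite -mulrA -exprD ler_wpM2l // le_eqVlt; apply/orP; left; apply/eqP.
  congr (_ ^+ _); have : (0 < 2 ^ s)%N by rewrite expn_gt0.
  by move: (2 ^ s)%N => N; lia.
have := grid_scale E (leqnn _) sq act.
rewrite [cell_at _]onth_default ?size_annotate // => -[/holds_le/andP[Y0 YW] _].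
apply: le_trans (Wchain (8 * size w)%N (leqnn _)).
rewrite /grid_value /= in Y0 YW; apply: lerXn2r; rewrite ?nnegrE //.
  by apply: grid_ge0; rewrite ?leq_div2r //; [exact: ltnW | rewrite mulKn].
apply: le_trans YW _; rewrite /W mulKn // modnMr le_eqVlt; apply/orP; left; apply/eqP.
by congr X; congr KW; apply: val_inj; rewrite /= inordK.
Qed.

(** By [name_rules], all occurrences of a name have the same value, which defines
[xv]. *)
Lemma grid_sound : exists xv, (forall ds, 0 <= xv ds) /\
  sat scale xv (fun i k => X k i i) pstate0 w.
Proof.
pose named i := exists q a, [/\ cell_at i = Some (q, a), p_start q & is_digit a].
have same i j : named i -> named j -> run (drop i w) = run (drop j w) ->
    X KX i i <= X KX j j.
  move=> [q [a [Ei qs ad]]] [q' [a' [Ej qs' ad']]] rE.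
  have [iw _] := onth_annotate_inv Ei; have [jw _] := onth_annotate_inv Ej.
  apply: le_trans (name_chain iw jw rE).
  have := grid_names Ei Ej; rewrite /name_rules !all_hold_cat qs qs' ad ad' /=.
  by move=> [[/holds_le/andP[_ +] _] _].
have /choice[xv xvP] : forall ds, exists r : R, 0 <= r /\
    forall i, named i -> run (drop i w) = ds -> X KX i i = r.
  move=> ds.
  have [[i [ni ri]]|none] := pselect (exists i, named i /\ run (drop i w) = ds).
    have [q [a [Ei _ _]]] := ni; have [iw _] := onth_annotate_inv Ei.
    exists (X KX i i); split; first by apply: grid_ge0; apply: ltnW.
    move=> j nj rj; apply/eqP; rewrite eq_le !same // ?ri ?rj //.
  by exists 0; split=> // i ni ri; case: none; exists i.
exists xv; split; first by move=> ds; have [] := xvP ds.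
apply/satP; split; first by move=> i k iw; apply: grid_ge0.
move=> i q a E; split; last by move=> qs ad; apply: (xvP _).2 => //; exists q, a.
split; first exact: grid_word.
by move=> sq e act; apply: scale_chain E sq act.
Qed.

End GridSound.

(** The exact solution of the halving chain. *)
Definition root_value (A V : R) (s : nat) : R :=
  if (A == 0) || (V == 0) then 0
  else pow2 (log2 V + (log2 A - log2 V) / 2 ^+ s).

(** If the rest of the two names is the same then [KG] is the value at j, and otherwise the
value at i, which is large enough at the start and never compared at the end. *)
Definition grid_of (D : nat -> kind -> R) (k : kind) (i j : nat) : R :=
  if (i <= size w)%N && (j <= size w)%N then
    match k with
    | KG => if run (drop i w) == run (drop j w) then D j KX else D i KX
    | KW e t => root_value (D i (KA e)) (D i (KV e)) (8 * j + t)
    | _ => D i k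
    end
  else 0.

Lemma root_value_ge0 A V s : 0 <= root_value A V s.
Proof. by rewrite /root_value; case: ifP; rewrite ?pow2_ge0. Qed.

Lemma grid_complete xv D : sat scale xv D pstate0 w -> grid_ok (grid_of D).
Proof.
move=> /satP[D0 st] i j iw jw; rewrite /grid_rules all_hold_cat; split.
  apply/all_hold_map => k _; apply/holds_nonneg.
  rewrite /grid_value /grid_of /= iw jw; case: k => *; rewrite ?root_value_ge0 ?D0 //.
  by case: ifP; rewrite D0.
case Ei : (cell_at i) => [[q a]|] //.
have [iw' ai] := onth_annotate_inv Ei; have [ok nm] := st _ _ _ Ei.
rewrite !all_hold_cat; split; [|split].
- case: eqP => // <-{j jw}; apply/all_hold_map_block.
  have [+ _] := ok; apply: word_rules_ext => k b wk.
  by case: b; case: k wk => //= *; rewrite /grid_value /grid_of /= ?iw ?iw'.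
- case Ej : (cell_at j) => [[q' a']|] //.
  have [jw' aj] := onth_annotate_inv Ej; have [ok' nm'] := st _ _ _ Ej.
  have KGE : grid_of D KG i j = if run (drop i w) == run (drop j w) then D j KX else D i KX.
    by rewrite /grid_of iw jw.
  have KXE k : (k <= size w)%N -> grid_of D KX k k = D k KX.
    by move=> kw; rewrite /grid_of kw.
  rewrite /name_rules; apply/all_hold_cat; split; last (apply/all_hold_cat; split).
  + case: ifP => // /and4P[qs qs' ad ad']; split=> //; apply/holds_le.
    rewrite /grid_value /= KGE KXE // D0 //=; case: eqP => // rE.
    by rewrite nm // nm' // rE.
  + case: ifP => // /andP[ad /eqP aa]; split=> //; apply/holds_le.
    rewrite /grid_value /= KGE [grid_of D KG _ _]/grid_of iw' jw' /=.
    rewrite (rule_KX ok ad) (rule_KX ok') -?aa // (run_drop iw') (run_drop jw').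
    rewrite ai aj -aa ad eqseq_cons eqxx /=.
    by case: ifP; rewrite D0 // lexx.
  + case: ifP => // /andP[ad ad']; split=> //; apply/holds_le.
    rewrite /grid_value /= KGE KXE // (run_drop iw') (run_drop jw') ai aj.
    by rewrite (negPf ad) (negPf ad') eqxx D0 // lexx.
- case: ifP => // sq; apply/all_hold_flatten => e _; case: ifP => // act.
  set A := D i (KA e); set V := D i (KV e).
  have A0 : 0 <= A by apply: D0.
  have V0 : 0 <= V by apply: D0.
  have KWE t k : (k <= size w)%N -> grid_of D (KW e t) i k = root_value A V (8 * k + t).
    by move=> kw; rewrite /grid_of iw kw.
  rewrite /scale_rules; case Ej : (cell_at j) => [[q' a']|].
    have [jw' _] := onth_annotate_inv Ej; apply/all_hold_cat; split.
      case: ifP => // qf; have j0 := first_annotate Ej qf; split=> //; apply/holds_le.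
      rewrite /grid_value /= KWE // root_value_ge0 j0 /grid_of iw /= -/A.
      rewrite /root_value; case: ifPn => // /norP[An Vn].
      by rewrite expr0 divr1 addrC subrK log2K // lt_def An A0.
    apply/all_hold_map => t _; apply/holds_avg.
    rewrite /grid_value /= KWE // root_value_ge0 /grid_of iw /= -/V; split=> //.
    have -> : oapp (fun km => grid_of D km.1 (target km.2 i j).1 (target km.2 i j).2) 1
        (halved e t) = root_value A V (8 * j + t).+1.
      rewrite /halved; case: ifP => /= t8; rewrite KWE //=.
        by rewrite inordK // addnS.
      congr root_value; have := ltn_ord t; lia.
    rewrite /root_value; case: ifPn => [_|/norP[An Vn]]; first by rewrite expr0n mul0r.
    have {}V0 : 0 < V by rewrite lt_def Vn V0.
    rewrite -[X in _ <= _ * X](log2K V0) pow2Xn -pow2D ler_pow2.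
    by rewrite exprS invfM; set x := (2 ^+ _)^-1; lra.
  have jE : j = size w.
    apply/eqP; rewrite eqn_leq jw leqNgt; apply/negP => jw'.
    by have [q' E] := onth_annotate pstate0 jw'; rewrite E in Ej.
  split=> //; apply/holds_le; rewrite /grid_value /= KWE // /grid_of iw' /= addn0 jE.
  have Y0 : 0 <= D i.+1 (KY e) by apply: D0.
  rewrite Y0 /=; have [_ /(_ sq e act)] := ok; rewrite -/A -/V => le1.
  have n0 : (0 < size w)%N by apply: leq_ltn_trans iw'.
  have M1 : (0 < scale.-1)%N.
    by rewrite -ltnS prednK ?scale_gt0 // /scale -[1%N](expn0 2) ltn_exp2l //; lia.
  have le_root (y : R) : 0 <= y -> D i.+1 (KY e) ^+ scale <= y ^+ scale ->
      D i.+1 (KY e) <= y.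
    by move=> y0; rewrite ler_pXn2r ?nnegrE // scale_gt0.
  apply: le_root; first exact: root_value_ge0.
  apply: le_trans le1 _; rewrite /root_value; case: ifPn => [|/norP[An Vn]].
    by move=> /orP[/eqP->|/eqP->]; rewrite ?mul0r ?expr0n ?(gtn_eqF M1) ?mulr0 (gtn_eqF scale_gt0).
  have {}A0 : 0 < A by rewrite lt_def An A0.
  have {}V0 : 0 < V by rewrite lt_def Vn V0.
  rewrite -[in leLHS](log2K A0) -[in leLHS](log2K V0) !pow2Xn -pow2D ler_pow2.
  have -> : scale.-1%:R = scale%:R - 1 :> R by rewrite -subn1 natrB // scale_gt0.
  have -> : 2 ^+ (8 * size w) = scale%:R :> R by rewrite natrX.
  have s0 : scale%:R != 0 :> R by rewrite pnatr_eq0 gtn_eqF // scale_gt0.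
  move: (log2 A) (log2 V) => x y; rewrite mulrDr mulrCA divff // mulr1.
  by lra.
Qed.

End Grid.

(** * The semidefinite program of a word *)

Section TwoByTwo.
Variable R : realType.

Lemma psd2 (P Q S : R) :
  (forall x y, 0 <= P * x ^+ 2 + 2 * Q * x * y + S * y ^+ 2) <->
  [/\ 0 <= P, 0 <= S & Q ^+ 2 <= P * S].
Proof.
split=> [h|[P0 S0 le1] x y].
  have P0 : 0 <= P by have := h 1 0; rewrite !(mulr0, mulr1, addr0, expr1n, expr0n).
  have S0 : 0 <= S by have := h 0 1; rewrite !(mulr0, mul0r, mulr1, add0r, expr1n, expr0n).
  split=> //; have [S1|S1] := ltP 0 S.
    have := h S (- Q); rewrite -[Q ^+ 2 <= _]subr_ge0.
    have -> : P * S ^+ 2 + 2 * Q * S * - Q + S * (- Q) ^+ 2 = S * (P * S - Q ^+ 2) by ring.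
    by rewrite pmulr_rge0.
  have SE : S = 0 by apply/eqP; rewrite eq_le S1.
  have [->|Q0] := eqVneq Q 0; first by rewrite expr0n SE mulr0.
  have := h 1 (- (P + 1) / (2 * Q)).
  have -> : P * 1 ^+ 2 + 2 * Q * 1 * (- (P + 1) / (2 * Q)) + S * (- (P + 1) / (2 * Q)) ^+ 2 = -1.
    by rewrite SE; field.
  by rewrite oppr_ge0 ler10.
have [P1|P1] := ltP 0 P.
  rewrite -(pmulr_rge0 _ P1).
  have -> : P * (P * x ^+ 2 + 2 * Q * x * y + S * y ^+ 2) =
     (P * x + Q * y) ^+ 2 + (P * S - Q ^+ 2) * y ^+ 2 by ring.
  by apply: addr_ge0; rewrite ?sqr_ge0 //; apply: mulr_ge0; rewrite ?sqr_ge0 ?subr_ge0.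
have PE : P = 0 by apply/eqP; rewrite eq_le P1.
have QE : Q = 0.
  move: le1; rewrite PE mul0r real_exprn_even_le0 ?num_real //= => /eqP.
  by [].
by rewrite PE QE !(mul0r, mulr0, add0r); apply: mulr_ge0; rewrite ?sqr_ge0.
Qed.

Lemma quad_formE (T : finType) (N : T -> T -> R) (u : T -> R) :
  ((\col_(i < #|T|) u (enum_val i))^T
    *m \matrix_(r < #|T|, s < #|T|) N (enum_val r) (enum_val s)
    *m (\col_(i < #|T|) u (enum_val i))) 0 0 =
  \sum_r \sum_s u r * N r s * u s.
Proof.
rewrite mxE (reindex_onto (@enum_rank T) enum_val) /=; last first.
  by move=> i _; rewrite enum_valK.
rewrite (eq_bigl predT); last by move=> s; rewrite enum_rankK eqxx.
rewrite exchange_big /=; apply: eq_bigr => s _.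
rewrite !mxE mulr_suml (reindex_onto (@enum_rank T) enum_val) /=; last first.
  by move=> i _; rewrite enum_valK.
rewrite (eq_bigl predT); last by move=> r; rewrite enum_rankK eqxx.
by apply: eq_bigr => r _; rewrite !mxE !enum_rankK.
Qed.

(** A block diagonal quadratic form is the sum of the forms of its blocks, and each of them
is recovered on vectors supported by one block. *)
Lemma psd_blocks (K : finType) (F : K -> bool -> bool -> R) :
  (forall b, F b true false = F b false true) ->
  psd (\matrix_(r < #|{: K * bool}|, s < #|{: K * bool}|)
     (if (enum_val r).1 == (enum_val s).1
      then F (enum_val r).1 (enum_val r).2 (enum_val s).2 else 0)) <->
  (forall b, [/\ 0 <= F b false false, 0 <= F b true true &
     F b false true ^+ 2 <= F b false false * F b true true]).
Proof.
move=> Fsym; set M := \matrix_(r, s) _.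
pose N (r s : K * bool) := if r.1 == s.1 then F r.1 r.2 s.2 else 0.
have quad u : ((\col_(i < #|{: K * bool}|) u (enum_val i))^T *m M *m (\col_(i < #|{: K * bool}|) u (enum_val i))) 0 0 =
   \sum_b (F b false false * u (b, false) ^+ 2 +
     2 * F b false true * u (b, false) * u (b, true) + F b true true * u (b, true) ^+ 2).
  rewrite (quad_formE N) /=.
  rewrite (eq_bigr (fun r => \sum_s u (r.1, r.2) * N (r.1, r.2) s * u s)); last by case.
  rewrite -(pair_bigA _ (fun b x => \sum_s u (b, x) * N (b, x) s * u s)) /=.
  apply: eq_bigr => b _.
  have row x : \sum_s u (b, x) * N (b, x) s * u s =
     \sum_y u (b, x) * F b x y * u (b, y).
    rewrite (eq_bigr (fun s => u (b, x) * N (b, x) (s.1, s.2) * u (s.1, s.2))); last by case.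
    rewrite -(pair_bigA _ (fun c y => u (b, x) * N (b, x) (c, y) * u (c, y))) /=.
    rewrite (bigD1 b) //= [X in _ + X]big1 ?addr0.
      by apply: eq_bigr => y _; rewrite /N eqxx.
    move=> c cb; apply: big1 => y _; rewrite /N /= eq_sym (negPf cb).
    by rewrite mulr0 mul0r.
  rewrite !big_bool /= !row !big_bool /= Fsym; ring.
split=> [[_ psdM] b|h].
  apply/psd2 => x y.
  pose u (r : K * bool) := if r.1 == b then if r.2 then y else x else 0.
  have := psdM (\col_(i < #|{: K * bool}|) u (enum_val i)); rewrite quad (bigD1 b) //= big1 ?addr0.
    by rewrite /u /= eqxx.
  by move=> c cb; rewrite /u /= (negPf cb) expr0n !mulr0 !addr0.
split.
  apply/matrixP => r s; rewrite !mxE eq_sym; case: eqP => // ->.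
  by case: (enum_val r).2; case: (enum_val s).2; rewrite ?Fsym.
move=> v; pose u (r : K * bool) := v (enum_rank r) 0.
have -> : v = \col_(i < #|{: K * bool}|) u (enum_val i).
  by apply/colP => i; rewrite mxE /u enum_valK.
rewrite quad; apply: sumr_ge0 => b _; exact: (psd2 _ _ _).2 (h b) _ _.
Qed.

End TwoByTwo.

(** The lists of rules have different lengths; they are filled up with a rule that always
holds. *)
Definition no_rule {T : Type} : block T := Block [::] [::] [::].

Definition block_entry T (b : block T) (r s : bool) : seq (option T) :=
  match r, s with
  | false, false => b_ul b
  | true, true => b_lr b
  | _, _ => b_off b
  end.

Definition num_rules : nat :=
  \max_(v : option (pstate * symbol) * option (pstate * symbol) * bool)
    size (grid_rules v.1.1 v.1.2 v.2).

Section Program.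
Variable w : seq symbol.

Notation cell_at i := (onth (annotate parse pstate0 w) i).

Definition place : finType := 'I_(size w).+1.
Definition sdp_var : finType := (place * place * kind)%type.
Definition sdp_block : finType := (place * place * 'I_num_rules)%type.

Definition rule_of (b : sdp_block) : block (kind * mode) :=
  let: (i, j, a) := b in
  nth no_rule (grid_rules (cell_at i) (cell_at j) (i == j :> nat)) a.

Definition names_var (b : sdp_block) (v : sdp_var) (x : option (kind * mode)) : bool :=
  if x is Some (k, m) then
    (k == v.2) && (target m b.1.1 b.1.2 == (v.1.1 : nat, v.1.2 : nat))
  else false.

Definition coef (P : option (kind * mode) -> bool) (r s : sdp_block * bool) : nat :=
  if r.1 == s.1 then count P (block_entry (rule_of r.1) r.2 s.2) else 0%N.

Definition is_one (x : option (kind * mode)) : bool := ~~ isSome x.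

Lemma coef_sym P (r s : sdp_block * bool) :
  coef P r s = coef P s r.
Proof.
rewrite /coef eq_sym; case: eqP => // ->.
by case: r s => [? []] [? []].
Qed.

Definition sdp_matrix (N : sdp_block * bool -> sdp_block * bool -> rat) :=
  \matrix_(r < #|{: sdp_block * bool}|, s < #|{: sdp_block * bool}|)
     N (enum_val r) (enum_val s).

Definition var_entry (v : sdp_var) (r s : sdp_block * bool) : rat :=
  (coef (names_var r.1 v) r s)%:R.

(** The sign is changed because the constant matrix is subtracted. *)
Definition const_entry (r s : sdp_block * bool) : rat := - (coef is_one r s)%:R.

Lemma var_matrix_sym v : (sdp_matrix (var_entry v))^T = sdp_matrix (var_entry v).
Proof.
apply/matrixP => r s; rewrite !mxE /var_entry coef_sym /coef.
by case: eqP => // ->.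
Qed.

Lemma const_matrix_sym : (sdp_matrix const_entry)^T = sdp_matrix const_entry.
Proof. by apply/matrixP => r s; rewrite !mxE /const_entry coef_sym. Qed.

Definition word_sdp : sdp_instance :=
  @SDP #|{: sdp_block * bool}| #|sdp_var|
    (fun k => sdp_matrix (var_entry (enum_val k))) (sdp_matrix const_entry)
    (fun k => var_matrix_sym _) const_matrix_sym.

Variable R : realType.

(** Unknowns outside the grid count as 0, so that a rule may refer to a position beyond its
border. *)
Definition unknown (x : 'I_#|sdp_var| -> R) (k : kind) (i j : nat) : R :=
  if insub i is Some i' then
    if insub j is Some j' then x (enum_rank ((i', j', k) : sdp_var)) else 0
  else 0.

Lemma sum_names_var x (i j : place) a (r : option (kind * mode)) :
  \sum_(v : sdp_var) x (enum_rank v) * (names_var (i, j, a) v r)%:R +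
    (is_one r)%:R = oapp (grid_value (unknown x) i j) 1 r.
Proof.
case: r => [[k m]|]; last first.
  by rewrite /= big1 ?add0r // => v _; rewrite mulr0.
rewrite addr0 /= /grid_value /unknown /=.
case: insubP => [i' _ i'E|iN]; last first.
  apply: big1 => -[[i1 j1] k1] _; rewrite /names_var /=.
  rewrite (_ : (target _ _ _ == _) = false) ?andbF ?mulr0 //.
  by apply/negP => /eqP E; move: iN; rewrite E /= ltn_ord.
case: insubP => [j' _ j'E|jN]; last first.
  apply: big1 => -[[i1 j1] k1] _; rewrite /names_var /=.
  rewrite (_ : (target _ _ _ == _) = false) ?andbF ?mulr0 //.
  by apply/negP => /eqP E; move: jN; rewrite E /= ltn_ord.
rewrite (bigD1 (i', j', k)) //= /names_var /= eqxx i'E j'E -surjective_pairing eqxx mulr1.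
rewrite big1 ?addr0 // => -[[i1 j1] k1] ne; rewrite (_ : _ && _ = false) ?mulr0 //=.
apply/negP => /andP[/eqP kE /eqP tE]; move: ne; rewrite -kE.
suff [-> ->] : i1 = i' /\ j1 = j' by rewrite eqxx.
by split; apply: val_inj; rewrite ?i'E ?j'E tE.
Qed.

Lemma word_sdp_entry (x : 'I_#|sdp_var| -> R) :
  \sum_k x k *: map_mx ratr (@sdp_A word_sdp k) - map_mx ratr (sdp_B word_sdp) =
  \matrix_(r < #|{: sdp_block * bool}|, s < #|{: sdp_block * bool}|)
     (if (enum_val r).1 == (enum_val s).1
      then let: (i, j, a) := (enum_val r).1 in
           lsum (grid_value (unknown x) i j)
             (block_entry (rule_of (i, j, a)) (enum_val r).2 (enum_val s).2)
      else 0).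
Proof.
apply/matrixP => r s; rewrite !mxE summxE.
rewrite (reindex_onto (@enum_rank sdp_var) enum_val) /=; last first.
  by move=> i _; rewrite enum_valK.
rewrite (eq_bigl predT); last by move=> v; rewrite enum_rankK eqxx.
under eq_bigr => v _ do rewrite !mxE enum_rankK /var_entry ratr_nat.
rewrite /const_entry rmorphN /= ratr_nat opprK /coef.
move: (enum_val r) (enum_val s) => -[[[i j] a] p] [b' q] /=.
case: eqP => _; last by rewrite big1 ?addr0 // => v _; rewrite mulr0.
elim: (block_entry _ _ _) => [|y l IH] /=.
  by rewrite lsum0 addr0 big1 // => v _; rewrite mulr0.
rewrite /lsum big_cons -/(lsum _ _) -IH -(sum_names_var x i j a).
under eq_bigr => v _ do rewrite natrD mulrDr.
by rewrite big_split /= natrD addrACA.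
Qed.

Lemma word_sdp_feasible_grid :
  sdp_feasible R word_sdp <-> exists x, grid_ok w (unknown x).
Proof.
have all_rules (v : kind * mode -> R) x y b :
  all_hold v (grid_rules x y b) <->
  forall a : 'I_num_rules, holds v (nth no_rule (grid_rules x y b) a).
  have szN : (size (grid_rules x y b) <= num_rules)%N.
    by rewrite /num_rules (bigD1 (x, y, b)) //= leq_maxl.
  have triv : holds v no_rule by rewrite /holds /= !lsum0 expr0n mulr0.
  have nthE bs : all_hold v bs <-> forall n, holds v (nth no_rule bs n).
    elim: bs => [|c bs IH] /=; first by split=> // _ n; rewrite nth_nil.
    rewrite IH; split=> [[h1 h2] [|n]|h] //=; split; first exact: (h 0%N).
    by move=> n; apply: (h n.+1).
  rewrite nthE; split=> [h a|h n]; first exact: h.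
  have [nN|Nn] := ltnP n num_rules; first exact: (h (Ordinal nN)).
  by rewrite nth_default // (leq_trans szN).
suff E x : psd (\sum_k x k *: map_mx ratr (@sdp_A word_sdp k) -
    map_mx ratr (sdp_B word_sdp)) <-> grid_ok w (unknown x).
  by split=> -[x /E h]; exists x.
rewrite word_sdp_entry.
rewrite (psd_blocks (F := fun (b : sdp_block) p q => let: (i, j, a) := b in
   lsum (grid_value (unknown x) i j) (block_entry (rule_of (i, j, a)) p q)));
  last by move=> [[i j] a].
split=> [h i j iw jw|h [[i j] a]].
  apply/all_rules => a.
  pose i' : place := Ordinal (iw : (i < (size w).+1)%N).
  pose j' : place := Ordinal (jw : (j < (size w).+1)%N).
  exact: (h (i', j', a)).
have := h i j (ltn_ord i) (ltn_ord j).
by move=> /all_rules/(_ a).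
Qed.

End Program.

(** * The loop program that writes the semidefinite program *)

Lemma peval_seqs (S Q T : finType) (l : seq (Q * S)) (Ps : seq (pprog S Q T)) pos :
  peval l (foldr (@PSeq S Q T) (Emit (fun=> [::])) Ps) pos =
  flatten [seq peval l P pos | P <- Ps].
Proof. by elim: Ps => //= P Ps ->. Qed.

Notation ptr i := (@Ordinal 6 i isT).

(** Pointers 0 and 1 give the two positions of an unknown, pointers 2 and 3 those of the
block of a row, and pointers 4 and 5 those of the block of a column. *)
Definition wview : Type := view symbol pstate 'I_6.

Definition same (v : wview) (p q : 'I_6) : bool := v.2 (p, q) == Some true.
Definition succ (v : wview) (p q : 'I_6) : bool := v.2 (p, q) == Some false.

(** The pair of pointers 0 and 1 is the target of a mode, seen from pointers 2 and 3. *)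
Definition hits (v : wview) (m : mode) : bool :=
  match m with
  | Here => same v (ptr 2) (ptr 0) && same v (ptr 3) (ptr 1)
  | Next => succ v (ptr 2) (ptr 0) && succ v (ptr 3) (ptr 1)
  | Row => same v (ptr 2) (ptr 0) && same v (ptr 2) (ptr 1)
  | RowNext => succ v (ptr 2) (ptr 0) && succ v (ptr 2) (ptr 1)
  | Col => same v (ptr 3) (ptr 0) && same v (ptr 3) (ptr 1)
  | Right => same v (ptr 2) (ptr 0) && succ v (ptr 3) (ptr 1)
  end.

Definition seen_coef (P : option (kind * mode) -> bool) (v : wview)
    (ar bs : 'I_num_rules * bool) : nat :=
  if [&& same v (ptr 2) (ptr 4), same v (ptr 3) (ptr 5) & ar.1 == bs.1] then
    count P (block_entry
      (nth no_rule (grid_rules (v.1 (ptr 2)) (v.1 (ptr 3)) (same v (ptr 2) (ptr 3))) ar.1)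
      ar.2 bs.2)
  else 0%N.

Definition seen_var_entry (k : kind) (v : wview) (ar bs : 'I_num_rules * bool) : rat :=
  (seen_coef (fun x => if x is Some (k', m) then (k' == k) && hits v m else false)
    v ar bs)%:R.

Definition seen_const_entry (v : wview) (ar bs : 'I_num_rules * bool) : rat :=
  - (seen_coef is_one v ar bs)%:R.

Notation prog := (pprog symbol pstate 'I_6).
Notation pcat := (foldr (@PSeq symbol pstate 'I_6) (Emit (fun=> [::]))).

Definition rule_rows := enum {: 'I_num_rules * bool}.

Definition matrix_prog (N : wview -> 'I_num_rules * bool -> 'I_num_rules * bool -> rat) :
    prog :=
  For (ptr 2) (For (ptr 3) (pcat [seq
    PSeq (For (ptr 4) (For (ptr 5) (pcat [seq
      Emit (fun v => rcons (enc_rat (N v ar bs)) Comma) | bs <- rule_rows])))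
      (Emit (fun=> [:: Semicolon]))
    | ar <- rule_rows])).

Definition sdp_prog : prog :=
  PSeq
    (For (ptr 0) (For (ptr 1) (pcat [seq
      PSeq (matrix_prog (seen_var_entry k)) (Emit (fun=> [:: Bar]))
      | k <- enum {: kind}])))
    (PSeq (matrix_prog seen_const_entry) (Emit (fun=> [:: Bar]))).

Lemma nests_fresh_seqs (S Q T : finType) (X : Type) busy
    (F : X -> pprog S Q T) (s : seq X) :
  (forall x, nests_fresh busy (F x)) ->
  nests_fresh busy (foldr (@PSeq S Q T) (Emit (fun=> [::])) [seq F x | x <- s]).
Proof. by move=> FP; elim: s => //= x s ->; rewrite FP. Qed.

Lemma nests_fresh_matrix busy N : ptr 2 \notin busy -> ptr 3 \notin busy ->
  ptr 4 \notin busy -> ptr 5 \notin busy -> nests_fresh busy (matrix_prog N).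
Proof.
move=> b2 b3 b4 b5 /=; rewrite b2 inE negb_or b3 /=.
apply: nests_fresh_seqs => ar /=.
rewrite !inE !negb_or b4 b5 /= andbT.
exact: nests_fresh_seqs.
Qed.

Lemma nests_fresh_sdp : nests_fresh [::] sdp_prog.
Proof.
have seqE busy (P1 P2 : prog) : nests_fresh busy (PSeq P1 P2) =
  nests_fresh busy P1 && nests_fresh busy P2 by [].
have forE busy p (P : prog) : nests_fresh busy (For p P) =
  (p \notin busy) && nests_fresh (p :: busy) P by [].
rewrite /sdp_prog seqE [X in _ && X]seqE nests_fresh_matrix // andbT 2!forE.
apply/and3P; split=> //.
by apply: nests_fresh_seqs => k; rewrite seqE nests_fresh_matrix.
Qed.

(** The enumeration of a product is lexicographic: one index of the matrices corresponds to
several nested loops. *)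
Lemma flatten_enum_pair (A B : finType) (X : Type) (f : A * B -> seq X) :
  flatten [seq f ab | ab <- enum {: A * B}] =
  flatten [seq flatten [seq f (a, b) | b <- enum B] | a <- enum A].
Proof.
have -> : enum {: A * B} = [seq (a, b) | a <- enum A, b <- enum B].
  by rewrite [LHS]enumT unlock.
elim: (enum A) => //= a s IH.
by rewrite map_cat flatten_cat IH -map_comp.
Qed.

Lemma flatten_enum_ord n (X : Type) (f : nat -> seq X) :
  flatten [seq f (nat_of_ord i) | i <- enum 'I_n] = flatten [seq f i | i <- iota 0 n].
Proof. by rewrite -val_enum_ord -map_comp. Qed.

Lemma flatten_enum_val (A : finType) (X : Type) (f : A -> seq X) :
  flatten [seq f (enum_val i) | i <- enum 'I_#|A|] = flatten [seq f a | a <- enum A].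
Proof.
congr flatten; rewrite (map_comp f); congr map.
case: (pickP A) => [a0 _|A0].
  apply: (@eq_from_nth _ a0); first by rewrite size_map size_enum_ord cardE.
  move=> i; rewrite size_map size_enum_ord => iA.
  rewrite (nth_map (Ordinal iA)) ?size_enum_ord //.
  by rewrite (enum_val_nth a0) /= nth_enum_ord.
have : size (enum A) = 0%N by rewrite -cardE eq_card0.
case: (enum A) (cardE A) => // E _.
by apply/nilP; rewrite /nilp size_map size_enum_ord E.
Qed.

Section Output.
Variable w : seq symbol.
Let l := annotate parse pstate0 w.

Lemma terminateE X (t : symbol) (f : X -> seq symbol) (s : seq X) :
  terminate t [seq f x | x <- s] = flatten [seq rcons (f x) t | x <- s].
Proof. by rewrite /terminate -map_comp. Qed.

Lemma peval_matrix (N : wview -> 'I_num_rules * bool -> 'I_num_rules * bool -> rat)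
    (M : sdp_block w * bool -> sdp_block w * bool -> rat) pos :
  (forall (i j i' j' : place w) (a b : 'I_num_rules) r s,
    N (view_at l (point (point (point (point pos (ptr 2) (i : nat)%:Z)
         (ptr 3) (j : nat)%:Z)
         (ptr 4) (i' : nat)%:Z)
         (ptr 5) (j' : nat)%:Z)) (a, r) (b, s)
    = M ((i, j, a), r) ((i', j', b), s)) ->
  peval l (matrix_prog N) pos = enc_matrix (sdp_matrix M).
Proof.
move=> NM; rewrite /enc_matrix terminateE /enc_row.
pose row r := rcons (flatten [seq rcons (enc_rat (M r s)) Comma
  | s <- enum {: sdp_block w * bool}]) Semicolon.
have -> : [seq rcons (terminate Comma [seq enc_rat (sdp_matrix M i j)
      | j <- enum 'I_#|{: sdp_block w * bool}|]) Semicolon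
    | i <- enum 'I_#|{: sdp_block w * bool}|] =
  [seq row (enum_val i) | i <- enum 'I_#|{: sdp_block w * bool}|].
  apply: eq_map => i; rewrite terminateE /row.
  rewrite -(flatten_enum_val (fun s => rcons (enc_rat (M (enum_val i) s)) Comma)).
  by congr (rcons (flatten _) _); apply: eq_map => j; rewrite mxE.
rewrite (flatten_enum_val row) 3!flatten_enum_pair /row.
have forE p P pos' : peval l (For p P) pos' =
    flatten [seq peval l P (point pos' p n%:Z) | n <- iota 0 (size w).+1].
  by rewrite -[size w](size_annotate parse pstate0).
have seqE P1 P2 pos' : peval l (PSeq P1 P2) pos' = peval l P1 pos' ++ peval l P2 pos' by [].
rewrite /matrix_prog.
rewrite forE -(flatten_enum_ord (size w).+1 (fun n => peval l _ (point _ _ n%:Z))); congr flatten; apply: eq_map => i.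
rewrite forE -(flatten_enum_ord (size w).+1 (fun n => peval l _ (point _ _ n%:Z))); congr flatten; apply: eq_map => j.
rewrite peval_seqs -map_comp flatten_enum_pair.
congr flatten; apply: eq_map => a; congr flatten; apply: eq_map => r.
rewrite /comp seqE -cats1; congr (_ ++ _).
rewrite flatten_enum_pair flatten_enum_pair flatten_enum_pair.
rewrite forE -(flatten_enum_ord (size w).+1 (fun n => peval l _ (point _ _ n%:Z))); congr flatten; apply: eq_map => i'.
rewrite forE -(flatten_enum_ord (size w).+1 (fun n => peval l _ (point _ _ n%:Z))); congr flatten; apply: eq_map => j'.
rewrite peval_seqs -map_comp flatten_enum_pair.
congr flatten; apply: eq_map => b; congr flatten; apply: eq_map => s /=.
by rewrite NM.
Qed.

Lemma same_view pos p q : same (view_at l pos) p q = (pos q == pos p).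
Proof.
rewrite /same ffunE /offset_mark /= subr_eq0; case: (pos q =P pos p) => // _.
by case: ifP.
Qed.

Lemma succ_view pos p q : succ (view_at l pos) p q = (pos q == pos p + 1).
Proof.
rewrite /succ ffunE /offset_mark /= subr_eq0 subr_eq addrC.
by case: (pos q =P pos p) => [->|_]; [apply/esym/negP => /eqP; lia | case: ifP].
Qed.

Lemma hits_view pos (k1 k2 i j : nat) m :
  pos (ptr 0) = k1%:Z -> pos (ptr 1) = k2%:Z ->
  pos (ptr 2) = i%:Z -> pos (ptr 3) = j%:Z ->
  hits (view_at l pos) m = (target m i j == (k1, k2)).
Proof.
move=> e0 e1 e2 e3; case: m => /=; rewrite ?same_view ?succ_view e0 e1 ?e2 ?e3;
by rewrite xpair_eqE -?PoszD !eqz_nat ?addn1 ![_ == k1]eq_sym ![_ == k2]eq_sym.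
Qed.

Lemma seen_coef_view (P : option (kind * mode) -> bool) pos (i j i' j' : place w) ar bs :
  pos (ptr 2) = (i : nat)%:Z -> pos (ptr 3) = (j : nat)%:Z ->
  pos (ptr 4) = (i' : nat)%:Z -> pos (ptr 5) = (j' : nat)%:Z ->
  seen_coef P (view_at l pos) ar bs =
  coef P ((i, j, ar.1), ar.2) ((i', j', bs.1), bs.2).
Proof.
move=> e2 e3 e4 e5; rewrite /seen_coef /coef !same_view !ffunE e2 e3 e4 e5 /=.
rewrite !eqz_nat [(i' : nat) == _]eq_sym [(j' : nat) == _]eq_sym [(j : nat) == i]eq_sym.
by rewrite !xpair_eqE -!val_eqE /= -andbA.
Qed.

Lemma sdp_prog_output :
  peval l sdp_prog (fun=> (size w).+1%:Z) = enc_sdp (word_sdp w).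
Proof.
have seqE P1 P2 pos' : peval l (PSeq P1 P2) pos' = peval l P1 pos' ++ peval l P2 pos' by [].
have forE p P pos' : peval l (For p P) pos' =
    flatten [seq peval l P (point pos' p n%:Z) | n <- iota 0 (size w).+1].
  by rewrite -[size w](size_annotate parse pstate0).
have -> : enc_sdp (word_sdp w) =
    flatten [seq rcons (enc_matrix (sdp_matrix (var_entry (enum_val k)))) Bar
            | k <- enum 'I_#|sdp_var w|] ++
    rcons (enc_matrix (sdp_matrix (@const_entry w))) Bar.
  by rewrite /enc_sdp /terminate map_rcons flatten_rcons -map_comp.
rewrite (flatten_enum_val (fun v => rcons (enc_matrix (sdp_matrix (var_entry v))) Bar)).
rewrite /sdp_prog seqE; congr (_ ++ _); last first.
  rewrite seqE -cats1; congr (_ ++ _); apply: peval_matrix => i j i' j' a b r s.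
  by rewrite /seen_const_entry /const_entry (seen_coef_view _ (i := i) (j := j) (i' := i') (j' := j')).
rewrite 2!flatten_enum_pair.
rewrite forE -(flatten_enum_ord (size w).+1 (fun n => peval l _ (point _ _ n%:Z))); congr flatten; apply: eq_map => k1.
rewrite forE -(flatten_enum_ord (size w).+1 (fun n => peval l _ (point _ _ n%:Z))); congr flatten; apply: eq_map => k2.
rewrite peval_seqs -map_comp; congr flatten; apply: eq_map => k.
rewrite /comp seqE -cats1; congr (_ ++ _); apply: peval_matrix => i j i' j' a b r s.
rewrite /seen_var_entry /var_entry (seen_coef_view _ (i := i) (j := j) (i' := i') (j' := j')) //.
congr (_%:R); rewrite /coef; case: eqP => // _; apply: eq_count => -[[k' m]|] //=.
by rewrite (hits_view (k1 := k1) (k2 := k2) (i := i) (j := j)).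
Qed.

End Output.

(** * Rounding approximate solutions *)

Section FromInstance.
Variables (R : realType) (M : nat).

Lemma le_big_maxe (x : nat -> \bar rat) (a : \bar rat) (vs : seq nat) :
  (a <= \big[maxe/-oo]_(u <- vs) x u)%E ->
  a = -oo%E \/ exists2 u, u \in vs & (a <= x u)%E.
Proof.
elim: vs => [|v vs IH]; first by rewrite big_nil leeNy_eq => /eqP ->; left.
rewrite big_cons le_max => /orP[h|/IH[->|[u uv h]]]; [|by left|].
- by right; exists v; rewrite ?inE ?eqxx.
- by right; exists u; rewrite ?inE ?uv ?orbT.
Qed.

Definition exp_value (a : \bar rat) : R :=
  if a is r%:E%E then pow2 (M%:R * ratr r) else 0.

Lemma exp_value_ge0 a : 0 <= exp_value a.
Proof. by case: a => [r| |] //=; apply: pow2_ge0. Qed.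

Lemma exp_value_le a b : b <> +oo%E -> (a <= b)%E -> exp_value a <= exp_value b.
Proof.
case: a b => [r| |] [s| |] //= _; rewrite ?lee_fin ?pow2_ge0 // => rs.
by rewrite ler_pow2 ler_wpM2l ?ler0n // ler_rat.
Qed.

Lemma soft_of_holds (x : nat -> \bar rat) C : (forall v, x v <> +oo%E) ->
  mpa_holds x C -> soft M (fun v => exp_value (x v)) C.
Proof.
move=> xfin; case: C => [v vs|v c u|v u w|v c] /=.
- move=> /le_big_maxe[->|[u uvs le1]]; first by rewrite sumr_ge0 // => *; apply: exp_value_ge0.
  apply: le_trans (exp_value_le (xfin u) le1) _.
  rewrite (big_rem u uvs) /= lerDl sumr_ge0 // => *; exact: exp_value_ge0.
- case: (x v) (xfin v) => [r| |] //=; last by rewrite ltxx.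
  case: (x u) (xfin u) => [s| |] //= _ _; rewrite lee_fin => rs _.
  rewrite pow2_gt0 !pow2K -mulrDr -rmorphD /= ler_wpM2l ?ler0n ?ler_rat //.
- case: (x v) (xfin v) => [r| |] //= _; last first.
    by move=> _; rewrite expr0n mulr_ge0 ?exp_value_ge0.
  case: (x u) (xfin u) => [s| |] // _.
  case: (x w) (xfin w) => [t| |] // _.
  rewrite lee_fin /= pow2Xn -pow2D ler_pow2 -(ler_rat R r) rmorphM rmorphD fmorphV /= ratr_nat.
  rewrite mulrCA -mulrDr => h; rewrite ler_wpM2l ?ler0n //; lra.
- by move=> -> /=; rewrite pow2_gt0 pow2K.
Qed.

End FromInstance.

Lemma lt_pos_digits p : (nat_of_bin (Npos p) < 2 ^ size (pos_digits p))%N.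
Proof.
by elim: p => //= p IH; rewrite !natTrecE expnS; move: IH => /=; lia.
Qed.

Lemma lt_enc_nat n : (n < 2 ^ size (enc_nat n))%N.
Proof.
rewrite /enc_nat -[X in (X < _)%N]bin_of_natK; case: bin_of_nat => // p.
exact: lt_pos_digits.
Qed.

Definition occurring (C : mpa_constraint) : seq nat :=
  match C with
  | LeMax v vs => v :: vs | LeShift v _ u => [:: v; u]
  | LeAvg v u w => [:: v; u; w] | EqConst v _ => [:: v]
  end.

Definition denominator (C : mpa_constraint) : nat :=
  match C with
  | LeShift _ c _ => `|denq c|%N | EqConst _ c => `|denq c|%N | _ => 1%N
  end.

Lemma size_terminate t ws : size (terminate t ws) = (\sum_(w <- ws) (size w).+1)%N.
Proof.
elim: ws => [|w ws IH]; first by rewrite big_nil.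
by rewrite big_cons -IH /terminate /= size_cat size_rcons.
Qed.

Lemma size_occurring C : (size (occurring C) <= size (enc_constraint C))%N.
Proof.
have szv vs : (size vs <= size (terminate Comma [seq enc_nat u | u <- vs]))%N.
  rewrite size_terminate big_map; elim: vs => // v vs IH.
  by rewrite big_cons /=; lia.
case: C => [v vs|v c u|v u w|v c] /=; first exact: leqW (szv (v :: vs)).
all: by rewrite size_terminate !big_cons big_nil; lia.
Qed.

Lemma lt_denominator C : (denominator C <= 2 ^ size (enc_constraint C))%N.
Proof.
have dq c n : (size (enc_rat c) <= n)%N -> (`|denq c| <= 2 ^ n)%N.
  move=> cn; apply: leq_trans (ltnW (lt_enc_nat _)) _; apply: leq_pexp2l => //.
  by apply: leq_trans cn; rewrite /enc_rat !size_cat /=; lia.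
by case: C => [v vs|v c u|v u w|v c] //=; rewrite ?expn_gt0 //; apply: dq;
  rewrite size_terminate !big_cons big_nil; lia.
Qed.

Definition all_occurring (I : mpa_instance) := flatten [seq occurring C | C <- I].
Definition common_denominator (I : mpa_instance) := (\prod_(C <- I) denominator C)%N.

(** The bounds below count symbols of the text: one digit at least for each occurrence of a
variable, and one for each bit of a denominator. *)
Lemma size_enc_mpa C I : size (enc_mpa (C :: I)) =
  ((size (enc_constraint C)).+1 + size (enc_mpa I))%N.
Proof. by rewrite /enc_mpa !size_terminate /= big_cons. Qed.

Lemma size_all_occurring I : (size (all_occurring I) <= size (enc_mpa I))%N.
Proof.
elim: I => // C I IH; rewrite size_enc_mpa /all_occurring /= size_cat.
exact: leq_add (leqW (size_occurring C)) IH.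
Qed.

Lemma common_denominator_le I : (common_denominator I <= 2 ^ size (enc_mpa I))%N.
Proof.
elim: I => [|C I IH]; first by rewrite /common_denominator big_nil.
rewrite size_enc_mpa /common_denominator big_cons expnD; apply: leq_mul => //.
apply: leq_trans (lt_denominator C) _; apply: leq_pexp2l => //.
Qed.

Lemma denominator_gt0 C : (0 < denominator C)%N.
Proof. by case: C => //= *; rewrite absz_gt0 denq_neq0. Qed.

Lemma common_denominator_gt0 I : (0 < common_denominator I)%N.
Proof. by apply: prodn_gt0 => C; apply: denominator_gt0. Qed.

Lemma In_denominator I C : List.In C I -> (denominator C %| common_denominator I)%N.
Proof.
elim: I => //= C' I IH; rewrite /common_denominator big_cons.
by move=> [->|/IH h]; [apply: dvdn_mulr | apply: dvdn_mull].
Qed.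

Lemma In_occurring I C v : List.In C I -> v \in occurring C -> v \in all_occurring I.
Proof.
elim: I => //= C' I IH; rewrite /all_occurring /= mem_cat.
by move=> [->|/IH h] vC; [rewrite vC | rewrite h ?orbT].
Qed.

Lemma In_size I C : List.In C I -> (size (occurring C) <= size (enc_mpa I))%N.
Proof.
elim: I => //= C' I IH; rewrite size_enc_mpa => -[->|/IH h]; last lia.
by have := size_occurring C; lia.
Qed.

Section RowLists.
Variables (R : realType) (k : nat).

Definition linear_row : Type := ('rV[int]_k.+1 * int)%type.

Definition row_holds (F : numFieldType) (z : 'cV[F]_k.+1) (ab : linear_row) : Prop :=
  (map_mx intr ab.1 *m z) 0 0 <= ab.2%:~R.

Lemma rational_rows (rs : seq linear_row) (z : 'cV[R]_k.+1) (c : int) :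
  1 <= c -> (forall ab, ab \in rs -> \sum_j `|ab.1 0 j| <= c) ->
  (forall ab, ab \in rs -> row_holds z ab) ->
  0 <= z 0 0 < (c%:~R ^+ k.+1)^-1 ->
  exists y : 'cV[rat]_k.+1, y 0 0 = 0 /\ forall ab, ab \in rs -> row_holds y ab.
Proof.
move=> c1 rsc rsz /andP[z0 zc].
pose rs' : seq linear_row := (- delta_mx 0 0, 0) :: rs.
pose A : 'M[int]_(size rs', k.+1) := \matrix_(i, j) (nth (0, 0) rs' i).1 0 j.
pose b : 'cV[int]_(size rs') := \col_i (nth (0, 0) rs' i).2.
have AE (F : numFieldType) (y : 'cV[F]_k.+1) i :
    (map_mx intr A *m y) i 0 = (map_mx intr (nth (0, 0) rs' i).1 *m y) 0 0.
  by rewrite !mxE; apply: eq_bigr => j _; rewrite !mxE.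
have rowP i : nth (0, 0) rs' i = (- delta_mx 0 0, 0) \/ nth (0, 0) rs' i \in rs \/
    nth (0, 0) rs' i = (0, 0).
  case: i => [|i]; first by left.
  have [h|h] := ltnP i (size rs); first by right; left; apply: mem_nth.
  by right; right; rewrite nth_default.
have [] := @small_slack_vanishes R _ _ A b z 0 (0 : 'I_(size rs).+1) c c1.
- move=> i; rewrite (eq_bigr (fun j => `|(nth (0, 0) rs' i).1 0 j|)); last first.
    by move=> j _; rewrite mxE.
  case: (rowP i) => [->|[/rsc//|->]] /=; last first.
    by rewrite big1 ?(le_trans _ c1) // => j _; rewrite mxE normr0.
  rewrite (bigD1 0) //= big1 ?addr0 => [|j j0]; first by rewrite !mxE eqxx normrN1.
  by rewrite !mxE (negPf j0) andbF oppr0 normr0.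
- by move=> j; rewrite /A mxE /= !mxE eqxx.
- by rewrite /b mxE.
- move=> i; rewrite AE /b [X in _ <= X%:~R]mxE.
  case: (rowP i) => [->|[/rsz//|->]] /=; last first.
    by rewrite map_mx0 mul0mx mxE.
  by rewrite map_mxN mulNmx mxE map_delta_mx -rowE mxE oppr_le0.
- exact: zc.
move=> d [y [d0 y0 yA]]; exists (d%:~R^-1 *: map_mx intr y); split.
  by rewrite !mxE y0 mulr0.
move=> ab abrs; have abi : (index ab rs < size rs)%N by rewrite index_mem.
pose i := lift ord0 (Ordinal abi).
have bi : b i 0 = ab.2 by rewrite /b mxE /= nth_index.
have Ai : (A *m y) i 0 = (ab.1 *m y) 0 0.
  by rewrite !mxE; apply: eq_bigr => j _; rewrite mxE /= nth_index.
have := yA i; rewrite bi Ai /row_holds -scalemxAr -map_mxM => le1.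
by rewrite 2!mxE mulrC.
Qed.

End RowLists.

(** The logarithms of a soft solution, divided by the scale, satisfy all constraints up to
an error in each maximum, which is taken as one more unknown, the slack. Everything is
multiplied by a common denominator of the constants to make the data integral. *)
Section Rounding.
Variables (R : realType) (I : mpa_instance) (x : nat -> R).
Let n := size (enc_mpa I).
Let M := (2 ^ (8 * n))%N.
Hypotheses (x_ge0 : forall v, 0 <= x v)
  (softI : forall C, List.In C I -> soft M x C).

Let vs := undup (all_occurring I).
Let D := common_denominator I.
Let k := size vs.

(** Column 0 is the slack, hence the successor. *)
Let column (v : nat) : 'I_k.+1 := inord (index v vs).+1.

Let z : 'cV[R]_k.+1 := \col_j
  if j == 0 then D%:R * n%:R / M%:R
  else D%:R * log2 (x (nth 0%N vs j.-1)) / M%:R.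

Let M_gt0 : 0 < M%:R :> R.
Proof. by rewrite ltr0n expn_gt0. Qed.

Let D_gt0 : (0 < D)%N.
Proof. exact: common_denominator_gt0. Qed.

Let z0E : z 0 0 = D%:R * n%:R / M%:R.
Proof. by rewrite mxE eqxx. Qed.

Let zE v : v \in vs -> z (column v) 0 = D%:R * log2 (x v) / M%:R.
Proof.
move=> vvs; have iv : (index v vs < k)%N by rewrite index_mem.
rewrite mxE /column; case: eqP => [/(congr1 val)/=|_].
  by rewrite inordK // ltnS.
by rewrite inordK ?ltnS //= nth_index.
Qed.

(** There are at most [n] variables and the common denominator is at most [2 ^ n]. *)
Let slack_small : 0 <= z 0 0 < ((4 : int)%:~R ^+ k.+1)^-1.
Proof.
rewrite z0E; apply/andP; split; first by rewrite divr_ge0 ?mulr_ge0 ?ler0n.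
rewrite -[X in _ < X]mul1r ltr_pdivlMr ?exprn_gt0 // mulrAC ltr_pdivrMr // mul1r.
have -> : (4 : int)%:~R = 4%:R :> R by [].
rewrite -natrX -!natrM ltr_nat.
have kn : (k <= n)%N by apply: leq_trans (size_undup _) (size_all_occurring I).
have Dn : (D <= 2 ^ n)%N by apply: common_denominator_le.
have [n0|n0] := posnP n; first by rewrite n0 muln0 mul0n expn_gt0.
apply: (@leq_ltn_trans (2 ^ n * n * 4 ^ n.+1)).
  by rewrite leq_mul ?leq_mul // leq_pexp2l.
rewrite (_ : 4 = 2 ^ 2)%N // -expnM.
apply: (@leq_trans (2 ^ n * 2 ^ n * 2 ^ (2 * n.+1))).
  by rewrite ltn_pmul2r ?expn_gt0 // ltn_pmul2l ?expn_gt0 // ltn_expl.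
by rewrite -!expnD leq_pexp2l //; lia.
Qed.

Definition rounded (y : 'cV[rat]_k.+1) (v : nat) : \bar rat :=
  if (0 < x v) && (v \in vs) then (y (column v) 0 / D%:R)%:E else -oo%E.

Let row_of (v : nat) : 'rV[int]_k.+1 := delta_mx 0 (column v).
Let slack_row : 'rV[int]_k.+1 := delta_mx 0 0.

Let apply_row (F : numFieldType) (a : 'rV[int]_k.+1) (y : 'cV[F]_k.+1) : F :=
  (map_mx intr a *m y) 0 0.

Let apply_row_delta (F : numFieldType) j (y : 'cV[F]_k.+1) :
  apply_row (delta_mx 0 j) y = y j 0.
Proof. by rewrite /apply_row map_delta_mx -rowE mxE. Qed.

Let apply_rowD (F : numFieldType) a b (y : 'cV[F]_k.+1) :
  apply_row (a + b) y = apply_row a y + apply_row b y.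
Proof. by rewrite /apply_row map_mxD mulmxDl mxE. Qed.

Let apply_rowN (F : numFieldType) a (y : 'cV[F]_k.+1) :
  apply_row (- a) y = - apply_row a y.
Proof. by rewrite /apply_row map_mxN mulNmx mxE. Qed.

Let apply_rowB (F : numFieldType) a b (y : 'cV[F]_k.+1) :
  apply_row (a - b) y = apply_row a y - apply_row b y.
Proof. by rewrite apply_rowD apply_rowN. Qed.

Let norm1 (a : 'rV[int]_k.+1) : int := \sum_j `|a 0 j|.

Let norm1D a b : norm1 (a + b) <= norm1 a + norm1 b.
Proof.
by rewrite /norm1 -big_split; apply: ler_sum => j _; rewrite mxE ler_normD.
Qed.

Let norm1N a : norm1 (- a) = norm1 a.
Proof. by apply: eq_bigr => j _; rewrite mxE normrN. Qed.

Let norm1_delta j : norm1 (delta_mx 0 j) = 1.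
Proof.
rewrite /norm1 (bigD1 j) //= big1 ?addr0 => [|i ij]; first by rewrite mxE !eqxx.
by rewrite mxE (negPf ij) andbF normr0.
Qed.

Let scaled (c : rat) : int := numq c * (D %/ `|denq c|)%N%:Z.

Let scaled_rat (c : rat) : (`|denq c| %| D)%N -> (scaled c)%:~R = D%:R * c.
Proof.
move=> cD; rewrite -[c in RHS]divq_num_den rmorphM /=.
rewrite -[in RHS](divnK cD) natrM.
have -> : (`|denq c|%N)%:R = (denq c)%:~R :> rat.
  by rewrite -[X in X%:R]/(`|denq c|%N) pmulrn gez0_abs.
have d0 : (denq c)%:~R != 0 :> rat by rewrite intr_eq0 denq_neq0.
by rewrite -pmulrn; field.
Qed.

Let scaled_real (c : rat) : (`|denq c| %| D)%N ->
  (scaled c)%:~R = D%:R * ratr c :> R.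
Proof.
by move=> cD; rewrite -ratr_int scaled_rat // rmorphM /= ratr_nat.
Qed.

Let DR_gt0 (F : numFieldType) : 0 < D%:R :> F.
Proof. by rewrite ltr0n. Qed.

Let roundedE y v : v \in vs -> 0 < x v ->
  rounded y v = (y (column v) 0 / D%:R)%:E.
Proof. by move=> vv xv0; rewrite /rounded xv0 vv. Qed.

Let rounded0 y v : ~~ (0 < x v) -> rounded y v = -oo%E.
Proof. by rewrite /rounded => /negPf ->. Qed.

(** Some term is at least the average of the sum, and [size us <= 2 ^ size us]. *)
Lemma max_witness v us : 0 < x v -> x v <= \sum_(u <- us) x u ->
  exists2 u, u \in us & 0 < x u /\ log2 (x v) <= (size us)%:R + log2 (x u).
Proof.
move=> v0 le1.
have [u uus ule] : exists2 u, u \in us & x v <= (size us)%:R * x u.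
  apply: contrapT => none.
  suff lt1 : forall s : seq nat, {subset s <= us} -> (0 < size s)%N ->
      (size us)%:R * (\sum_(u <- s) x u) < (size s)%:R * x v.
    case: us le1 none lt1 => [|u us] le1 none lt1.
      by move: le1; rewrite big_nil leNgt v0.
    have := lt1 (u :: us) (fun _ => id) isT.
    by rewrite ltr_pM2l ?ltr0n // ltNge le1.
  have ltu u : u \in us -> (size us)%:R * x u < x v.
    by move=> uus; rewrite ltNge; apply/negP => h; apply: none; exists u.
  elim=> // u [|u' s] IH sub _.
    by rewrite big_seq1 mul1r ltu // sub ?inE ?eqxx.
  rewrite big_cons mulrDr.
  have -> : (size [:: u, u' & s])%:R = 1 + (size (u' :: s))%:R :> R.
    by rewrite /= -nat1r.
  rewrite mulrDl mul1r.
  apply: ltrD; first by rewrite ltu // sub ?inE ?eqxx.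
  by apply: IH => // y ys; apply: sub; rewrite inE ys orbT.
have n0 : (0 < size us)%N by case: (us) uus.
have u0 : 0 < x u.
  have : 0 < (size us)%:R * x u by apply: lt_le_trans ule.
  by rewrite pmulr_rgt0 // ltr0n.
exists u => //; split=> //.
apply: (@le_trans _ _ (log2 (pow2 (size us)%:R * x u))).
  rewrite ler_log2 ?mulr_gt0 ?pow2_gt0 //; apply: le_trans ule _.
  rewrite ler_wpM2r ?ltW // -[X in pow2 X]mulr1 -pow2Xn pow2_1.
  by rewrite -natrX ltr_nat ltn_expl.
by rewrite log2M ?pow2_gt0 // pow2K.
Qed.

(** A maximum contributes one row, for a term that is large enough; a constraint on a
variable that is -oo contributes none. With slack 0 the rows give back the
constraint. *)
Lemma round_constraint C : List.In C I ->
  exists rs : seq (linear_row k),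
    (forall ab, ab \in rs -> norm1 ab.1 <= 4 /\ row_holds z ab) /\
    (forall y : 'cV[rat]_k.+1, y 0 0 = 0 ->
      (forall ab, ab \in rs -> row_holds y ab) -> mpa_holds (rounded y) C).
Proof.
move=> CI; have sC := softI CI.
have occ v : v \in occurring C -> v \in vs.
  by rewrite mem_undup; apply: In_occurring.
have dC := In_denominator CI; have szC := In_size CI.
have MR (a : R) : D%:R * a / M%:R = D%:R * (a / M%:R) by rewrite mulrA.
case: C {CI} sC occ dC szC => [v us|v c u|v u w|v c] /= sC occ dC szC.
- have [v0|v0] := boolP (0 < x v); last first.
    by exists [::]; split=> // y _ _; rewrite rounded0 ?leNye.
  have [u uus [u0 le1]] := max_witness v0 sC.
  have vv : v \in vs by rewrite occ ?inE ?eqxx.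
  have uv : u \in vs by rewrite occ ?inE ?uus ?orbT.
  exists [:: (row_of v - row_of u - slack_row, 0)]; split.
    move=> ab; rewrite inE => /eqP->; split=> /=.
      apply: le_trans (norm1D _ _) _; rewrite norm1N norm1_delta.
      apply: le_trans (lerD (norm1D _ _) (lexx _)) _.
      by rewrite norm1N !norm1_delta.
    rewrite /row_holds -/(apply_row _ _) !apply_rowB !apply_row_delta z0E !zE //.
    rewrite -!mulrBl pmulr_lle0 ?invr_gt0 // -!mulrBr pmulr_rle0 ?ltr0n //.
    have : (size us)%:R <= n%:R :> R by rewrite ler_nat; lia.
    by lra.
  move=> y y0 /(_ _ (mem_head _ _)).
  rewrite /row_holds -/(apply_row _ _) !apply_rowB !apply_row_delta y0 subr0 subr_le0 => le_sum_rule.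
  have -> : (rounded y v <= \big[maxe/-oo]_(u0 <- us) rounded y u0)%E; last by [].
  apply: (@le_trans _ _ (rounded y u)).
    by rewrite !roundedE // lee_fin ler_pM2r ?invr_gt0 ?DR_gt0.
  elim: us uus {sC occ szC le1} => // u' us IH.
  rewrite inE big_cons le_max => /orP[/eqP->|/IH ->]; rewrite ?lexx ?orbT //.
- have [v0|v0] := boolP (0 < x v); last first.
    by exists [::]; split=> // y _ _; rewrite rounded0 ?leNye.
  have [u0 le1] := sC v0.
  have vv : v \in vs by rewrite occ ?inE ?eqxx.
  have uv : u \in vs by rewrite occ ?inE ?eqxx ?orbT.
  exists [:: (row_of v - row_of u, scaled c)]; split.
    move=> ab; rewrite inE => /eqP->; split=> /=.
      apply: le_trans (norm1D _ _) _.
      by rewrite norm1N !norm1_delta.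
    rewrite /row_holds -/(apply_row _ _) apply_rowB !apply_row_delta !zE //.
    rewrite scaled_real // -mulrBl -mulrBr ler_pdivrMr // -mulrA ler_pM2l ?DR_gt0 //.
    by rewrite mulrC; move: le1; lra.
  move=> y y0 /(_ _ (mem_head _ _)).
  rewrite /row_holds -/(apply_row _ _) apply_rowB !apply_row_delta scaled_rat // => le_sum_rule.
  rewrite !roundedE // -EFinD lee_fin ler_pdivrMr ?DR_gt0 // mulrDl divfK ?gt_eqF ?DR_gt0 //.
  by move: le_sum_rule; lra.
- have [v0|v0] := boolP (0 < x v); last first.
    by exists [::]; split=> // y _ _; rewrite rounded0 ?leNye.
  have [u0 w0 le1] := avg_log2 v0 (x_ge0 u) (x_ge0 w) sC.
  have vv : v \in vs by rewrite occ ?inE ?eqxx.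
  have uv : u \in vs by rewrite occ ?inE ?eqxx ?orbT.
  have wv : w \in vs by rewrite occ ?inE ?eqxx ?orbT.
  exists [:: (row_of v + row_of v - row_of u - row_of w, 0)]; split.
    move=> ab; rewrite inE => /eqP->; split=> /=.
      apply: le_trans (norm1D _ _) _; rewrite norm1N norm1_delta.
      apply: le_trans (lerD (norm1D _ _) (lexx _)) _; rewrite norm1N norm1_delta.
      apply: le_trans (lerD (lerD (norm1D _ _) (lexx _)) (lexx _)) _.
      by rewrite !norm1_delta.
    rewrite /row_holds -/(apply_row _ _) !apply_rowB apply_rowD !apply_row_delta !zE //.
    rewrite -mulrDl -!mulrBl pmulr_lle0 ?invr_gt0 // -mulrDr -!mulrBr pmulr_rle0 ?DR_gt0 //.
    by move: le1; lra.
  move=> y y0 /(_ _ (mem_head _ _)).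
  rewrite /row_holds -/(apply_row _ _) !apply_rowB apply_rowD !apply_row_delta /= => le_sum_rule.
  rewrite !roundedE // -EFinD -EFinM lee_fin -mulrDl mulrAC ler_pM2r ?invr_gt0 ?DR_gt0 //.
  by move: le_sum_rule; lra.
- have [v0 lv] := sC.
  have vv : v \in vs by rewrite occ ?inE ?eqxx.
  have zv : z (column v) 0 = D%:R * ratr c.
    by rewrite zE // lv mulrCA mulrAC divff ?mul1r // gt_eqF.
  exists [:: (row_of v, scaled c); (- row_of v, - scaled c)]; split.
    move=> ab; rewrite !inE => /orP[]/eqP->; split=> /=; rewrite ?norm1N ?norm1_delta //;
    rewrite /row_holds -/(apply_row _ _) ?apply_rowN apply_row_delta /= ?rmorphN /=;
    by rewrite zv scaled_real // ?lerN2.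
  move=> y y0 h.
  have := h _ (mem_head _ _); have := h (- row_of v, - scaled c).
  rewrite !inE eqxx orbT => /(_ isT).
  rewrite /row_holds -!/(apply_row _ _) apply_rowN !apply_row_delta /= rmorphN /= lerN2.
  rewrite scaled_rat // => le1 le_sum_rule; rewrite roundedE //; congr (_%:E).
  have -> : y (column v) 0 = D%:R * c by apply/eqP; rewrite eq_le le1 le_sum_rule.
  by rewrite mulrAC divff ?mul1r // gt_eqF ?DR_gt0.
Qed.

Lemma solvable_of_soft : mpa_solvable I.
Proof.
have [rs [rsz rsE]] : exists rs : seq (linear_row k),
    (forall ab, ab \in rs -> norm1 ab.1 <= 4 /\ row_holds z ab) /\
    (forall y : 'cV[rat]_k.+1, y 0 0 = 0 ->
      (forall ab, ab \in rs -> row_holds y ab) ->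
      forall C, List.In C I -> mpa_holds (rounded y) C).
  have : forall C, List.In C I -> List.In C I by [].
  elim: {1 3}I => [|C J IH] JI; first by exists [::]; split.
  have [|rs1 [rs1z rs1E]] := IH; first by move=> C' C'J; apply: JI; right.
  have [rs2 [rs2z rs2E]] := round_constraint (JI C (or_introl erefl)).
  exists (rs2 ++ rs1); split.
    by move=> ab; rewrite mem_cat => /orP[/rs2z|/rs1z].
  move=> y y0 yrs C' [<-|C'J].
    by apply: rs2E => // ab abrs; apply: yrs; rewrite mem_cat abrs.
  by apply: rs1E => // ab abrs; apply: yrs; rewrite mem_cat abrs orbT.
have [| | | |y [y0 yrs]] := @rational_rows R k rs z 4.
- by [].
- by move=> ab /rsz[].
- by move=> ab /rsz[].
- exact: slack_small.
exists (rounded y); split; first by move=> v; rewrite /rounded; case: ifP.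
by apply: rsE.
Qed.

End Rounding.

(** * The reduction *)
Theorem theorem12 (R : realType) :
  poly_time_reducible mpa_encoding sdp_encoding mpa_solvable (sdp_feasible R).
Proof.
exists (fun I => word_sdp (enc_mpa I)); split.
  apply: (pprog_poly_time (q0 := pstate0) (delta := parse) nests_fresh_sdp) => I.
  exact: (esym (sdp_prog_output (enc_mpa I))).
move=> I; set w := enc_mpa I.
have M0 := scale_gt0 w.
have lastw : ~~ is_digit (last Semicolon w) by rewrite last_enc_mpa.
split.
- move=> [x [xfin xI]]; apply/word_sdp_feasible_grid.
  pose xv ds := exp_value R (scale w) (x (dval ds)).
  have xv0 ds : 0 <= xv ds by apply: exp_value_ge0.
  have [|D st] := complete_word M0 pstate0 (I := I) xv0.
    move=> C CI; have := @soft_of_holds R (scale w) x C xfin (xI C CI).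
    by congr soft; apply/funext => v; rewrite /xv dval_enc_nat.
  have ok := grid_complete st.
  pose X (k : 'I_#|sdp_var w|) := let v := enum_val k in grid_of w D v.2 v.1.1 v.1.2.
  exists X; rewrite (_ : unknown X = grid_of w D) //.
  apply/funext => k; apply/funext => i; apply/funext => j; rewrite /unknown.
  case: insubP => [i' iw i'E|iN]; last first.
    by rewrite /grid_of (negPf iN : (i <= size w)%N = false).
  case: insubP => [j' jw j'E|jN]; last first.
    by rewrite /grid_of (negPf jN : (j <= size w)%N = false) andbF.
  by rewrite /X enum_rankK /= i'E j'E.
- move=> /word_sdp_feasible_grid[x ok].
  have [xv [xv0 st]] := grid_sound ok lastw.
  apply: (solvable_of_soft (R := R) (x := fun v => xv (enc_nat v))) => // C CI.
  exact: sound_word st C CI.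
Qed.
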